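(* Let $\bm{T}$ be a $\bm{\sigma}$-Galton--Watson tree with type set $\mathfrak{G}$, and fix a type $\kappa\in\mathfrak{G}$. Let $(\mathcal{E}_n)_n$ be events with $\mathbb{P}(\mathcal{E}_n)>0$ for all $n$, and let $\bm{T}_n := (\bm{T}\mid \mathcal{E}_n)$. Suppose that $\mathbb{E}[\#_\kappa\bm{T}^\kappa]=2$ and that there is a deterministic sequence $s_n\to\infty$ such that for all $\epsilon>0$ $$\exp(-\epsilon s_n)=o(\mathbb{P}(\mathcal{E}_n))\qquad\text{and}\qquad \mathbb{P}(\#_\kappa\bm{T}_n\ge s_n)\to 1 .$$ Let $v_n^\kappa$ denote a uniformly selected type $\kappa$ vertex of $\bm{T}_n$. Then $$\mathfrak{L}((\bm{T}_n,v_n^\kappa)\mid\bm{T}_n)\xrightarrow{\;p\;}\mathfrak{L}(\hat{\bm{T}}(\kappa)).$$ That is, given a finite $\mathfrak{G}$-type plane tree $T$ with root type $\kappa$ and a type $\kappa$ vertex $v$ of $T$, $$\frac{N_{(T,v)}(\bm{T}_n)}{\#_\kappa\bm{T}_n}\xrightarrow{\;p\;}\mathbb{P}\big(f^{\kappa,[h]}(\hat{\bm{T}}(\kappa))=(T,v)\big),$$ with $h+1$ denoting the number of vertices of type $\kappa$ on the path from the root to $v$ in $T$.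
   Context: All limits are as $n\to\infty$; $\xrightarrow{p}$ is convergence in probability; $\mathfrak{L}$ denotes (conditional) laws. Types and trees. $\mathfrak{G}$ is a countable non-empty set of types. A $\mathfrak{G}$-type plane tree is a rooted ordered tree, each vertex having finitely many children, with a type in $\mathfrak{G}$ assigned to each vertex. $\#_iT$ is the number of vertices of type $i$ in $T$. The fringe subtree at a vertex is the tree formed by that vertex and all its descendants. Branching trees. $\bm{\sigma}=(\bm{\sigma}_i)_{i\in\mathfrak{G}}$ is an independent family of random finite words over $\mathfrak{G}$. The $\bm{\sigma}$-Galton--Watson tree $\bm{T}$ has root type given by an independent random type $\alpha$, and each vertex of type $i$ independently receives an ordered list of children with types given by an independent copy of $\bm{\sigma}_i$. Standing assumptions: $\mathbb{P}(\#_i\bm{T}\ne0)>0$ for all $i\in\mathfrak{G}$, and $\bm{T}$ is almost surely finite. $\bm{T}(\kappa)$ is the same tree started with a root of type $\kappa$. $\bm{T}^\kappa$ is defined like $\bm{T}(\kappa)$, except that non-root vertices of type $\kappa$ receive no offspring. The limit tree. When $\mathbb{E}[\#_\kappa\bm{T}^\kappa]=2$, $\hat{\bm{T}}^\kappa$ is the random marked tree with $\mathbb{P}(\hat{\bm{T}}^\kappa=(T,u))=\mathbb{P}(\bm{T}^\kappa=T)$ for every $\mathfrak{G}$-type tree $T$ (root of type $\kappa$, non-root type $\kappa$ vertices without offspring) and every non-root vertex $u$ of $T$ of type $\kappa$. The infinite tree $\hat{\bm{T}}(\kappa)$, marked at $u_0$, is built as follows: $u_0$ has type $\kappa$ and is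 the root of an independent copy of $\bm{T}(\kappa)$; for each $i\ge1$, $u_i$ is the root of an independent copy of $\hat{\bm{T}}^\kappa$, whose marked vertex is identified with $u_{i-1}$ and whose non-marked, non-root vertices of type $\kappa$ become roots of independent copies of $\bm{T}(\kappa)$. So $u_0$ has infinitely many ancestors (the spine). Marked trees. For a marked tree $(T_1,v_1)$, $f^{\kappa,[h]}(T_1,v_1)$ is the fringe subtree at that ancestor $w$ of $v_1$ (possibly $v_1$ itself) which has type $\kappa$ and for which the path from $w$ to $v_1$ contains precisely $h+1$ vertices of type $\kappa$ (endpoints included), marked at $v_1$; if no such $w$ exists it returns $(T_1,v_1)$ together with an overflow flag. For $(T,v)$ with $h+1$ type $\kappa$ vertices on the path from the root to $v$, $N_{(T,v)}(T_1)$ is the number of vertices $u$ of $T_1$ with $f^{\kappa,[h]}(T_1,u)=(T,v)$ without overflow. Similarly $f^{[h]}(T_1,v_1)$ is the fringe subtree at the $h$-th ancestor of $v_1$ (the $0$-th being $v_1$), marked at $v_1$; if that ancestor does not exist it is $(T_1,v_1)$ with an overflow flag. Space and convergence. $\mathfrak{X}$ is the set of all finite marked $\mathfrak{G}$-type plane trees together with all locally finite $\mathfrak{G}$-type plane trees having a marked vertex with a countably infinite number of ancestors (hence no root) and all $f^{[h]}$ finite. Its metric is $d(T_1^\bullet,T_2^\bullet)=2$ if $f^{[0]}(T_1^\bullet)\neq f^{[0]}(T_2^\bullet)$, and $2^{-\sup\{h\ge0:\,f^{[h]}(T_1^\bullet)=f^{[h]}(T_2^\bullet)\}}$ otherwise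 ($2^{-\infty}=0$). The conditional law $\mathfrak{L}((\bm{T}_n,v_n^\kappa)\mid\bm{T}_n)$ is the random Borel probability measure on $\mathfrak{X}$ which is uniform on the pairs $(\bm{T}_n,v)$, $v$ a type $\kappa$ vertex of $\bm{T}_n$ (arbitrary if there is none); convergence in probability is with respect to the topology of weak convergence of probability measures on $\mathfrak{X}$. *)

(* Defs.v *)
From HB Require Import structures.
From mathcomp Require Import all_boot all_order all_algebra.
From mathcomp Require Import all_classical all_reals all_analysis.

Set Implicit Arguments.
Unset Strict Implicit.
Unset Printing Implicit Defensive.
Import Order.TTheory GRing.Theory Num.Theory.
Import numFieldNormedType.Exports.
Local Open Scope classical_set_scope.
Local Open Scope ring_scope.

Section Imap.
Variables (A B : Type) (f : nat -> A -> B).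

Fixpoint imap (k : nat) (s : seq A) : seq B :=
  if s is x :: s' then f k x :: imap k.+1 s' else [::].

End Imap.

Section Trees.
Variable G : Type.

Inductive tree : Type := Node of G & seq tree.

Definition root_type (t : tree) : G := let: Node i _ := t in i.

End Trees.

HB.instance Definition _ (G : Type) := gen_eqMixin (tree G).
HB.instance Definition _ (G : Type) := gen_choiceMixin (tree G).

Section Vertices.
Variable G : countType.

(* A vertex is encoded by its Ulam-Harris address: the empty word is the root
   and [rcons u k] is the child number [k] (from 0) of [u]. *)
Fixpoint vertices (t : tree G) : seq (seq nat) :=
  let: Node _ ts := t in
  [::] :: flatten (imap (fun k t' => [seq k :: u | u <- vertices t']) 0 ts).

Fixpoint subtree (t : tree G) (u : seq nat) : option (tree G) :=
  if u is k :: u' then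
    let: Node _ ts := t in
    if onth ts k is Some t' then subtree t' u' else None
  else Some t.

Definition type_at (t : tree G) (u : seq nat) : option G :=
  omap (@root_type G) (subtree t u).

Definition typed_vertices (i : G) (t : tree G) : seq (seq nat) :=
  [seq u <- vertices t | type_at t u == Some i].

Definition ntype (i : G) (t : tree G) : nat := size (typed_vertices i t).

Definition path_ntype (i : G) (t : tree G) (u : seq nat) : nat :=
  count (fun j => type_at t (take j u) == Some i) (iota 0 (size u).+1).

(* [c u i] is the word of children types used at address [u] if the vertex
   there has type [i]; [realizes c i t] says that growing a tree from a root of
   type [i] by means of [c] yields precisely the finite tree [t]. *)
Definition realizes (c : seq nat -> G -> seq G) (i : G) (t : tree G) : Prop :=
  root_type t = i /\
  forall u j ts, subtree t u = Some (Node j ts) ->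
    c u j = [seq root_type t' | t' <- ts].

(* The tree grown from [c]; there is at most one finite tree satisfying
   [realizes c i], and the single-vertex tree is a junk value for the case where
   the growth does not stop. *)
Definition grown (c : seq nat -> G -> seq G) (i : G) : tree G :=
  xget (Node i [::]) [set t | realizes c i t].

Definition stop_at (k : G) (c : seq nat -> G -> seq G) :
    seq nat -> G -> seq G :=
  fun u i => if (i == k) && (u != [::]) then [::] else c u i.

(* Replaces each non-root vertex of type [k] at an address [v != m] (together
   with its descendants) by [s v]; [u] is the address of the current vertex. *)
Fixpoint graft (k : G) (m : seq nat) (s : seq nat -> tree G)
    (u : seq nat) (t : tree G) : tree G :=
  let: Node i ts := t in
  if [&& i == k, u != [::] & u != m] then s u
  else Node i (imap (fun j t' => graft k m s (rcons u j) t') 0 ts).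

End Vertices.

Section MarkedTrees.
Variable G : countType.

(* Marked trees are represented by zippers. A frame describes a proper ancestor
   [w] of the marked vertex: its type and the fringe subtrees at the children of
   [w] standing before, resp. after, the child through which the path to the
   marked vertex goes. Frames are listed from the parent of the marked vertex
   upwards; the first argument of the constructors is the fringe subtree at the
   marked vertex. All the fringe subtrees at ancestors of the marked vertex are
   finite by construction. *)
Definition frame : Type := (G * seq (tree G) * seq (tree G))%type.

Inductive mtree : Type :=
| FinM of tree G & seq frame
| InfM of tree G & (nat -> frame).

Fixpoint focus (t : tree G) (u : seq nat) (fs : seq frame) :
    tree G * seq frame :=
  if u is k :: u' then
    let: Node i ts := t in
    if onth ts k is Some t' then
      focus t' u' ((i, take k ts, drop k.+1 ts) :: fs)
    else (t, fs)
  else (t, fs).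

(* Only meaningful when [u] is a vertex of [t]. *)
Definition mark (t : tree G) (u : seq nat) : mtree :=
  let: (t', fs) := focus t u [::] in FinM t' fs.

Definition up (h : nat) (x : mtree) : option mtree :=
  match x with
  | FinM t fs => if (h <= size fs)%N then Some (FinM t (take h fs)) else None
  | InfM t fs => Some (FinM t (mkseq fs h))
  end.

Definition ancestor_type (h : nat) (x : mtree) : option G :=
  match h, x with
  | 0%N, FinM t _ | 0%N, InfM t _ => Some (root_type t)
  | h'.+1, FinM _ fs => omap (fun f : frame => f.1.1) (onth fs h')
  | h'.+1, InfM _ fs => Some (fs h').1.1
  end.

(* The boolean is the overflow flag. *)
Definition fringe (h : nat) (x : mtree) : mtree * bool :=
  if up h x is Some y then (y, false) else (x, true).

Definition is_typed_ancestor (k : G) (h : nat) (x : mtree) (j : nat) : bool :=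
  (ancestor_type j x == Some k) &&
  (count (fun l => ancestor_type l x == Some k) (iota 0 j.+1) == h.+1).

Definition typed_fringe (k : G) (h : nat) (x : mtree) : mtree * bool :=
  match pselect (exists j, is_typed_ancestor k h x j) with
  | left ex => fringe (ex_minn ex) x
  | right _ => (x, true)
  end.

(* The number of vertices [u] of [t1] whose neighbourhood is [(t, v)]. *)
Definition noccur (k : G) (h : nat) (t : tree G) (v : seq nat)
    (t1 : tree G) : nat :=
  count (fun u => `[< typed_fringe k h (mark t1 u) = (mark t v, false) >])
        (vertices t1).

End MarkedTrees.

Section Distance.
Variables (R : realType) (G : countType).

Definition agree (x y : mtree G) : set nat :=
  [set h | fringe h x = fringe h y].

(* [inf {2^-h | h in A}] is [2^-(sup A)], including the case [sup A = +oo]. *)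
Definition tree_dist (x y : mtree G) : R :=
  if `[< fringe 0 x = fringe 0 y >]
  then inf [set (2^-1) ^+ h | h in agree x y] else 2.

Let half_ge0 h : 0 <= (2^-1 : R) ^+ h.
Proof. by rewrite exprn_ge0// invr_ge0. Qed.

Let half_gt0 h : 0 < (2^-1 : R) ^+ h.
Proof. by rewrite exprn_gt0// invr_gt0. Qed.

Let half_anti h h' : (h <= h')%N -> (2^-1 : R) ^+ h' <= 2^-1 ^+ h.
Proof.
by move=> hh'; rewrite ler_wiXn2l// ?invr_ge0// invf_le1// ler1n.
Qed.

Lemma up_up k h (x y : mtree G) : (k <= h)%N -> up h x = Some y ->
  up k x = up k y.
Proof.
move=> kh; case: x => [t fs|t fs] /=.
  case: ifP => // hs [<-] /=.
  rewrite size_take_min leq_min kh (leq_trans kh hs) /=.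
  by rewrite take_takel.
by case=> <- /=; rewrite size_mkseq kh /mkseq -map_take take_iota (minn_idPl kh).
Qed.

Lemma fringe_le k h (x y : mtree G) : (k <= h)%N ->
  fringe h x = fringe h y -> fringe k x = fringe k y.
Proof.
move=> kh; rewrite /fringe.
case ux : (up h x) => [x'|]; case uy : (up h y) => [y'|] //.
- case=> e; rewrite (up_up kh ux) (up_up kh uy) e.
  case uk : (up k y') => [//|]; exfalso; move: uk; rewrite -(up_up kh uy).
  by move: uy; case: (y) => //= t fs; case: ifP => // hs _; rewrite (leq_trans kh hs).
- by case=> ->.
Qed.

Lemma fringe_inj (x y : mtree G) : (forall h, fringe h x = fringe h y) -> x = y.
Proof.
move=> e; rewrite /fringe in e.
case: x y e => [t fs|t fs] [t' fs'|t' fs'] e /=.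
- have := e (maxn (size fs) (size fs')).+1.
  by rewrite /= !ifN ?ltnNge ?ltnS ?leq_maxl ?leq_maxr// -?ltnNge ?ltnS ?leq_maxl ?leq_maxr// => -[-> ->].
- by have := e (size fs).+1; rewrite /= ltnn.
- by have := e (size fs').+1; rewrite /= ltnn.
- have [<-] := e 0%N; congr InfM; apply/funext => n.
  pose g (p : mtree G * bool) := if p.1 is FinM _ s then nth (fs n) s n else fs n.
  have : nth (fs n) (mkseq fs n.+1) n = nth (fs n) (mkseq fs' n.+1) n
    by exact: (congr1 g (e n.+1)).
  by rewrite !nth_mkseq.
Qed.

Let agree_lb x y : has_lbound [set (2^-1 : R) ^+ h | h in agree x y].
Proof. by exists 0 => _ [h _ <-]. Qed.

Let agree_inf x y h : agree x y h ->
  inf [set (2^-1 : R) ^+ h | h in agree x y] <= 2^-1 ^+ h.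
Proof. by move=> axy; apply: ge_inf => //; exists h. Qed.

Let agree_nonempty x y : fringe 0 x = fringe 0 y ->
  [set (2^-1 : R) ^+ h | h in agree x y] !=set0.
Proof. by move=> e; exists (2^-1 ^+ 0); exists 0%N. Qed.

Lemma tree_dist_ge0 x y : 0 <= tree_dist x y.
Proof.
rewrite /tree_dist; case: asboolP => // e.
by apply: lb_le_inf (agree_nonempty e) _ => _ [h _ <-].
Qed.

Lemma tree_distxx x : tree_dist x x = 0.
Proof.
apply/eqP; rewrite eq_le tree_dist_ge0 andbT.
rewrite /tree_dist asboolT//; apply/ler_addgt0Pl => e e0; rewrite addr0.
have [n ne] : exists n, (2^-1 : R) ^+ n < e.
  have : (fun n => (2^-1 : R) ^+ n) @ \oo --> 0.
    by apply: cvg_expr; rewrite ger0_norm ?invr_ge0// invf_lt1// ltr1n.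
  move=> /cvgrPdist_lt /(_ e e0) [N _ /(_ N (leqnn N))].
  by rewrite /= sub0r normrN ger0_norm// => ?; exists N.
by apply: le_trans (ltW ne); exact: agree_inf.
Qed.

Lemma tree_dist_eq0 x y : tree_dist x y = 0 -> x = y.
Proof.
rewrite /tree_dist; case: asboolP => [e d0|_ /eqP]; last by rewrite pnatr_eq0.
apply: fringe_inj => h; apply: contrapT => nh.
have : (2^-1 : R) ^+ h <= 0.
  rewrite -d0; apply: lb_le_inf (agree_nonempty e) _ => _ [k ak <-].
  apply: half_anti; rewrite leqNgt; apply/negP => hk; apply: nh.
  exact: fringe_le (ltnW hk) ak.
by rewrite leNgt half_gt0.
Qed.

Lemma tree_dist_sym x y : tree_dist x y = tree_dist y x.
Proof.
have aC : agree x y = agree y x by apply/seteqP; split => h /esym.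
rewrite /tree_dist aC; congr (if _ then _ else _).
by apply/asbool_equiv_eq; split => /esym.
Qed.

Lemma tree_dist_triangle y x z :
  tree_dist x z <= tree_dist x y + tree_dist y z.
Proof.
have d2 u v : tree_dist u v <= 2.
  rewrite /tree_dist; case: asboolP => // e.
  by rewrite (le_trans (@agree_inf u v 0%N e))// expr0 ler1n.
case: (pselect (fringe 0 x = fringe 0 y)) => [exy|nxy]; last first.
  by rewrite {2}/tree_dist asboolF// (le_trans (d2 _ _))// lerDl tree_dist_ge0.
case: (pselect (fringe 0 y = fringe 0 z)) => [eyz|nyz]; last first.
  by rewrite {3}/tree_dist asboolF// (le_trans (d2 _ _))// lerDr tree_dist_ge0.
rewrite /tree_dist !asboolT//; last by rewrite exy.
rewrite -lerBlDl; apply: lb_le_inf (agree_nonempty eyz) _ => _ [k ak <-].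
rewrite lerBlDl -lerBlDr; apply: lb_le_inf (agree_nonempty exy) _ => _ [h ah <-].
rewrite lerBlDr.
have am : agree x z (minn h k).
  rewrite /agree /= (fringe_le (geq_minl _ _) ah).
  exact: (fringe_le (geq_minr _ _) ak).
apply: le_trans (agree_inf am) _; rewrite /minn; case: ifP => _.
  by rewrite lerDl.
by rewrite lerDr.
Qed.

End Distance.

(* The parameters [R] and [k] are phantoms: [R] is where the distance takes its
   values and [k] provides the inhabitant required of a pointed type. *)
Definition treespace (R : realType) (G : countType) (k : G) : Type := mtree G.

HB.instance Definition _ (R : realType) (G : countType) (k : G) :=
  gen_eqMixin (treespace R k).
HB.instance Definition _ (R : realType) (G : countType) (k : G) :=
  gen_choiceMixin (treespace R k).
HB.instance Definition _ (R : realType) (G : countType) (k : G) :=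
  isPointed.Build (treespace R k) (FinM (Node k [::]) [::]).
HB.instance Definition _ (R : realType) (G : countType) (k : G) :=
  @isMetric.Build R (treespace R k) (@tree_dist R G) (@tree_distxx R G)
    (@tree_dist_eq0 R G) (@tree_dist_sym R G) (@tree_dist_triangle R G).

Definition borel_treespace (R : realType) (G : countType) (k : G) :=
  g_sigma_algebraType (@open (treespace R k)).

Section WeakTopology.
Variables (R : realType) (G : countType) (k : G).

Definition bounded_continuous : Type :=
  {f : treespace R k -> R | continuous f /\ bounded_fun f}.

Definition law : Type := probability (borel_treespace R k) R.

Definition integrate (mu : law) : {ptws bounded_continuous -> R} :=
  fun f => (\int[(mu : probability (borel_treespace R k) R)]_x sval f x)%R.

HB.instance Definition _ := gen_eqMixin law.
HB.instance Definition _ := gen_choiceMixin law.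
HB.instance Definition _ := Topological.copy law (initial_topology integrate).

(* The law of [(t, v)] for a uniform vertex [v] of type [k]; it is the arbitrary
   law [mu0] when there is no such vertex. *)
Definition uniform_mark (mu0 : law) (t : tree G) : law :=
  mnormalize
    (msum (fun j => \d_(mark t (nth [::] (typed_vertices k t) j)
                         : borel_treespace R k)) (ntype k t))
    (mu0 : probability (borel_treespace R k) R).

End WeakTopology.

Section Probability.
Context d (Omega : measurableType d) (R : realType) (P : probability Omega R).

(* The sigma-algebra generated by a random variable with values in a countable
   set carrying the discrete sigma-algebra. *)
Definition discrete_events (V : Type) (X : Omega -> V) : set (set Omega) :=
  [set X @^-1` B | B in setT].

Definition independent_systems (I : eqType) (F : I -> set (set Omega)) : Prop :=
  forall (J : seq I) (A : I -> set Omega), uniq J ->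
    (forall i, i \in J -> F i (A i)) ->
    P (\bigcap_(i in [set` J]) A i) = (\prod_(i <- J) fine (P (A i)))%:E.

Definition cond_prob (B A : set Omega) : R := fine (P (A `&` B)) / fine (P B).

(* Convergence in probability of [Y n], taken under [P] conditioned on [B n],
   to the constant [y]. *)
Definition cvg_in_prob (T : topologicalType) (B : nat -> set Omega)
    (Y : nat -> Omega -> T) (y : T) : Prop :=
  forall U : set T, nbhs y U ->
    (fun n => cond_prob (B n) (Y n @^-1` U)) @ \oo --> (1 : R).

End Probability.

Section BranchingTrees.
Context d (Omega : measurableType d) (R : realType) (P : probability Omega R).
Variable G : countType.

Definition branching_events (alpha : Omega -> G)
    (xi : seq nat -> G -> Omega -> seq G) (j : option (seq nat * G)) :
    set (set Omega) :=
  if j is Some (u, i) then discrete_events (xi u i) else discrete_events alpha.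

(* [sigma i] is the probability mass function of the random word $\sigma_i$;
   [xi u i] is the independent copy of $\sigma_i$ that is used at address [u] if
   the vertex there has type [i]; [alpha] is the type of the root. *)
Record branching_family (sigma : G -> seq G -> R) (alpha : Omega -> G)
    (xi : seq nat -> G -> Omega -> seq G) : Prop := {
  branching_measurable : forall j A, branching_events alpha xi j A ->
    measurable A;
  branching_law : forall u i w, P (xi u i @^-1` [set w]) = (sigma i w)%:E;
  branching_indep : independent_systems P (branching_events alpha xi)
}.

Variable xi : seq nat -> G -> Omega -> seq G.

Definition gw_tree (alpha : Omega -> G) (w : Omega) : tree G :=
  grown (fun u i => xi u i w) (alpha w).

Definition gw_tree_from (k : G) (w : Omega) : tree G :=
  grown (fun u i => xi u i w) k.

Definition gw_tree_stopped (k : G) (w : Omega) : tree G :=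
  grown (stop_at k (fun u i => xi u i w)) k.

Definition gw_finite (alpha : Omega -> G) (w : Omega) : Prop :=
  exists t, realizes (fun u i => xi u i w) (alpha w) t.

End BranchingTrees.

Section LimitTree.
Context d (Omega : measurableType d) (R : realType) (P : probability Omega R).
Context d' (Omega' : measurableType d') (P' : probability Omega' R).
Variables (G : countType) (k : G).

Definition spine_events (T0 : Omega' -> tree G)
    (H : nat -> Omega' -> tree G * seq nat)
    (Tk : nat -> seq nat -> Omega' -> tree G)
    (j : option (nat + nat * seq nat)) : set (set Omega') :=
  match j with
  | None => discrete_events T0
  | Some (inl i) => discrete_events (H i)
  | Some (inr (i, u)) => discrete_events (Tk i u)
  end.

(* The building blocks of the limit tree: [T0] is attached at $u_0$, the block
   between $u_i$ and $u_{i+1}$ is [H i], a tree with the address of its marked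
   vertex, and [Tk i u] is attached at its vertex [u]. *)
Record spine_family (xi : seq nat -> G -> Omega -> seq G)
    (T0 : Omega' -> tree G) (H : nat -> Omega' -> tree G * seq nat)
    (Tk : nat -> seq nat -> Omega' -> tree G) : Prop := {
  spine_measurable : forall j A, spine_events T0 H Tk j A -> measurable A;
  spine_lawT0 : forall t,
    P' (T0 @^-1` [set t]) = P (gw_tree_from xi k @^-1` [set t]);
  spine_lawT : forall i u t,
    P' (Tk i u @^-1` [set t]) = P (gw_tree_from xi k @^-1` [set t]);
  spine_lawH : forall i t u, type_at t u = Some k -> u != [::] ->
    P' (H i @^-1` [set (t, u)]) = P (gw_tree_stopped xi k @^-1` [set t]);
  spine_indep : independent_systems P' (spine_events T0 H Tk)
}.

Definition block_frames (H : nat -> Omega' -> tree G * seq nat)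
    (Tk : nat -> seq nat -> Omega' -> tree G) (w : Omega') (i : nat) :
    seq (frame G) :=
  let: (t, m) := H i w in
  (focus (graft k m (fun u => Tk i u w) [::] t) m [::]).2.

(* The frames of the limit tree are the concatenation of those of the blocks.
   Almost surely no block is empty, so that the first [n.+1] blocks provide at
   least [n.+1] frames. *)
Definition limit_tree (T0 : Omega' -> tree G)
    (H : nat -> Omega' -> tree G * seq nat)
    (Tk : nat -> seq nat -> Omega' -> tree G) (w : Omega') : mtree G :=
  InfM (T0 w) (fun n => nth (k, [::], [::])
    (flatten [seq block_frames H Tk w i | i <- iota 0 n.+1]) n).

End LimitTree.

(* Main.v *)
Require Import Defs.
From HB Require Import structures.
From mathcomp Require Import all_boot all_order all_algebra.
From mathcomp Require Import all_classical all_reals all_analysis.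
From mathcomp Require Import measurable_realfun ring lra.
Set Implicit Arguments.
Unset Strict Implicit.
Unset Printing Implicit Defensive.
Import Order.TTheory GRing.Theory Num.Theory.
Import numFieldNormedType.Exports.
Local Open Scope classical_set_scope.
Local Open Scope ring_scope.

(** The neighbourhood of a vertex [u] is [(T, v)] iff [u] sits at position [v] of
    a fringe subtree equal to [T]; hence [N_(T, v)] counts the fringe subtrees
    equal to [T], and both claims concern their density among the vertices of
    type [kappa].

    A finite tree [t] has probability [p(t)], the product over its vertices of
    the offspring probabilities. For a real [theta] and a [c] slightly larger
    than [theta * p(T)], consider the tilt
    [exp (theta * N_T(t) - c * #_kappa t)]. It is multiplicative over the
    vertices, so its sum against [p] over the trees with a given root type
    satisfies the recursion of the branching process, except for one correction
    at [t = T]; by induction on the depth this sum is at most 1. Markov's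
    inequality bounds the probability that [N_T] deviates from
    [p(T) * #_kappa] by [eps * #_kappa] while [#_kappa >= s] by
    [2 exp (- (eps^2 / 8) s)], which is negligible compared with [P (E_n)].

    On the side of the limit tree, [(T, v)] determines the blocks along the spine
    and the trees grafted on them; multiplying their probabilities gives [p(T)]
    again, because the size-biased block has the law of $T^\kappa$ at every
    admissible mark, and criticality makes these laws sum to 1.

    For weak convergence, the neighbourhoods are open cells on which a continuous
    function is eventually almost constant around every infinite tree. Finitely
    many disjoint such cells carry almost all the mass of the limit, and the
    masses of these cells converge. *)

(** * Marked trees as zippers *)

(** Of the conditioning events only the probability is controlled, so each deviation is estimated
    under the unconditioned law and must survive division by [P (E n)]; hence the exponential bound.
    The tilt provides it for arbitrary offspring laws because its factor is 1 at every vertex of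
    type other than [k], and because the correction at [T] is governed by the single number [p(T)]:
    for root type [k] the tilted sum is at most [exp (- c) * (1 + (exp theta - 1) * p(T))], so that
    [(exp theta - 1) * p(T) <= c] and [1 + c <= exp c] bring it back to 1. A second obstacle is that
    [grown] returns a tree even when the growth does not stop, while almost sure finiteness is given
    only for the random root type. The law of the tree grown from [k] is therefore found by
    comparing masses: the products of offspring probabilities bound it from below, and they already
    sum to 1 for every type that is reached with positive probability. *)

Lemma tree_ind_mem (G : Type) (Q : tree G -> Prop) :
  (forall i ts, (forall t, t \in ts -> Q t) -> Q (Node i ts)) -> forall t, Q t.
Proof.
move=> IH; fix rec 1 => -[i ts]; apply: IH.
elim: ts => [|t0 ts IHts] t; first (rewrite in_nil; discriminate).
by rewrite in_cons => /predU1P[->|]; [exact: rec|exact: IHts].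
Qed.

Section Children.
Variable X : eqType.
Implicit Types (cs : seq (seq (seq nat * X))) (x : seq nat * X).

(** The step common to [nodes] and [cut]: entries listed for a child get the number of that child in
    front of their address. Membership and uniqueness of addresses are thus proved once. *)
Definition push_from (n : nat) cs : seq (seq nat * X) :=
  flatten (imap (fun j c => [seq (j :: x.1, x.2) | x <- c]) n cs).

Lemma push_from_cons n c cs :
  push_from n (c :: cs) = [seq (n :: x.1, x.2) | x <- c] ++ push_from n.+1 cs.
Proof. by []. Qed.

Lemma mem_push_from n cs u y :
  reflect (exists j c u', [/\ onth cs j = Some c, (u', y) \in c & u = (n + j)%N :: u'])
    ((u, y) \in push_from n cs).
Proof.
elim: cs n u => [|c cs IH] n u.
  by apply: (iffP idP) => [//|[[|j]] [c] [u'] []].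
rewrite push_from_cons mem_cat; apply: (iffP orP) => [[/mapP[[u' z] xc [-> ->]]|/IH]|].
- by exists 0%N, c, u'; split => //=; rewrite addn0.
- by move=> [j] [d] [u'] [jd ud ->]; exists j.+1, d, u'; rewrite addSnnS.
- move=> [[|j]] [d] [u'] /= [].
    by move=> [->] ud ->; left; apply/mapP; exists (u', y) => //=; rewrite addn0.
  by move=> jd ud ->; right; apply/IH; exists j, d, u'; rewrite addSnnS.
Qed.

Lemma uniq_push_from n cs : all (fun c => uniq (unzip1 c)) cs ->
  uniq (unzip1 (push_from n cs)).
Proof.
elim: cs n => [//|c cs IH] n /= /andP[uc ucs].
rewrite push_from_cons /unzip1 map_cat cat_uniq IH// andbT; apply/andP; split.
  rewrite -map_comp (@eq_map _ _ _ (cons n \o fst))// map_comp.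
  by rewrite map_inj_uniq// => a b [].
apply/hasPn => u /mapP[[u' y] /mem_push_from[j [d [v [_ _ /= ->]]]] ->] /=.
apply/negP => /mapP[[w z] /mapP[? _ [-> _]]] /= [/eqP].
by rewrite addSn -{2}[n]addn0 -addnS eqn_add2l.
Qed.

Lemma unzip2_push_from n cs :
  unzip2 (push_from n cs) = flatten [seq unzip2 c | c <- cs].
Proof.
elim: cs n => [//|c cs IH] n.
by rewrite push_from_cons /unzip2 map_cat [X in _ ++ X]IH -map_comp.
Qed.

End Children.

Section Nodes.
Variable G : countType.
Implicit Types (t : tree G) (ts : seq (tree G)) (i k : G).

Definition word_of t : seq G := let: Node _ ts := t in map (@root_type G) ts.

(** The address selects the independent copy of the offspring word, and the fringe subtree carries
    the type and the word found there. Probabilities of trees become products over this list. *)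
Fixpoint nodes t : seq (seq nat * tree G) :=
  let: Node _ ts := t in ([::], t) :: push_from 0 (map nodes ts).

Definition fringes t : seq (tree G) := unzip2 (nodes t).

Lemma vertices_nodes t : vertices t = unzip1 (nodes t).
Proof.
elim/tree_ind_mem: t => i ts IH /=; congr cons.
move: 0%N => n; elim: ts n IH => [//|t ts IHts] n IH.
rewrite /= IHts; last first.
  by move=> t' t'ts; apply: IH; rewrite in_cons t'ts orbT.
by rewrite push_from_cons /unzip1 map_cat -map_comp IH ?mem_head// -map_comp.
Qed.

Lemma nodesP t u t' : (u, t') \in nodes t <-> subtree t u = Some t'.
Proof.
elim/tree_ind_mem: t u t' => i ts IH u t' /=.
rewrite in_cons; split=> [/orP[/eqP[-> ->]//|]|].
  move=> /mem_push_from[j [c [u' []]]]; rewrite add0n onth_map.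
  case tj : (onth ts j) => [s|//] /= [<-] su' -> /=; rewrite tj.
  by apply/(IH s) => //; apply/onthP; exists j.
case: u => [[<-]|j u]; first by rewrite eqxx.
rewrite /=; case tj : (onth ts j) => [s|//] su; apply/mem_push_from.
exists j, (nodes s), u; rewrite onth_map tj; split => //.
have sts : s \in ts by apply/onthP; exists j.
exact/(IH s sts).
Qed.

Lemma uniq_vertices t : uniq (vertices t).
Proof.
rewrite vertices_nodes; elim/tree_ind_mem: t => i ts IH /=.
rewrite uniq_push_from ?andbT; last by apply/allP => _ /mapP[t /IH ut ->].
by apply/negP => /mapP[[u y] /mem_push_from[j [c [u' [_ _ /= ->]]]]].
Qed.

Lemma fringesE i ts :
  fringes (Node i ts) = Node i ts :: flatten (map fringes ts).
Proof. by rewrite /fringes /= unzip2_push_from -map_comp. Qed.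

Lemma ntype_fringes k t :
  ntype k t = count (fun s => root_type s == k) (fringes t).
Proof.
rewrite /ntype /typed_vertices vertices_nodes size_filter /fringes !count_map.
by apply: eq_in_count => -[u s] /nodesP /=; rewrite /type_at => ->.
Qed.

End Nodes.

Section Zippers.
Variable G : countType.
Implicit Types (t : tree G) (f : frame G) (a b : seq (frame G)) (k : G).

Definition ftype f : G := f.1.1.

Definition plugf t f : tree G := Node f.1.1 (f.1.2 ++ t :: f.2).

(** Inverse of [focus]. Frames run from the mark upwards, so the last frame is the root, and [addr]
    has to reverse the list. *)
Definition plug t a : tree G := foldl plugf t a.

Definition addr a : seq nat := rev [seq size f.1.2 | f <- a].

Lemma plug_cat t a b : plug t (a ++ b) = plug (plug t a) b.
Proof. exact: foldl_cat. Qed.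

Lemma plug_rcons t a f : plug t (rcons a f) = plugf (plug t a) f.
Proof. by rewrite -cats1 plug_cat. Qed.

Lemma addr_cat a b : addr (a ++ b) = addr b ++ addr a.
Proof. by rewrite /addr map_cat rev_cat. Qed.

Lemma addr_rcons a f : addr (rcons a f) = size f.1.2 :: addr a.
Proof. by rewrite -cats1 addr_cat. Qed.

Lemma onth_plugf t f : onth (f.1.2 ++ t :: f.2) (size f.1.2) = Some t.
Proof. by rewrite onth_cat ltnn subnn. Qed.

Lemma focus_plug t a b : focus (plug t a) (addr a) b = (t, a ++ b).
Proof.
elim/last_ind: a b => [//|a f IH] b.
rewrite plug_rcons addr_rcons /= onth_plugf IH cat_rcons; congr (_, _ ++ _ :: _).
case: f => -[i l] r /=; rewrite take_size_cat// drop_cat ltnNge leqnSn subSnn /=.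
by rewrite drop0.
Qed.

Lemma mark_plug t a : mark (plug t a) (addr a) = FinM t a.
Proof. by rewrite /mark focus_plug cats0. Qed.

Lemma subtree_plug t a : subtree (plug t a) (addr a) = Some t.
Proof.
elim/last_ind: a => [//|a f IH].
by rewrite plug_rcons addr_rcons /= onth_plugf.
Qed.

Lemma onth_plugfP i ts j t : onth ts j = Some t ->
  exists f, [/\ Node i ts = plugf t f, j = size f.1.2 & ftype f = i].
Proof.
move=> tj; have jts : (j < size ts)%N by rewrite -onthTE tj.
exists (i, take j ts, drop j.+1 ts); split => //=.
  by rewrite /plugf /= -{1}(onth_nth t _ _ _ tj) -drop_nth// cat_take_drop.
by rewrite size_takel// ltnW.
Qed.

Lemma subtree_plugP t u t' : subtree t u = Some t' ->
  exists2 a, t = plug t' a & u = addr a.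
Proof.
elim: u t => [|j u IH] [i ts] /=; first by move=> [<-]; exists [::].
case tj : (onth ts j) => [s|//] /IH[a sE ->].
have [f [-> -> _]] := onth_plugfP i tj.
by exists (rcons a f); rewrite ?plug_rcons ?addr_rcons ?sE.
Qed.

Lemma plug_addr_inj t t' a a' :
  plug t a = plug t' a' -> addr a = addr a' -> t = t' /\ a = a'.
Proof.
move=> e e'; have := focus_plug t a [::].
by rewrite e e' focus_plug !cats0 => -[-> ->].
Qed.

(* The frames between a vertex of type [k] and its [h]-th proper ancestor of
   type [k]. *)
Definition spine_level k (h : nat) a : bool :=
  (count (fun f => ftype f == k) a == h) && (last k (map ftype a) == k).

Lemma ancestor_type_up n l (x y : mtree G) : (l <= n)%N -> up n x = Some y ->
  ancestor_type l x = ancestor_type l y.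
Proof.
case: x => [t fs|t fs] /= ln; first case: ifP => // nfs.
  move=> [<-]; case: l ln => [//|l] ln /=; congr omap.
  by rewrite !onthE map_take nth_take.
move=> [<-]; case: l ln => [//|l] ln /=.
by rewrite /mkseq onth_map onthE (nth_map 0%N) ?size_iota// nth_iota.
Qed.

Lemma ancestor_type_FinM t a l :
  ancestor_type l (FinM t a) = onth (root_type t :: map ftype a) l.
Proof. by case: l => //= l; rewrite onth_map. Qed.

Lemma count_ancestor_type t a k :
  count (fun l => ancestor_type l (FinM t a) == Some k) (iota 0 (size a).+1)
  = count (pred1 k) (root_type t :: map ftype a).
Proof.
under eq_count do rewrite ancestor_type_FinM.
rewrite -(size_map ftype a) -/(size (root_type t :: map ftype a)).
move: (_ :: _) => s; elim: s => [//|j s IH] /=; congr addn.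
by rewrite -IH -[1%N]/(1 + 0)%N iotaDl count_map.
Qed.

Lemma is_typed_ancestor_uniq k h (x : mtree G) j j' :
  is_typed_ancestor k h x j -> is_typed_ancestor k h x j' -> j = j'.
Proof.
wlog jj' : j j' / (j <= j')%N.
  by case: (leqP j j') => [|/ltnW] le H Hj Hj'; [|apply/esym]; apply: H le _ _.
move=> /andP[_ /eqP cj] /andP[tj' /eqP cj'].
move: jj'; rewrite leq_eqVlt => /predU1P[//|jj'].
move: cj'; rewrite -[j'.+1]addn1 iotaD count_cat /= tj' !addn0 addn1 => -[cj'].
have : (h.+1 <= h)%N by rewrite -{2}cj' -(subnKC jj') iotaD count_cat cj leq_addr.
by rewrite ltnn.
Qed.

(** The frames [a] themselves show where the ancestor sought by [typed_fringe] sits, namely [size a]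
    steps up, and at most one ancestor qualifies. The search becomes a comparison of finitely many
    frames, which makes neighbourhoods open cells later on. *)
Lemma typed_fringeP k h t a (x : mtree G) : root_type t = k ->
  spine_level k h a ->
  typed_fringe k h x = (FinM t a, false) <-> up (size a) x = Some (FinM t a).
Proof.
move=> tk /andP[/eqP ca la]; split.
  rewrite /typed_fringe; case: pselect => // ex; rewrite /fringe.
  case: ex_minnP => j _ _.
  case uj : (up j x) => [y|//] [yE]; rewrite yE in uj.
  suff -> : size a = j by [].
  case: x uj ex => [t' fs|t' fs] /=; first case: ifP => // jfs.
    by move=> [_ <-] _; rewrite size_takel.
  by move=> [_ <-] _; rewrite size_mkseq.
move=> ux; have ta : is_typed_ancestor k h x (size a).
  rewrite /is_typed_ancestor (ancestor_type_up (leqnn _) ux).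
  rewrite (@eq_in_count _ _ (fun l => ancestor_type l (FinM t a) == Some k)).
    rewrite count_ancestor_type /= tk eqxx count_map ca add1n eqxx andbT.
    rewrite ancestor_type_FinM tk -(size_map ftype) onthE (nth_map k) ?ltnS//.
    by rewrite nth_last /= (eqP la).
  move=> l; rewrite mem_iota add0n ltnS /= => la'.
  by rewrite (ancestor_type_up la' ux).
rewrite /typed_fringe; case: pselect => [ex|]; last by case; exists (size a).
case: ex_minnP => j /is_typed_ancestor_uniq/(_ ta) -> _.
by rewrite /fringe ux.
Qed.

Lemma up_FinM_cat t a b : up (size a) (FinM t (a ++ b)) = Some (FinM t a).
Proof. by rewrite /= size_cat leq_addr take_size_cat. Qed.

(* A vertex [u] has neighbourhood [(t, v)] iff [u = w ++ v] for a vertex [w] whose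
   fringe subtree is [t], so the position of the mark does not matter. *)
Lemma noccur_fringes k h t v t0 a t1 : root_type t0 = k -> spine_level k h a ->
  mark t v = FinM t0 a ->
  noccur k h t v t1 = count (pred1 (plug t0 a)) (fringes t1).
Proof.
move=> tk lv mE; rewrite /noccur mE /fringes count_map -!size_filter.
set s2 := [seq _ <- nodes t1 | _].
pose shift (x : seq nat * tree G) := x.1 ++ addr a.
rewrite -(size_map shift s2).
apply/perm_size/uniq_perm; first exact/filter_uniq/uniq_vertices.
  rewrite (map_comp (fun u => u ++ addr a) fst) map_inj_uniq; last first.
    move=> u u' /(congr1 rev); rewrite !rev_cat => /eqP.
    by rewrite eqseq_cat// eqxx => /eqP/(can_inj revK).
  apply: subseq_uniq (uniq_vertices t1).
  by rewrite vertices_nodes; exact/map_subseq/filter_subseq.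
move=> u; rewrite mem_filter; apply/andP/mapP => [[/asboolP/(typed_fringeP _ tk lv)]|].
  move=> up_u; rewrite vertices_nodes => /mapP[[u' t'] /nodesP + /= uE].
  rewrite -{u'}uE => /subtree_plugP[b t1E uE].
  move: up_u; rewrite t1E uE mark_plug /=; case: ifP => // _ [t'E tbE].
  have bE : b = a ++ drop (size a) b by rewrite -{1}tbE cat_take_drop.
  exists (addr (drop (size a) b), plug t0 a).
    rewrite mem_filter /= eqxx; apply/nodesP.
    by rewrite t1E {1}bE t'E plug_cat subtree_plug.
  by rewrite /shift /= -addr_cat -bE.
move=> [[w T]]; rewrite mem_filter /= => /andP[/eqP -> /nodesP /subtree_plugP].
move=> [b t1E ->] ->; rewrite /shift /= -addr_cat t1E -plug_cat; split.
  by apply/asboolP/(typed_fringeP _ tk lv); rewrite mark_plug up_FinM_cat.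
rewrite vertices_nodes; apply/mapP; exists (addr (a ++ b), t0) => //.
by apply/nodesP; rewrite subtree_plug.
Qed.

Lemma path_ntype_plug k t a :
  path_ntype k (plug t a) (addr a) = count (pred1 k) (root_type t :: map ftype a).
Proof.
elim/last_ind: a => [|a f IH]; first by rewrite /path_ntype /= /type_at /= addn0.
rewrite plug_rcons addr_rcons map_rcons -rcons_cons -cats1 count_cat -IH /= addn0 addnC.
have countS (Q : pred nat) n :
  count Q (iota 0 n.+1) = (Q 0 + count (Q \o succn) (iota 0 n))%N.
  by rewrite [LHS]/= -[1%N]/(1 + 0)%N iotaDl count_map.
rewrite /path_ntype [LHS]countS [type_at _ _]/=; congr (_ + _)%N.
by apply: eq_count => j /=; rewrite /type_at /= onth_plugf.
Qed.

Lemma marked_tree_plug k h t v : root_type t = k -> type_at t v = Some k ->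
    path_ntype k t v = h.+1 ->
  exists t0 a, [/\ t = plug t0 a, v = addr a, root_type t0 = k & spine_level k h a].
Proof.
move=> tk; rewrite /type_at; case sv : (subtree t v) => [t0|//] [t0k] pv.
have [a tE vE] := subtree_plugP sv; exists t0, a; split => //.
move: pv; rewrite tE vE path_ntype_plug /= t0k eqxx add1n => -[ca].
rewrite /spine_level; move: ca; rewrite count_map => ->; rewrite eqxx /=.
case/lastP: a tE {vE} => [//|a f tE].
by rewrite map_rcons last_rcons -tk tE plug_rcons.
Qed.

End Zippers.

(** * Blocks and grafting *)

Lemma onth_imap (A B : Type) (f : nat -> A -> B) n s j :
  onth (imap f n s) j = omap (f (n + j)%N) (onth s j).
Proof.
elim: s n j => [|x s IH] n [|j] //=; first by rewrite addn0.
by rewrite IH addnS.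
Qed.

Lemma onth_mem_eq (A : eqType) (s : seq A) j x : onth s j = Some x -> x \in s.
Proof. by move=> sj; apply/onthP; exists j. Qed.

Lemma push_from_onth (G : countType) (F : tree G -> seq (seq nat * tree G)) ts u y :
  (u, y) \in push_from 0 (map F ts) ->
  exists j t v, [/\ onth ts j = Some t, (v, y) \in F t & u = j :: v].
Proof.
move=> /mem_push_from[j [c [v [+ + ->]]]]; rewrite onth_map add0n.
by case tj : (onth ts j) => [t|//] /= [<-] vy; exists j, t, v.
Qed.

Lemma onth_push_from (G : countType) (F : tree G -> seq (seq nat * tree G)) ts j t v y :
  onth ts j = Some t -> (v, y) \in F t -> (j :: v, y) \in push_from 0 (map F ts).
Proof.
by move=> tj vy; apply/mem_push_from; exists j, (F t), v; rewrite onth_map tj.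
Qed.

Lemma onth_take (A : Type) (s : seq A) j l :
  onth (take j s) l = if (l < j)%N then onth s l else None.
Proof. by elim: s j l => [|x s IH] [|j] [|l] //=; rewrite ?IH ?onth0n ?if_same. Qed.

Lemma onth_drop (A : Type) (s : seq A) j l : onth (drop j s) l = onth s (j + l).
Proof. by elim: s j => [|x s IH] [|j] //=; rewrite ?onth0n. Qed.

Lemma eq_around (A : eqType) (s1 s2 : seq A) j :
  (forall l, l != j -> onth s1 l = onth s2 l) ->
  take j s1 = take j s2 /\ drop j.+1 s1 = drop j.+1 s2.
Proof.
move=> H; split; apply: eq_from_onth => l.
  by rewrite !onth_take; case: ltnP => // lj; rewrite H// ltn_eqF.
by rewrite !onth_drop H// gtn_eqF// addSn ltnS leq_addr.
Qed.

Lemma uniq_unzip1 (A B : eqType) (l : seq (A * B)) x y y' :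
  uniq (unzip1 l) -> (x, y) \in l -> (x, y') \in l -> y = y'.
Proof.
elim: l => [//|[x0 y0] l IH] /= /andP[xl ul]; rewrite !inE.
have nl z : (x0, z) \notin l.
  by apply: contra xl => zl; apply/mapP; exists (x0, z).
move=> /predU1P[[-> ->]|xy] /predU1P[[]|xy'].
- by move=> ->.
- by rewrite (negbTE (nl _)) in xy'.
- by move=> xx0; rewrite xx0 (negbTE (nl _)) in xy.
- exact: IH.
Qed.

Section CutAndGraft.
Variables (G : countType) (k : G).
Implicit Types (t b : tree G) (ts : seq (tree G)) (u v m : seq nat).
Implicit Types (s : seq nat -> tree G).

(* [cut] lists the fringe subtrees at the vertices below which [prune] cuts off
   everything. [prune_root t] is the block at the root of [t], i.e. the value of
   $T^\kappa$ from which [t] arises by grafting the trees of [cut_root t]. *)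
Fixpoint prune t : tree G :=
  let: Node i ts := t in
  if i == k then Node i [::] else Node i (map prune ts).

Fixpoint cut t : seq (seq nat * tree G) :=
  let: Node i ts := t in
  if i == k then [:: ([::], t)] else push_from 0 (map cut ts).

Definition prune_root t : tree G := let: Node i ts := t in Node i (map prune ts).

Definition cut_root t : seq (seq nat * tree G) :=
  let: Node _ ts := t in push_from 0 (map cut ts).

Lemma root_type_prune t : root_type (prune t) = root_type t.
Proof. by case: t => i ts /=; case: ifP. Qed.

Lemma root_type_prune_root t : root_type (prune_root t) = root_type t.
Proof. by case: t. Qed.

Lemma uniq_cut t : uniq (unzip1 (cut t)).
Proof.
elim/tree_ind_mem: t => i ts IH /=; case: ifP => // _.
by apply: uniq_push_from; apply/allP => _ /mapP[t /IH ? ->].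
Qed.

Lemma uniq_cut_root t : uniq (unzip1 (cut_root t)).
Proof.
case: t => i ts; apply: uniq_push_from; apply/allP => _ /mapP[t _ ->].
exact: uniq_cut.
Qed.

Lemma cutP t u y : (u, y) \in cut t ->
  root_type y = k /\ subtree (prune t) u = Some (Node k [::]).
Proof.
elim/tree_ind_mem: t u => i ts IH u /=; case: eqP => [->|_].
  by rewrite inE => /eqP[-> ->].
move=> /push_from_onth[j [t [v [tj vy ->]]]] /=; rewrite onth_map tj /=.
exact: IH (onth_mem_eq tj) _ vy.
Qed.

Lemma cut_rootP t u y : (u, y) \in cut_root t ->
  [/\ u != [::], root_type y = k & subtree (prune_root t) u = Some (Node k [::])].
Proof.
case: t => i ts /push_from_onth[j [t [v [tj /cutP[yk sv] ->]]]] /=.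
by rewrite onth_map tj /=.
Qed.

(** The root is never grafted, so the mark [[::]] exempts nothing further and [graft k [::]] undoes
    the cutting. Here [u] is the address of the current vertex in the whole tree, which is why [s]
    is read at [u ++ v]. *)
Lemma graft_prune s u t : u != [::] ->
  (forall v y, (v, y) \in cut t -> s (u ++ v) = y) ->
  graft k [::] s u (prune t) = t.
Proof.
elim/tree_ind_mem: t u => i ts IH u u0 /=; case: eqP => [->|ik] /= H.
  by rewrite eqxx u0/= -[u]cats0; apply: H; rewrite mem_head.
move/eqP/negbTE: (ik) => -> /=; congr Node; apply: eq_from_onth => j.
rewrite onth_imap onth_map add0n; case tj : (onth ts j) => [t|//] /=.
congr Some; apply: IH => [||v y vy]; first exact: onth_mem_eq tj.
  by rewrite -cats1; case: (u).
by rewrite cat_rcons; apply: H; exact: onth_push_from tj vy.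
Qed.

Lemma graft_prune_root s t :
  (forall v y, (v, y) \in cut_root t -> s v = y) ->
  graft k [::] s [::] (prune_root t) = t.
Proof.
case: t => i ts H /=; rewrite andbF; congr Node; apply: eq_from_onth => j.
rewrite onth_imap onth_map add0n; case tj : (onth ts j) => [t|//] /=.
congr Some; apply: graft_prune => // v y vy.
by apply: H; exact: onth_push_from tj vy.
Qed.

Lemma prune_onth ts j t : map prune ts = ts -> onth ts j = Some t -> prune t = t.
Proof.
by move=> e tj; have := congr1 (fun l : seq (tree G) => onth l j) e; rewrite onth_map tj => -[].
Qed.

Section GraftFixpoint.
Variable s : seq nat -> tree G.
Hypothesis sk : forall u, root_type (s u) = k.

(** Converse direction: since the grafted trees have root type [k], pruning stops exactly at their
    roots and gives back the block. *)
Lemma prune_graft u b : u != [::] -> prune b = b -> prune (graft k [::] s u b) = b.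
Proof.
elim/tree_ind_mem: b u => i ts IH u u0 /=; rewrite u0 /=; case: eqP => [->|ik] /=.
  by move=> [<-]; case: (s u) (sk u) => j ts' /= ->; rewrite eqxx.
move/eqP/negbTE: (ik) => -> [tsE]; congr Node; apply: eq_from_onth => j.
rewrite onth_map onth_imap add0n; case tj : (onth ts j) => [t|//] /=.
congr Some; apply: IH (onth_mem_eq tj) _ _ (prune_onth tsE tj).
by rewrite -cats1; case: (u).
Qed.

Lemma cut_graft u b v y : u != [::] -> prune b = b ->
  (v, y) \in cut (graft k [::] s u b) -> s (u ++ v) = y.
Proof.
elim/tree_ind_mem: b u v => i ts IH u v u0 /=; rewrite u0 /=; case: eqP => [->|ik] /=.
  move=> _; case su : (s u) (sk u) => [j ts'] /= jk.
  by rewrite jk eqxx inE => /eqP[-> ->]; rewrite cats0 su jk.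
move/eqP/negbTE: (ik) => -> [tsE] /mem_push_from[j [c [w [+ wy ->]]]].
rewrite onth_map onth_imap !add0n; case tj : (onth ts j) => [t|//] /= [cE].
rewrite -cat_rcons; apply: (IH _ (onth_mem_eq tj)).
- by rewrite -cats1; case: (u).
- exact: prune_onth tsE tj.
- by rewrite cE.
Qed.

Lemma mem_cut_graft u b m : u != [::] -> prune b = b -> type_at b m = Some k ->
  (m, s (u ++ m)) \in cut (graft k [::] s u b).
Proof.
elim/tree_ind_mem: b u m => i ts IH u m u0 /=; rewrite u0 /=; case: eqP => [->|ik] /=.
  move=> [<-]; case: m => [|j m]; last by rewrite /type_at /= onth0n.
  move=> _; rewrite cats0; case: (s u) (sk u) => j ts' /= ->.
  by rewrite eqxx mem_head.
move/eqP/negbTE: (ik) => -> [tsE]; case: m => [|j m]; rewrite /type_at /=.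
  by move=> [/ik].
case tj : (onth ts j) => [t|//] tm; apply/mem_push_from.
exists j, (cut (graft k [::] s (rcons u j) t)), m.
rewrite onth_map onth_imap tj; split => //; rewrite -cat_rcons.
apply: IH (onth_mem_eq tj) _ _ _ (prune_onth tsE tj) tm.
by rewrite -cats1; case: (u).
Qed.

Lemma prune_root_graft b : prune_root b = b ->
  prune_root (graft k [::] s [::] b) = b.
Proof.
case: b => i ts /=; rewrite andbF /= => -[tsE]; congr Node.
apply: eq_from_onth => j; rewrite onth_map onth_imap.
case tj : (onth ts j) => [t|//] /=.
by congr Some; apply: prune_graft => //; exact: prune_onth tsE tj.
Qed.

Lemma cut_root_graft b v y : prune_root b = b ->
  (v, y) \in cut_root (graft k [::] s [::] b) -> s v = y.
Proof.
case: b => i ts /=; rewrite andbF /= => -[tsE] /mem_push_from[j [c [w [+ wy ->]]]].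
rewrite onth_map onth_imap !add0n; case tj : (onth ts j) => [t|//] /= [cE].
apply: (@cut_graft [:: j] t) => //; first exact: prune_onth tsE tj.
by rewrite cE.
Qed.

Lemma mem_cut_root_graft b m : m != [::] -> prune_root b = b ->
  type_at b m = Some k -> (m, s m) \in cut_root (graft k [::] s [::] b).
Proof.
case: b m => i ts [//|j m] _ /=; rewrite andbF /= => -[tsE]; rewrite /type_at /=.
case tj : (onth ts j) => [t|//] tm; apply/mem_push_from.
exists j, (cut (graft k [::] s [:: j] t)), m.
rewrite onth_map onth_imap tj; split => //.
exact: (@mem_cut_graft [:: j] t m) (prune_onth tsE tj) tm.
Qed.

End GraftFixpoint.

Lemma cut_plug u t y : (u, y) \in cut t ->
  exists a, [/\ t = plug y a, u = addr a & all (fun f => ftype f != k) a].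
Proof.
elim/tree_ind_mem: t u => i ts IH u /=; case: eqP => [->|/eqP ik].
  by rewrite inE => /eqP[-> ->]; exists [::].
move=> /push_from_onth[j [t [v [tj vy ->]]]].
have [a [tE -> ak]] := IH _ (onth_mem_eq tj) _ vy.
have [f [-> -> fi]] := onth_plugfP i tj.
by exists (rcons a f); rewrite plug_rcons addr_rcons all_rcons ak tE fi ik.
Qed.

Lemma cut_root_plug u t y : root_type t = k -> (u, y) \in cut_root t ->
  exists a f, [/\ t = plug y (rcons a f), u = addr (rcons a f),
    all (fun f => ftype f != k) a & ftype f = k].
Proof.
case: t => i ts /= ik /push_from_onth[j [t [v [tj vy ->]]]].
have [a [tE -> ak]] := cut_plug vy.
have [f [-> -> fi]] := onth_plugfP i tj.
by exists a, f; rewrite plug_rcons addr_rcons ak tE fi ik.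
Qed.

Lemma plug_cut t a : root_type t = k -> all (fun f => ftype f != k) a ->
  (addr a, t) \in cut (plug t a).
Proof.
move=> tk; elim/last_ind: a => [_|a f IH].
  by case: t tk => i ts /= ->; rewrite eqxx mem_head.
rewrite all_rcons => /andP[fk ak]; rewrite plug_rcons addr_rcons /=.
rewrite (negbTE fk); apply: onth_push_from (IH ak); exact: onth_plugf.
Qed.

Lemma plug_cut_root t a f : root_type t = k -> all (fun f => ftype f != k) a ->
  (addr (rcons a f), t) \in cut_root (plug t (rcons a f)).
Proof.
move=> tk ak; rewrite plug_rcons addr_rcons /=.
apply: onth_push_from (plug_cut tk ak); exact: onth_plugf.
Qed.

(** Peels off the topmost block: the root frame [f] and the frames [c] below it, down to the next
    frame of type [k]. This is the induction step along the spine. *)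
Lemma spine_level_split h a : spine_level k h.+1 a ->
  exists a' c f, [/\ a = a' ++ rcons c f, spine_level k h a',
    all (fun f => ftype f != k) c & ftype f = k].
Proof.
case/lastP: a => [//|a f] /andP[]; rewrite -cats1 count_cat map_cat last_cat /=.
move=> + /eqP fk; rewrite /= fk eqxx addn0 addn1 eqSS => ca.
suff [a' [c [aE aV ck]]] : exists a' c,
    [/\ a = a' ++ c, spine_level k h a' & all (fun f => ftype f != k) c].
  by exists a', c, f; rewrite aE cats1 rcons_cat.
elim/last_ind: a ca => [|a g IH] ca.
  by exists [::], [::]; rewrite /spine_level ca /=.
have [gk|gk] := eqVneq (ftype g) k.
  exists (rcons a g), [::]; rewrite cats0; split => //.
  by rewrite /spine_level ca map_rcons last_rcons gk eqxx.
move: ca; rewrite -cats1 count_cat /= (negbTE gk) !addn0 => /IH[a' [c [-> aV ck]]].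
by exists a', (rcons c g); rewrite cats1 rcons_cat all_rcons gk.
Qed.

Lemma spine_level_cat h a c f : spine_level k h a ->
  all (fun f => ftype f != k) c -> ftype f = k ->
  spine_level k h.+1 (a ++ rcons c f).
Proof.
move=> /andP[/eqP ca _] ck fk; rewrite /spine_level map_cat last_cat map_rcons.
rewrite last_rcons fk eqxx andbT -cats1 !count_cat ca /= fk eqxx addn0 addn1.
by rewrite -[X in _ == X.+1]addn0 addnS eqSS eqn_add2l -leqn0 leqNgt -has_count -all_predC.
Qed.

Lemma graft_unmarked s m t' u b : ~~ prefix u m ->
  graft k m s u b = graft k [::] (fun v => if v == m then t' else s v) u b.
Proof.
elim/tree_ind_mem: b u => i ts IH u um /=.
have [uE|unm] := eqVneq u m; first by rewrite uE prefix_refl in um.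
rewrite /= ?andbT ?andbb; case: ifP => // _; congr Node.
apply: eq_from_onth => j; rewrite !onth_imap add0n.
case tj : (onth ts j) => [t|//] /=; congr Some; apply: IH; first exact: onth_mem_eq tj.
by apply: contra um => /(prefix_trans _); apply; exact: prefix_rcons.
Qed.

Lemma graft_siblings s m t' u ts j m' : m = u ++ j :: m' ->
  let g1 := imap (fun l t => graft k m s (rcons u l) t) 0 ts in
  let g2 := imap (fun l t =>
    graft k [::] (fun v => if v == m then t' else s v) (rcons u l) t) 0 ts in
  take j g1 = take j g2 /\ drop j.+1 g1 = drop j.+1 g2.
Proof.
move=> mE g1 g2; apply: eq_around => l lj; rewrite !onth_imap add0n.
case: (onth ts l) => //= t; congr Some; apply: graft_unmarked.
by rewrite mE -cats1 prefix_catr// eqxx /= (negbTE lj).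
Qed.

(** Frames record only what hangs off the path to the mark, and the two graftings differ at the mark
    alone. *)
Lemma focus_graft s m t' u b m' fs : u != [::] -> m = u ++ m' ->
  prune b = b -> type_at b m' = Some k ->
  (focus (graft k m s u b) m' fs).2 =
  (focus (graft k [::] (fun v => if v == m then t' else s v) u b) m' fs).2.
Proof.
elim: m' u b fs => [|j m' IH] u [i ts] fs u0 mE; first by case: graft; case: graft.
rewrite /type_at /=; case: eqP => [_ [<-]|/eqP ik]; first by rewrite onth0n.
move=> -[tsE]; have [eqt eqd] := graft_siblings s t' ts mE.
rewrite /= !onth_imap add0n eqt eqd.
case tj : (onth ts j) => [t|//] /= tm; apply: IH.
- by rewrite -cats1; case: (u).
- by rewrite cat_rcons.
- exact: prune_onth tsE tj.
- exact: tm.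
Qed.

Lemma focus_graft_root s m t' b : m != [::] ->
  prune_root b = b -> type_at b m = Some k ->
  (focus (graft k m s [::] b) m [::]).2 =
  (focus (graft k [::] (fun v => if v == m then t' else s v) [::] b) m [::]).2.
Proof.
case: m b => [//|j m] [i ts] _ /= [tsE]; rewrite /type_at /= andbF /=.
have [eqt eqd] := graft_siblings s t' ts (erefl ([::] ++ j :: m)).
rewrite !onth_imap add0n eqt eqd; case tj : (onth ts j) => [t|//] /= tm.
exact: focus_graft (prune_onth tsE tj) tm.
Qed.

(** The frames contributed by one block, from below. The marked vertex itself is no frame of it, so
    the only frame of type [k] is the last one, the root of the block. *)
Definition is_block (a : seq (frame G)) : Prop :=
  exists c f, [/\ a = rcons c f, all (fun f => ftype f != k) c & ftype f = k].

Section Block.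
(* Exempting the mark from grafting has the same effect on the frames as grafting
   there any tree [t'] with root type [k]. *)
Variables (s : seq nat -> tree G) (b : tree G) (m : seq nat).
Hypotheses (sk : forall u, root_type (s u) = k) (m0 : m != [::])
  (bE : prune_root b = b) (bk : root_type b = k) (bm : type_at b m = Some k).

Let F := (focus (graft k m s [::] b) m [::]).2.

Lemma graft_block t' : root_type t' = k ->
  [/\ is_block F, m = addr F &
    plug t' F = graft k [::] (fun v => if v == m then t' else s v) [::] b].
Proof.
move=> tk'; set s' := fun _ => _; have sk' u : root_type (s' u) = k.
  by rewrite /s'; case: ifP.
have := mem_cut_root_graft sk' m0 bE bm; rewrite {1}/s' eqxx => mc.
have rk : root_type (graft k [::] s' [::] b) = k.
  by case: (b) bk => i ts /=; rewrite andbF.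
have [c [f [gE mE ck fk]]] := cut_root_plug rk mc.
have FE : F = rcons c f.
  by rewrite /F (focus_graft_root s t' m0 bE bm) -/s' gE mE focus_plug cats0.
by rewrite FE -gE -mE; split=> //; exists c, f.
Qed.

(** Splits the event that a block yields the frames [a] into one condition on the block with its
    mark and one on each grafted tree, a form to which independence applies. The position of the
    mark is left out since [t'] comes from the lower blocks. *)
Lemma graft_blockP t' a : root_type t' = k -> is_block a ->
  F = a <-> [/\ b = prune_root (plug t' a), m = addr a &
    forall u y, (u, y) \in cut_root (plug t' a) -> u != m -> s u = y].
Proof.
move=> tk' [c [f [aE ck fk]]]; have [_ mE gE] := graft_block tk'.
move: gE; set s' := fun _ => _ => gE.
have sk' u : root_type (s' u) = k by rewrite /s'; case: ifP.
split=> [FE|[bE' mE' H]].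
  rewrite -FE gE -mE prune_root_graft//; split=> // u y uy um.
  by have := cut_root_graft sk' bE uy; rewrite /s' (negbTE um).
(* Tree and address determine the zipper, so it is enough to compare the trees obtained by plugging
   in [t']. *)
apply: (@proj2 (t' = t')); apply: plug_addr_inj; last by rewrite -mE -mE'.
rewrite gE {1}bE'; apply: graft_prune_root => v y vy; rewrite /s'.
case: eqP => [vm|/eqP]; last exact: H.
have my := plug_cut_root f tk' ck; rewrite -aE -mE' -vm in my.
exact: uniq_unzip1 (uniq_cut_root (plug t' a)) my vy.
Qed.

End Block.

End CutAndGraft.

(** * Weights of trees *)

Section Weights.
Variables (R : realType) (G : countType) (sigma : G -> seq G -> R) (k : G).
Implicit Types (t b : tree G) (ts : seq (tree G)).

Definition weight t : R :=
  \prod_(s <- fringes t) sigma (root_type s) (word_of s).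

(** In a stopped tree the empty words at non-root vertices of type [k] are forced, hence these
    vertices contribute no factor to the probability. *)
Definition block_nodes b : seq (seq nat * tree G) :=
  let: Node i ts := b in
  ([::], b) :: [seq x <- push_from 0 (map (@nodes G) ts) | root_type x.2 != k].

Definition block_weight b : R :=
  \prod_(x <- block_nodes b) sigma (root_type x.2) (word_of x.2).

Lemma weightE i ts : weight (Node i ts) =
  sigma i (map (@root_type G) ts) * \prod_(t <- ts) weight t.
Proof. by rewrite /weight fringesE big_cons big_flatten big_map. Qed.

Lemma big_push_from (V : eqType) n (cs : seq (seq (seq nat * V))) (Q : pred V) (F : V -> R) :
  \prod_(x <- push_from n cs | Q x.2) F x.2 =
  \prod_(c <- cs) \prod_(x <- c | Q x.2) F x.2.
Proof.
transitivity (\prod_(y <- unzip2 (push_from n cs) | Q y) F y); first by rewrite big_map.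
rewrite unzip2_push_from big_flatten big_map; apply: eq_bigr => c _.
by rewrite big_map.
Qed.

(** Each vertex either lies in exactly one cut tree or survives in the pruned tree with another type
    than [k]. Pruning keeps root types, so the survivors keep their words. *)
Lemma weight_prune t : weight t =
  \prod_(s <- fringes (prune k t) | root_type s != k) sigma (root_type s) (word_of s)
  * \prod_(x <- cut k t) weight x.2.
Proof.
elim/tree_ind_mem: t => i ts IH /=; case: eqP => [->|/eqP ik].
  by rewrite fringesE /= !big_cons !big_nil /= eqxx mul1r mulr1.
rewrite weightE fringesE big_cons /= ik -map_comp.
rewrite (eq_map (root_type_prune k)) -mulrA; congr (_ * _).
rewrite big_flatten !big_map (big_push_from _ _ predT) big_map -big_split /=.
by apply: eq_big_seq => t /IH.
Qed.

Lemma weight_prune_root t : weight t =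
  block_weight (prune_root k t) * \prod_(x <- cut_root k t) weight x.2.
Proof.
case: t => i ts; rewrite weightE /block_weight /= big_cons /= -map_comp.
rewrite (eq_map (root_type_prune k)) -mulrA; congr (_ * _).
rewrite big_filter [\prod_(x <- push_from _ _ | _) _](big_push_from _ _
  (fun s => root_type s != k) (fun s => sigma (root_type s) (word_of s))).
rewrite (big_push_from _ _ predT) !big_map -big_split /=.
by apply: eq_bigr => t _; rewrite {1}weight_prune /fringes big_map.
Qed.

Lemma uniq_block_nodes b : uniq (unzip1 (block_nodes b)).
Proof.
have := uniq_vertices b; rewrite vertices_nodes; apply: subseq_uniq.
case: b => i ts; apply: map_subseq; rewrite /= eqxx; exact: filter_subseq.
Qed.

Lemma realizesE (c : seq nat -> G -> seq G) i t : realizes c i t <->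
  root_type t = i /\ forall x, x \in nodes t -> c x.1 (root_type x.2) = word_of x.2.
Proof.
split=> -[ti H]; split=> //.
  by move=> [u [j ts]] /nodesP /= /H.
by move=> u j ts /nodesP /H.
Qed.

Lemma realizes_uniq (c : seq nat -> G -> seq G) i t t' :
  realizes c i t -> realizes c i t' -> t = t'.
Proof.
elim/tree_ind_mem: t c i t' => j ts IH c i [j' ts'] [/= -> H] [/= ji H'].
have /= Hr := H [::] _ _ (erefl _); have /= Hr' := H' [::] _ _ (erefl _).
rewrite ji in Hr' *; rewrite Hr in Hr'.
congr Node; apply: eq_from_onth => l.
have := congr1 (fun s : seq G => onth s l) Hr'; rewrite !onth_map.
case tl : (onth ts l) => [t|]; case tl' : (onth ts' l) => [t'|] //= [tt'].
congr Some; apply: (IH _ (onth_mem_eq tl) (fun u => c (l :: u)) (root_type t)).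
  by split=> // u a b sE; apply: (H (l :: u)); rewrite /= tl.
by split=> // u a b sE; apply: (H' (l :: u)); rewrite /= tl'.
Qed.

Lemma prune_fixP b : prune k b = b <->
  forall x, x \in nodes b -> root_type x.2 = k -> word_of x.2 = [::].
Proof.
split.
  elim/tree_ind_mem: b => i ts IH /=; case: eqP => [_ [<-]|ik [tsE]] x.
    by rewrite inE => /eqP ->.
  rewrite inE => /predU1P[-> /ik//|]; case: x => u y /push_from_onth[j [t [v [tj vy ->]]]].
  exact: IH (onth_mem_eq tj) (prune_onth tsE tj) _ vy.
elim/tree_ind_mem: b => i ts IH H /=; case: eqP => [ik|ik].
  have := H _ (mem_head _ _) ik; by case: (ts).
congr Node; apply: eq_from_onth => l; rewrite onth_map.
case tl : (onth ts l) => [t|//] /=; congr Some.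
apply: IH (onth_mem_eq tl) _ => -[u y] uy.
by apply: (H (l :: u, y)); rewrite inE /= (onth_push_from tl uy).
Qed.

Lemma prune_root_fixP b : prune_root k b = b <->
  forall x, x \in nodes b -> x.1 != [::] -> root_type x.2 = k -> word_of x.2 = [::].
Proof.
case: b => i ts; split => [/= [tsE] x|H /=].
  rewrite inE => /predU1P[-> //|]; case: x => u y /push_from_onth[j [t [v [tj vy ->]]]] _.
  exact: (proj1 (prune_fixP t) (prune_onth tsE tj) (v, y) vy).
congr Node; apply: eq_from_onth => l; rewrite onth_map.
case tl : (onth ts l) => [t|//] /=; congr Some.
apply/prune_fixP => -[u y] uy.
by apply: (H (l :: u, y)); rewrite // inE /= (onth_push_from tl uy).
Qed.

Lemma prune_root_idem t : prune_root k (prune_root k t) = prune_root k t.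
Proof.
case: t => i ts /=; congr Node; rewrite -map_comp; apply: eq_map => t /=.
elim/tree_ind_mem: t => j ts' IH /=; case: ifP => /= ->//.
by congr Node; rewrite -map_comp; apply/eq_in_map => t /IH.
Qed.

Lemma block_nodesP b x : x \in block_nodes b =
  (x \in nodes b) && ((x.1 == [::]) || (root_type x.2 != k)).
Proof.
case: b => i ts; rewrite /= !inE mem_filter.
case: x => -[|j u] y /=; last by rewrite andbC.
have /negbTE -> : ([::], y) \notin push_from 0 (map (@nodes G) ts).
  by apply/negP => /push_from_onth[j [t [v []]]].
by rewrite andbF orbF andbT.
Qed.

Lemma realizes_stop (c : seq nat -> G -> seq G) b : realizes (stop_at k c) k b <->
  [/\ root_type b = k, prune_root k b = b &
      forall x, x \in block_nodes b -> c x.1 (root_type x.2) = word_of x.2].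
Proof.
rewrite realizesE /stop_at; split=> [[bk H]|[bk /prune_root_fixP bE H]].
  split=> //; first by apply/prune_root_fixP => x /H + x0 xk; rewrite xk eqxx x0 => /= <-.
  move=> x; rewrite block_nodesP => /andP[/H <-]; case: ifP => // /andP[-> x0].
  by rewrite (negbTE x0).
split=> // x xb; case: ifP => [/andP[/eqP xk x0]|xk]; first by rewrite bE.
by apply: H; rewrite block_nodesP xb; move/negbT: xk; rewrite negb_and negbK orbC.
Qed.

Definition stopped_vertices b : seq (seq nat) :=
  [seq u <- typed_vertices k b | u != [::]].

(** The root accounts for the difference: an expected number 2 of type [k] vertices means an
    expected number 1 of admissible marks. *)
Lemma size_stopped_vertices b : root_type b = k ->
  ntype k b = (size (stopped_vertices b)).+1.
Proof.
move=> bk; have u0 : [::] \in typed_vertices k b.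
  rewrite mem_filter {1}/type_at /= bk eqxx vertices_nodes.
  by apply/mapP; exists ([::], b) => //; apply/nodesP.
rewrite /ntype -(count_predC (pred1 [::])) count_uniq_mem ?u0; last first.
  exact/filter_uniq/uniq_vertices.
by rewrite /stopped_vertices size_filter.
Qed.

Lemma mem_stopped_vertices b u :
  u \in stopped_vertices b = (u != [::]) && (type_at b u == Some k).
Proof.
rewrite !mem_filter; congr (_ && _); rewrite /type_at vertices_nodes.
case: eqP => //=; case su : (subtree b u) => [t|//] _.
by apply/mapP; exists (u, t) => //; apply/nodesP.
Qed.

Lemma uniq_stopped_vertices b : uniq (stopped_vertices b).
Proof. exact/filter_uniq/filter_uniq/uniq_vertices. Qed.

End Weights.

(** * Exponential tilting *)

Section Esum.
Variables (R : realType).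
Local Open Scope ereal_scope.

Lemma esum_mull (T : choiceType) (A : set T) (c : R) (f : T -> \bar R) :
  (0 <= c)%R -> (forall x, 0 <= f x) ->
  \esum_(x in A) (c%:E * f x) = c%:E * \esum_(x in A) f x.
Proof.
move=> c0 f0.
have le (e : R) (g : T -> \bar R) : (0 <= e)%R -> (forall x, 0 <= g x) ->
    \esum_(x in A) (e%:E * g x) <= e%:E * \esum_(x in A) g x.
  move=> e0 g0; apply: ge_ereal_sup => _ [X [fX XA] <-].
  rewrite -ge0_mule_fsumr//.
  rewrite lee_wpmul2l ?lee_fin//; apply: ereal_sup_ubound; by exists X.
apply/eqP; rewrite eq_le le//=.
have [c00|cn0] := eqVneq c 0%R.
  by rewrite c00 mul0e esum_ge0// => x _; rewrite mul0e.
have cp : (0 < c)%R by rewrite lt0r cn0.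
rewrite -lee_pdivlMl//; apply: (le_trans _ (le _ _ _ _)); rewrite ?invr_ge0//.
- by apply: le_esum => x Ax; rewrite muleA -EFinM mulVf// mul1e.
- by move=> x; rewrite mule_ge0 ?lee_fin.
Qed.

Lemma esum_subset (T : choiceType) (A B : set T) (f : T -> \bar R) :
  A `<=` B -> (forall x, B x -> 0 <= f x) ->
  \esum_(x in A) f x <= \esum_(x in B) f x.
Proof.
move=> AB f0; rewrite esum_mkcond [leRHS]esum_mkcond; apply: le_esum => x _.
case: ifPn => [/set_mem/AB/mem_set -> //|_]; by case: ifPn => // /set_mem/f0.
Qed.

Lemma esum_fibers (T1 T2 : choiceType) (h : T1 -> T2) (f : T1 -> \bar R) :
  (forall x, 0 <= f x) ->
  \esum_(x in [set: T1]) f x =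
  \esum_(y in [set: T2]) \esum_(x in [set x | h x = y]) f x.
Proof.
move=> f0; rewrite esum_esum//; apply: (reindex_esum _ setT (fun z => z.2)).
split=> [[y x] //|[y x] [y' x']|x _].
  by rewrite !inE/= => -[_ <-] [_ <-] ->.
by exists (h x, x).
Qed.

Lemma esum_le1_ub (T : choiceType) (A : set T) (f : T -> \bar R) (M : \bar R) :
  (forall s : seq T, (forall x, x \in s -> A x) -> uniq s ->
     \sum_(x <- s) f x <= M) ->
  \esum_(x in A) f x <= M.
Proof.
move=> H; apply: ge_ereal_sup => _ [X [fX XA] <-].
rewrite fsbig_finite//; apply: H; last exact: finmap.fset_uniq.
by move=> x; rewrite in_fset_set// => /set_mem/XA.
Qed.

Lemma sum_le_esum (T : choiceType) (A : set T) (f : T -> \bar R) (s : seq T) :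
  (forall x, x \in s -> A x) -> uniq s ->
  \sum_(x <- s) f x <= \esum_(x in A) f x.
Proof.
move=> sA us; apply: esum_ge; exists [set` s].
  by split=> [|x /=]; [exact: finite_seq|exact: sA].
by rewrite fsbig_seq.
Qed.

End Esum.

(** * Sums of weights over the trees with a given root type *)

Section WeightSums.
Variables (R : realType) (G : countType) (sigma : G -> seq G -> R).
Hypothesis sigma_ge0 : forall i w, 0 <= sigma i w.
Hypothesis sigma_sum : forall i, (\esum_(w in [set: seq G]) (sigma i w)%:E = 1)%E.
Implicit Types (t : tree G) (g : tree G -> R).

Let W := weight sigma.

Lemma weight_ge0 t : 0 <= weight sigma t.
Proof. by apply: prodr_ge0 => s _. Qed.

Definition typed_sum g i : \bar R :=
  \esum_(t in [set t : tree G | root_type t = i]) (W t * g t)%:E.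

Definition children t : seq (tree G) := let: Node _ ts := t in ts.

(** The branching property in analytic form: weights are multiplicative, so the sum over forests
    with root types [w] factorises tree by tree. *)
Lemma esum_word g w : (forall t, 0 <= g t) ->
  (forall i, (typed_sum g i < +oo)%E) ->
  (\esum_(ts in [set ts | map (@root_type G) ts = w])
    (\prod_(t <- ts) (W t * g t))%:E
  = \prod_(j <- w) typed_sum g j)%E.
Proof.
move=> g0 gfin; have Wg0 t : 0 <= W t * g t by rewrite mulr_ge0 ?weight_ge0.
have S0 j : (0 <= typed_sum g j)%E by apply: esum_ge0 => t _; rewrite lee_fin.
elim: w => [|i w IH].
  rewrite [X in esum X](_ : _ = [set [::]]); last first.
    by apply/seteqP; split=> [[|? ?]//|_ ->].
  by rewrite esum_set1 !big_nil ?lee_fin.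
rewrite big_cons -IH.
pose J := [set t : tree G | root_type t = i] `*`` fun=> [set ts | map (@root_type G) ts = w].
rewrite (reindex_esum J _ (fun x => x.1 :: x.2)); last first.
  split=> [[t ts] [/= -> ->]//|[t ts] [t' ts'] _ _ [-> ->]//|[//|t ts] [ti tsw]].
  by exists (t, ts).
under eq_esum do rewrite big_cons.
rewrite -(esum_esum (a := fun t ts => (W t * g t * \prod_(s <- ts) (W s * g s))%:E)); last first.
  by move=> t ts _ _; rewrite lee_fin mulr_ge0// prodr_ge0.
set Z := (\esum_(ts in _) _)%E in IH *.
have Z0 : (0 <= Z)%E by apply: esum_ge0 => ts _; rewrite lee_fin prodr_ge0.
have Zfin : Z \is a fin_num.
  rewrite IH ge0_fin_numE ?prode_ge0//; elim: (w) => [|j w' IHw].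
    by rewrite big_nil ltry.
  by rewrite big_cons lte_mul_pinfty// ge0_fin_numE.
rewrite muleC -(fineK Zfin) -esum_mull ?fine_ge0//.
apply: eq_esum => t _; rewrite (fineK Zfin) muleC -esum_mull//.
  by move=> ts; rewrite lee_fin prodr_ge0.
Qed.

Lemma typed_sum_children g i : (forall t, 0 <= g t) ->
  (forall j, (typed_sum g j < +oo)%E) ->
  typed_sum (fun t => \prod_(s <- children t) g s) i =
  (\esum_(w in [set: seq G]) ((sigma i w)%:E * \prod_(j <- w) typed_sum g j))%E.
Proof.
move=> g0 gfin; have Wg0 t : 0 <= W t * g t by rewrite mulr_ge0 ?weight_ge0.
rewrite /typed_sum (reindex_esum [set: seq (tree G)] _ (Node i)); last first.
  by split=> [//|ts ts' _ _ []//|[j ts] /= <-]; exists ts.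
rewrite (esum_fibers (map (@root_type G))); last first.
  by move=> ts; rewrite lee_fin mulr_ge0 ?weight_ge0// prodr_ge0.
apply: eq_esum => w _; rewrite -/(typed_sum _) -esum_word// -esum_mull//; last first.
  by move=> ts; rewrite lee_fin prodr_ge0.
apply: eq_esum => ts /= tsw.
by rewrite -EFinM /W weightE tsw -mulrA -big_split.
Qed.

Definition tsize t := size (fringes t).

Lemma tsizeE i ts : tsize (Node i ts) = (sumn (map tsize ts)).+1.
Proof. by rewrite /tsize fringesE /= size_flatten /shape -map_comp. Qed.

Lemma tsize_child i ts t : t \in ts -> (tsize t < tsize (Node i ts))%N.
Proof.
move=> tts; rewrite tsizeE ltnS sumnE big_map (big_rem t) //=.
exact: leq_addr.
Qed.

Lemma tsize_fringes t t' : t' \in fringes t -> (tsize t' <= tsize t)%N.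
Proof.
elim/tree_ind_mem: t => i ts IH; rewrite fringesE inE => /predU1P[->//|].
move=> /flatten_mapP[s sts t's].
exact: leq_trans (IH s sts t's) (ltnW (tsize_child i sts)).
Qed.

Variables (k : G) (T : tree G) (theta c : R).
Hypothesis Tk : root_type T = k.

Definition tilt t : R :=
  expR (theta * (t == T)%:R - c * (root_type t == k)%:R).

Lemma tilt_ge0 t : 0 <= tilt t. Proof. exact: expR_ge0. Qed.

(* Only the factors at depth less than [H] are kept, but the whole tree is still
   weighted; hence the induction on [H] in [typed_sum_tilt_upto] starts with a
   sum that is at most 1. *)
Fixpoint tilt_upto (H : nat) t : R :=
  if H is H'.+1 then tilt t * \prod_(s <- children t) tilt_upto H' s else 1.

Lemma tilt_upto_ge0 H t : 0 <= tilt_upto H t.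
Proof.
elim: H t => [//|H IH] t /=.
by rewrite mulr_ge0 ?tilt_ge0// prodr_ge0.
Qed.

Lemma tilt_uptoE H t : (tsize t <= H)%N ->
  tilt_upto H t = \prod_(s <- fringes t) tilt s.
Proof.
elim: H t => [[i ts]|H IH [i ts]]; first by rewrite tsizeE.
move=> tH; rewrite fringesE big_cons big_flatten big_map /=; congr (_ * _).
apply: eq_big_seq => s sts; apply: IH.
by rewrite -ltnS; exact: leq_trans (tsize_child i sts) tH.
Qed.

Lemma prod_tiltE t : \prod_(s <- fringes t) tilt s =
  expR (theta * (count (pred1 T) (fringes t))%:R - c * (ntype k t)%:R).
Proof.
rewrite ntype_fringes; elim: (fringes t) => [|s l IH].
  by rewrite big_nil !mulr0 subr0 expR0.
rewrite big_cons IH /tilt -expRD /= !natrD; congr expR; ring.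
Qed.

(* [T] is not a fringe subtree of its own proper subtrees. *)
Lemma tilt_upto_child H t : t \in children T ->
  (0 <= theta -> 0 <= c -> tilt_upto H t <= 1) /\
  (theta <= 0 -> c <= 0 -> 1 <= tilt_upto H t).
Proof.
move=> tT; have : T \notin fringes t.
  apply/negP => /tsize_fringes; rewrite leqNgt => /negP; apply.
  by case: (T) tT => i ts /= /tsize_child.
elim: H t {tT} => [//|H IH] [i ts]; rewrite fringesE inE negb_or => /andP[tT tsT] /=.
have IHs s : s \in ts -> T \notin fringes s.
  by move=> sts; apply: contra tsT => Ts; apply/flatten_mapP; exists s.
rewrite /tilt eq_sym (negbTE tT) mulr0 sub0r.
split=> th0 c0.
  rewrite mulr_ile1 ?expR_ge0 ?prodr_ge0//.
  - by move=> s _; exact: tilt_upto_ge0.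
  - by rewrite expR_le1 oppr_le0 mulr_ge0.
  - rewrite big_seq; apply: prodr_ile1 => s sts.
    by rewrite tilt_upto_ge0 (proj1 (IH _ (IHs _ sts))).
rewrite -[leLHS]mulr1 ler_pM//.
- by rewrite -expR0 ler_expR oppr_ge0 mulr_le0_ge0.
- rewrite big_seq; elim/big_ind : _ => // [x y x1 y1|s sts]; last exact: (proj2 (IH _ (IHs _ sts))).
  by rewrite -[leLHS]mulr1 ler_pM.
Qed.

Hypothesis W_le1 : forall i, (typed_sum (fun=> 1%R) i <= 1)%E.
Hypothesis signs : (0 <= theta /\ 0 <= c) \/ (theta <= 0 /\ c <= 0).
Hypothesis theta_c : (expR theta - 1) * W T <= c.

Lemma typed_sum_tilt_upto H i : (typed_sum (tilt_upto H) i <= 1)%E.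
Proof.
elim: H i => [//|H IH] i.
have g0 := tilt_upto_ge0 H.
have P1 j : (typed_sum (fun t => \prod_(s <- children t) tilt_upto H s)%R j <= 1)%E.
  rewrite typed_sum_children//; last by move=> j'; rewrite (le_lt_trans (IH j'))// ltry.
  rewrite -[leRHS](sigma_sum j); apply: le_esum => w _.
  rewrite -[leRHS]mule1 lee_wpmul2l ?lee_fin//.
  suff /andP[] : (0 <= \prod_(j0 <- w) typed_sum (tilt_upto H) j0 <= 1)%E by [].
  elim/big_ind : _ => [|x y /andP[x0 x1] /andP[y0 y1]|j0 _]; rewrite ?lee01 ?lexx//.
    by rewrite mule_ge0//= -[leRHS]mule1 lee_pmul.
  by rewrite IH andbT; apply: esum_ge0 => t _; rewrite lee_fin mulr_ge0 ?weight_ge0.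
(* [T] has type [k], so for any other root type the root factor is 1 and [P1] is already the
   claim. *)
have [ik|ik] := eqVneq i k; last first.
  apply: le_trans (P1 i); rewrite le_eqVlt; apply/orP; left; apply/eqP.
  apply: eq_esum => t /= ti; rewrite /tilt ti (negbTE ik) mulr0 subr0.
  have /negbTE -> : t != T by apply: contra ik => /eqP tT; rewrite -ti tT Tk.
  by rewrite mulr0 expR0 mul1r.
pose h t := \prod_(s <- children t) tilt_upto H s.
have h0 t : 0 <= h t by apply: prodr_ge0.
have Wh0 t : 0 <= W t * h t by rewrite mulr_ge0 ?weight_ge0.
have split_T (f : tree G -> \bar R) : (forall t, 0 <= f t)%E ->
    (\esum_(t in [set t | root_type t = i]) f t = f T +
     \esum_(t in [set t | root_type t = i] `&` ~` [set T]) f t)%E.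
  move=> f0; rewrite (esumID [set T])//; congr (_ + _)%E.
  rewrite setIC (_ : _ `&` _ = [set T]) ?esum_set1//.
  by apply/seteqP; split=> [t []//|t /= ->]; rewrite Tk ik.
have := P1 i; rewrite /typed_sum (split_T (fun t => (W t * h t)%:E)); last first.
  by move=> t; rewrite lee_fin.
rewrite split_T; last first.
  by move=> t; rewrite lee_fin mulr_ge0 ?weight_ge0 ?tilt_upto_ge0.
set X := (\esum_(t in _) (W t * h t)%:E)%E => X1.
(* For root type [k] every tree except [T] has the root factor [expR (- c)]. *)
have -> : (\esum_(t in [set t | root_type t = i] `&` ~` [set T])
    (W t * tilt_upto H.+1 t)%:E = (expR (- c))%:E * X)%E.
  rewrite -esum_mull ?expR_ge0//; apply: eq_esum => t [/= ti /eqP/negbTE tT].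
  by rewrite -EFinM -/(h t) /tilt ti ik eqxx tT mulr0 mulr1 sub0r mulrCA.
have X0 : (0 <= X)%E by apply: esum_ge0 => t _; rewrite lee_fin.
have Xfin : X \is a fin_num.
  rewrite ge0_fin_numE//; apply: le_lt_trans (ltry 1); apply: le_trans X1.
  by rewrite leeDr// lee_fin.
move: X1 X0; rewrite -(fineK Xfin) -EFinM -!EFinD !lee_fin.
move: (fine X) => x X1 x0; rewrite /= -/(h T) /tilt eqxx Tk eqxx !mulr1.
have q0 := h0 T; have p0 : 0 <= W T := weight_ge0 T.
(* The factors below the root of [T] never hurt: their product is at most 1 when [theta >= 0] and at
   least 1 when [theta <= 0], in accordance with the sign of [expR theta - 1]. *)
have qle : (expR theta - 1) * h T <= expR theta - 1.
  have [[th0 c0]|[th0 c0]] := signs.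
    rewrite ler_piMr// ?subr_ge0 -?expR0 ?ler_expR//.
    rewrite expR0 /h big_seq; apply: prodr_ile1 => s sT.
    by rewrite tilt_upto_ge0 (proj1 (tilt_upto_child H sT)).
  have e1 : expR theta <= 1 by rewrite -expR0 ler_expR.
  suff q1 : 1 <= h T by move: e1 q1; move: (expR theta) (h T) => e q; nra.
  rewrite /h big_seq; elim/big_ind : _ => // [y z y1 z1|s sT].
    by rewrite -[leLHS]mulr1 ler_pM.
  exact: (proj2 (tilt_upto_child H sT)).
rewrite expRD; have ec := expR_ge1Dx c.
suff : expR theta * W T * h T + x <= expR c.
  move=> le; rewrite (_ : _ + _ = expR (- c) * (expR theta * W T * h T + x)); last by ring.
  by rewrite expRN mulrC ler_pdivrMr ?expR_gt0// mul1r.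
apply: le_trans ec; move: theta_c qle p0 X1.
move: (expR theta) (W T) (h T) => e p q ec qle p0 X1.
have := ler_wpM2l p0 qle; lra.
Qed.

Lemma typed_sum_tilt i : (typed_sum (fun t => \prod_(s <- fringes t) tilt s)%R i <= 1)%E.
Proof.
apply: esum_le1_ub => l lA ul.
(* The sum is bounded through its finite parts, and on finitely many trees a large [H] truncates
   nothing. *)
pose H := \max_(t <- l) tsize t.
apply: le_trans (typed_sum_tilt_upto H i); apply: le_trans (sum_le_esum _ lA ul).
rewrite le_eqVlt; apply/orP; left; apply/eqP; apply: eq_big_seq => t tl.
by rewrite tilt_uptoE// /H (big_rem t)//= leq_maxl.
Qed.

Lemma weight_tail i (B : set (tree G)) (K : R) :
  (forall t, B t -> K <= theta * (count (pred1 T) (fringes t))%:R - c * (ntype k t)%:R) ->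
  (\esum_(t in [set t | root_type t = i] `&` B) (W t)%:E <= (expR (- K))%:E)%E.
Proof.
move=> BK; rewrite -[leRHS]mule1; apply: le_trans; last first.
  by apply: lee_wpmul2l (typed_sum_tilt i); rewrite lee_fin expR_ge0.
have g0 t : 0 <= W t * \prod_(s <- fringes t) tilt s.
  by rewrite mulr_ge0 ?weight_ge0// prodr_ge0// => s _; rewrite tilt_ge0.
rewrite -esum_mull ?expR_ge0//.
apply: le_trans (esum_subset (@subIsetl _ _ B) _); last first.
  by move=> t _; rewrite mule_ge0 ?lee_fin ?expR_ge0.
apply: le_esum => t [_ /BK Kt]; rewrite -EFinM lee_fin prod_tiltE mulrCA -expRD.
rewrite -[leLHS]mulr1 ler_wpM2l ?weight_ge0// -[leLHS]expR0 ler_expR.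
by rewrite addrC subr_ge0.
Qed.

End WeightSums.

(** * Deviation of the number of fringe subtrees *)

Lemma expRB1_le (R : realType) (x : R) : x <= 2^-1 -> expR x - 1 <= x + 2 * x ^+ 2.
Proof.
move=> x2; have : 1 - x <= expR (- x) by exact: expR_ge1Dx.
have : expR x * expR (- x) = 1 by rewrite -expRD subrr expR0.
move: (expR_gt0 x) (expR_gt0 (- x)); move: (expR x) (expR (- x)) => e f.
(* From [expR x * (1 - x) <= 1] and [(1 - x) * (1 + x + 2 * x ^+ 2) = 1 + x ^+ 2 * (1 - 2 * x)],
   which is at least 1 for [x <= 1 / 2]. *)
nra.
Qed.

Section Deviation.
Variables (R : realType) (G : countType) (sigma : G -> seq G -> R).
Hypothesis sigma_ge0 : forall i w, 0 <= sigma i w.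
Hypothesis sigma_sum : forall i, (\esum_(w in [set: seq G]) (sigma i w)%:E = 1)%E.
Hypothesis W_le1 : forall i, (typed_sum sigma (fun=> 1%R) i <= 1)%E.
Variables (k : G) (T : tree G).
Hypothesis Tk : root_type T = k.

Let W := weight sigma.
Let N (t : tree G) : R := (count (pred1 T) (fringes t))%:R.
Let n (t : tree G) : R := (ntype k t)%:R.

Definition deviating (eps s : R) : set (tree G) :=
  [set t | s <= n t /\ eps * n t <= `|N t - W T * n t|].

Lemma weight_deviation i eps s : 0 < eps -> eps <= 1 ->
  (\esum_(t in [set t | root_type t = i] `&` deviating eps s) (W t)%:E
    <= (2 * expR (- (eps ^+ 2 / 8 * s)))%:E)%E.
Proof.
move=> e0 e1; have W0 t : 0 <= W t by exact: weight_ge0.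
have p1 : W T <= 1.
  rewrite -lee_fin; apply: le_trans (W_le1 (root_type T)).
  have := @sum_le_esum R _ [set t : tree G | root_type t = root_type T]
    (fun t => (W t * 1)%:E) [:: T].
  rewrite big_seq1 mulr1; apply=> // x.
  by rewrite inE => /eqP ->.
have e4 : 0 <= eps / 4 by lra.
have e8 : 0 <= eps ^+ 2 / 8 by rewrite divr_ge0// sqr_ge0.
have p0 := W0 T; have n0 t : 0 <= n t by [].
pose up_dev := [set t | s <= n t /\ eps * n t <= N t - W T * n t].
pose lo_dev := [set t | s <= n t /\ eps * n t <= W T * n t - N t].
apply: (@le_trans _ _ (\esum_(t in [set t | root_type t = i] `&` up_dev) (W t)%:E +
  \esum_(t in [set t | root_type t = i] `&` lo_dev) (W t)%:E)%E).
  rewrite !esum_mkcondr -esumD; try by move=> t _; case: ifP => _; rewrite lee_fin.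
  apply: le_esum => t _; case: ifPn => [/set_mem[st]|_]; last first.
    by rewrite adde_ge0//; case: ifP => _; rewrite lee_fin.
  rewrite ler_normr opprB => /orP[tu|tl].
    by rewrite [t \in up_dev]mem_set// leeDl//; case: ifP => _; rewrite lee_fin.
  by rewrite [t \in lo_dev]mem_set// leeDr//; case: ifP => _; rewrite lee_fin.
rewrite -[2]/(1 + 1) mulrDl mul1r EFinD; apply: leeD.
(* theta = +-eps/4 and c = theta p + |theta| eps/2; for p < eps/2 the lower
   deviation only occurs in trees without vertices of type k, where theta = 0
   suffices. *)
- apply: (weight_tail sigma_ge0 sigma_sum (theta := eps / 4)
    (c := eps / 4 * W T + eps ^+ 2 / 8) Tk) => //.
  + by left; split; [|rewrite addr_ge0// mulr_ge0]; rewrite ?divr_ge0// ?sqr_ge0// ltW.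
  (* The quadratic term [2 * theta ^+ 2] equals [eps ^+ 2 / 8]; as [W T <= 1], the excess of [c]
     over [theta * W T] covers it. *)
  + have /expRB1_le/(ler_wpM2r p0) : eps / 4 <= 2^-1 by lra.
    have := ler_wpM2l e8 p1.
    by rewrite -/(W T); move: (expR _) (W T) => e p; lra.
  (* The deviation yields [theta * eps * n t], that is [eps ^+ 2 / 4 * n t], and the excess in [c]
     takes away half of it. *)
  + move=> t [st ut]; rewrite -/(N t) -/(n t).
    have := ler_wpM2l e8 st; have := ler_wpM2l e4 ut.
    by move: (n t) (N t) (W T) => nt Nt p; lra.
have [pe|pe] := leP (eps / 2) (W T).
  apply: (weight_tail sigma_ge0 sigma_sum (theta := - (eps / 4))
    (c := - (eps / 4 * W T) + eps ^+ 2 / 8) Tk) => //.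
  + right; split; first by rewrite oppr_le0 divr_ge0// ltW.
    by have := ler_wpM2l e4 pe; move: (W T) => p; lra.
  + have /expRB1_le/(ler_wpM2r p0) : - (eps / 4) <= 2^-1 by lra.
    have := ler_wpM2l e8 p1.
    by rewrite -/(W T); move: (expR _) (W T) => e p; lra.
  + move=> t [st ut]; rewrite -/(N t) -/(n t).
    have := ler_wpM2l e8 st; have := ler_wpM2l e4 ut.
    by move: (n t) (N t) (W T) => nt Nt p; lra.
apply: (weight_tail sigma_ge0 sigma_sum (theta := 0) (c := 0) Tk) => //.
- by left.
- by rewrite expR0 subrr mul0r.
- move=> t [st ut]; rewrite !mul0r subrr.
  have N0 : 0 <= N t by [].
  have nt0 : n t = 0.
    apply/eqP; rewrite eq_le n0 andbT.
    by move: (n t) (N t) (W T) (n0 t) st ut p0 pe N0 => nt Nt p; nra.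
  move: st; rewrite nt0 => s0.
  by rewrite mulr_ge0_le0// divr_ge0// sqr_ge0.
Qed.

End Deviation.

(** * Discrete random variables *)

Section TreeCountable.
Variable G : countType.

Fixpoint tree_encode (t : tree G) : GenTree.tree G :=
  let: Node i ts := t in GenTree.Node 0 (GenTree.Leaf i :: map tree_encode ts).

Fixpoint tree_decode (g : GenTree.tree G) : option (tree G) :=
  if g is GenTree.Node _ (GenTree.Leaf i :: l) then Some (Node i (pmap tree_decode l))
  else None.

Lemma tree_encodeK : pcancel tree_encode tree_decode.
Proof.
elim/tree_ind_mem => i ts IH /=; congr (Some (Node i _)).
elim: ts IH => [//|t ts IHts] IH /=; rewrite IH ?mem_head//= IHts//.
by move=> t' t'ts; apply: IH; rewrite inE t'ts orbT.
Qed.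

End TreeCountable.

HB.instance Definition _ (G : countType) := PCanIsCountable (@tree_encodeK G).

Section DiscreteMeasurable.
Context d (Omega : measurableType d).

(** Random trees and frames take countably many values. Once they are measurable in this sense,
    every event depending only on them is measurable, including the events on laws that arise from
    weak neighbourhoods. *)
Definition discretely_measurable (V : Type) (X : Omega -> V) :=
  forall B : set V, measurable (X @^-1` B).

Lemma discretely_measurableP (V : countType) (X : Omega -> V) :
  (forall v, measurable (X @^-1` [set v])) -> discretely_measurable X.
Proof.
move=> mX B.
rewrite (_ : _ @^-1` _ = \bigcup_n if @unpickle V n is Some v then
    if v \in B then X @^-1` [set v] else set0 else set0).
  apply: bigcupT_measurable => n; case: (unpickle n) => // v.
  by case: ifP => _; [exact: mX|exact: measurable0].
apply/seteqP; split=> [w Bw|w [n _]].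
  by exists (pickle (X w)) => //; rewrite pickleK mem_set.
by case: (unpickle n) => // v; case: ifPn => // /set_mem Bv /= ->.
Qed.

Lemma discretely_measurable_cst (V : Type) (v : V) :
  discretely_measurable (fun=> v).
Proof.
move=> B; have [Bv|Bv] := pselect (B v).
  rewrite (_ : _ @^-1` _ = setT); first exact: measurableT.
  by apply/seteqP; split.
rewrite (_ : _ @^-1` _ = set0); first exact: measurable0.
by apply/seteqP; split.
Qed.

Lemma discretely_measurable_comp (V W : Type) (f : V -> W) (X : Omega -> V) :
  discretely_measurable X -> discretely_measurable (f \o X).
Proof. by move=> mX B; exact: mX (f @^-1` B). Qed.

(** Splitting over the countably many values of [X]. It handles a tree grown from a random root type
    and grafting on a random block. *)
Lemma discretely_measurable_bind (V : countType) (W : Type) (X : Omega -> V)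
    (Y : V -> Omega -> W) :
  discretely_measurable X -> (forall v, discretely_measurable (Y v)) ->
  discretely_measurable (fun w => Y (X w) w).
Proof.
move=> mX mY B.
rewrite (_ : _ @^-1` _ = \bigcup_n if @unpickle V n is Some v then
    X @^-1` [set v] `&` Y v @^-1` B else set0).
  apply: bigcupT_measurable => n; case: (unpickle n) => // v.
  by apply: measurableI; [exact: mX|exact: mY].
apply/seteqP; split=> [w Bw|w [n _]].
  by exists (pickle (X w)) => //; rewrite pickleK.
by case: (unpickle n) => // v [/= ->].
Qed.

Lemma discretely_measurable_pair (V W : countType) (X : Omega -> V) (Y : Omega -> W) :
  discretely_measurable X -> discretely_measurable Y ->
  discretely_measurable (fun w => (X w, Y w)).
Proof.
move=> mX mY; apply: (discretely_measurable_bind (Y := fun x w => (x, Y w))) => // x.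
exact: discretely_measurable_comp mY.
Qed.

Lemma discretely_measurable_map (A : eqType) (V : countType) (F : A -> Omega -> V) (s : seq A) :
  (forall x, x \in s -> discretely_measurable (F x)) ->
  discretely_measurable (fun w => [seq F x w | x <- s]).
Proof.
elim: s => [_|x s IH mF]; first exact: discretely_measurable_cst.
have ms : discretely_measurable (fun w => [seq F x w | x <- s]).
  by apply: IH => y ys; apply: mF; rewrite inE ys orbT.
exact: (discretely_measurable_comp (fun z => z.1 :: z.2)
  (discretely_measurable_pair (mF _ (mem_head _ _)) ms)).
Qed.

Lemma discretely_measurable_imap (A : eqType) (V : countType)
    (F : nat -> A -> Omega -> V) n (s : seq A) :
  (forall j x, x \in s -> discretely_measurable (F j x)) ->
  discretely_measurable (fun w => imap (fun j x => F j x w) n s).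
Proof.
elim: s n => [|x s IH] n mF; first exact: discretely_measurable_cst.
have ms : discretely_measurable (fun w => imap (fun j x => F j x w) n.+1 s).
  by apply: IH => j y ys; apply: mF; rewrite inE ys orbT.
exact: (discretely_measurable_comp (fun z => z.1 :: z.2)
  (discretely_measurable_pair (mF n _ (mem_head _ _)) ms)).
Qed.

Variables (R : realType) (P : probability Omega R).

Lemma integral_discrete (V : countType) (X : Omega -> V) (f : V -> R) :
  discretely_measurable X -> (forall v, 0 <= f v) ->
  (\int[P]_w (f (X w))%:E = \esum_(v in [set: V]) ((f v)%:E * P (X @^-1` [set v])))%E.
Proof.
move=> mX f0; pose F n := X @^-1` [set v | pickle v = n].
have mF n : measurable (F n) by exact: mX.
have tF : trivIset setT F.
  by move=> m n _ _ [w [/= <- <-]].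
have FT : \bigcup_n F n = setT.
  by apply/seteqP; split=> // w _; exists (pickle (X w)).
have mf : measurable_fun (\bigcup_n F n) (fun w => (f (X w))%:E).
  by move=> _ Y _; rewrite FT setTI; exact: (mX ((EFin \o f) @^-1` Y)).
rewrite -FT ge0_integral_bigcup//; last by move=> w _; rewrite lee_fin.
rewrite nneseries_esumT; last by move=> n; apply: integral_ge0 => w _; rewrite lee_fin.
rewrite (esumID (range (@pickle V)))//; last first.
  by move=> n _; apply: integral_ge0 => w _; rewrite lee_fin.
rewrite setTI [X in (_ + X)%E]esum1 ?adde0; last first.
  move=> n [_ /= nV]; rewrite (_ : F n = set0) ?integral_set0//.
  by apply/seteqP; split=> // w /= Xn; apply: nV; exists (X w).
rewrite esum_image; last by move=> u v _ _ /(pcan_inj pickleK).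
apply: eq_esum => v _; have -> : F (pickle v) = X @^-1` [set v].
  by rewrite /F; apply/seteqP; split=> w /=; [move/(pcan_inj pickleK)|move=> ->].
rewrite -integral_cst; last exact: mX.
by apply: eq_integral => w; rewrite inE /= => ->.
Qed.

Lemma prob_discrete (V : countType) (X : Omega -> V) (B : set V) :
  discretely_measurable X ->
  P (X @^-1` B) = (\esum_(v in B) P (X @^-1` [set v]))%E.
Proof.
move=> mX; have := @integral_discrete V X (fun v => (v \in B)%:R) mX (fun=> ler0n _ _).
rewrite (_ : (fun w => _) = EFin \o (\1_(X @^-1` B) : Omega -> R)); last first.
  by apply/funext => w /=; rewrite indicE; congr (_ %:R%:E).
rewrite integral_indic//.
rewrite setIT => ->; rewrite [RHS]esum_mkcond; apply: eq_esum => v _.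
by case: ifPn => _; rewrite ?mul1e ?mul0e.
Qed.

(** Independence is phrased with a function assigning one event to each index. Here the events are
    listed and carry distinct keys; [A] recovers the event of an index from the position of its
    key. *)
Lemma indep_prod (I K : eqType) (F : I -> set (set Omega)) (ks : seq K)
    (key : K -> I) (ev : K -> set Omega) :
  independent_systems P F -> uniq (map key ks) ->
  (forall x, x \in ks -> F (key x) (ev x)) ->
  P (\bigcap_(x in [set` ks]) ev x) = (\prod_(x <- ks) fine (P (ev x)))%:E.
Proof.
case: ks => [iF _ _|x0 ks iF].
  have := iF [::] (fun=> set0) erefl.
  by rewrite !set_nil !bigcap_set0 !big_nil; apply.
set l := x0 :: ks => ul Fl.
pose A i := ev (nth x0 l (index i (map key l))).
have AE x : x \in l -> A (key x) = ev x.
  move=> xl; rewrite /A; congr ev.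
  have -> : index (key x) (map key l) = index x l.
    have kx : (index x l < size l)%N by rewrite index_mem.
    rewrite -{1}(nth_index x0 xl) -(nth_map x0 (key x0))//.
    by rewrite index_uniq// size_map.
  by rewrite nth_index.
have := iF (map key l) A ul.
rewrite big_map (eq_big_seq (fun x => fine (P (ev x)))); last by move=> x /AE ->.
move=> <-; last by move=> _ /mapP[x xl ->]; rewrite AE//; exact: Fl.
congr (P _); apply/seteqP; split=> w H.
  by move=> _ /mapP[x xl ->]; rewrite AE//; exact: H.
by move=> x xl; rewrite -AE//; apply: H; exact: map_f.
Qed.

End DiscreteMeasurable.

(** Termwise domination without loss of total mass leaves no room for a strict inequality. This is
    how laws are identified despite the default value of [grown]. *)
Lemma esum_deficit (R : realType) (V : choiceType) (A : set V) (f g : V -> R) :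
  (forall x, A x -> 0 <= f x <= g x) ->
  (\esum_(x in A) (g x)%:E <= \esum_(x in A) (f x)%:E)%E ->
  (\esum_(x in A) (f x)%:E < +oo)%E ->
  forall x, A x -> f x = g x.
Proof.
move=> fg le ffin x Ax.
have f0 y : A y -> 0 <= f y by move=> /fg/andP[].
have gf0 y : A y -> 0 <= g y - f y by move=> /fg/andP[_]; rewrite subr_ge0.
have e : (\esum_(x in A) (g x)%:E =
    \esum_(x in A) (f x)%:E + \esum_(x in A) (g x - f x)%:E)%E.
  rewrite -esumD; try by move=> y Ay; rewrite lee_fin; auto.
  by apply: eq_esum => y _; rewrite -EFinD addrC subrK.
have fin : (\esum_(x in A) (f x)%:E \is a fin_num)%E.
  by rewrite ge0_fin_numE// esum_ge0// => y /f0.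
move: le; rewrite e -[leRHS]adde0 leeD2lE// => le0.
have : ((g x - f x)%:E <= 0)%E.
  apply: le_trans le0; have := @sum_le_esum R _ A (fun y => (g y - f y)%:E) [:: x].
  rewrite big_seq1; apply=> // y; by rewrite inE => /eqP ->.
rewrite lee_fin subr_le0 => gf; apply/eqP; rewrite eq_le gf andbT.
by have /andP[] := fg _ Ax.
Qed.

Lemma grown_realizes (G : countType) (c : seq nat -> G -> seq G) i t :
  realizes c i t -> grown c i = t.
Proof. by move=> r; apply: realizes_uniq (xgetI _ r) r. Qed.

Lemma grownP (G : countType) (c : seq nat -> G -> seq G) i t :
  grown c i = t <-> realizes c i t \/ t = Node i [::] /\ forall t', ~ realizes c i t'.
Proof.
split=> [<-|[|[-> nr]]]; [|exact: grown_realizes|exact: xgetPN].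
rewrite /grown; case: xgetP => [t0 _ r|nr]; first by left.
by right.
Qed.

Section GrownMeasurable.
Context d (Omega : measurableType d) (G : countType).
Variable c : Omega -> seq nat -> G -> seq G.
Hypothesis mc : forall u j, discretely_measurable (fun w => c w u j).

Lemma realizes_bigcap i t : root_type t = i ->
  [set w | realizes (c w) i t] = \bigcap_(x in [set` nodes t])
    ((fun w => c w x.1 (root_type x.2)) @^-1` [set word_of x.2]).
Proof.
move=> ti; apply/seteqP; split=> w; first by move=> /realizesE[_].
by move=> H; apply/realizesE.
Qed.

Lemma measurable_realizes i t : measurable [set w | realizes (c w) i t].
Proof.
have [ti|ti] := eqVneq (root_type t) i.
  rewrite realizes_bigcap//; apply: fin_bigcap_measurable => [|x _]; last exact: mc.
  exact: finite_seq.
rewrite (_ : [set w | _] = set0); first exact: measurable0.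
by apply/seteqP; split=> // w [] /eqP; rewrite (negbTE ti).
Qed.

Lemma discretely_measurable_grown i : discretely_measurable (fun w => grown (c w) i).
Proof.
apply: discretely_measurableP => t.
(* The single-vertex tree also collects the outcomes for which no finite tree is realised, a
   countable intersection of measurable events. *)
rewrite (_ : _ @^-1` _ = [set w | realizes (c w) i t] `|`
  if t == Node i [::] then ~` \bigcup_n
    (if @unpickle (tree G) n is Some t' then [set w | realizes (c w) i t'] else set0)
  else set0).
  apply: measurableU; first exact: measurable_realizes.
  case: ifP => _; last exact: measurable0.
  apply: measurableC; apply: bigcupT_measurable => n.
  by case: unpickle => // t'; exact: measurable_realizes.
apply/seteqP; split=> w /=.
  move=> /grownP[r|[-> nr]]; [by left|right]; rewrite eqxx => -[n _].
  by case: unpickle => // t' /nr.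
move=> [r|r]; apply/grownP; [by left|right].
move: r; case: eqP => [->|//] nr; split=> // t' r; apply: nr.
by exists (pickle t') => //; rewrite pickleK.
Qed.

End GrownMeasurable.

(** * Laws of branching trees *)

Section BranchingLaws.
Context d (Omega : measurableType d) (R : realType) (P : probability Omega R).
Variables (G : countType) (sigma : G -> seq G -> R) (alpha : Omega -> G)
  (xi : seq nat -> G -> Omega -> seq G).
Hypothesis hxi : branching_family P sigma alpha xi.

Let W := weight sigma.

Lemma measurable_xi u i : discretely_measurable (xi u i).
Proof.
by move=> B; apply: (branching_measurable hxi (j := Some (u, i))); exists B.
Qed.

Lemma measurable_alpha : discretely_measurable alpha.
Proof. by move=> B; apply: (branching_measurable hxi (j := None)); exists B. Qed.

Lemma sigma_ge0 i w : 0 <= sigma i w.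
Proof. by rewrite -lee_fin -(branching_law hxi [::] i w) measure_ge0. Qed.

Lemma sigma_sum i : (\esum_(w in [set: seq G]) (sigma i w)%:E = 1)%E.
Proof.
rewrite -(probability_setT P) -(preimage_setT (xi [::] i)).
rewrite (prob_discrete _ _ (@measurable_xi [::] i)).
by apply: eq_esum => w _; rewrite (branching_law hxi).
Qed.

Definition root_law i : R := fine (P (alpha @^-1` [set i])).

Lemma root_lawE i : P (alpha @^-1` [set i]) = (root_law i)%:E.
Proof. by rewrite fineK// fin_num_measure//; exact: measurable_alpha. Qed.

Lemma root_law_ge0 i : 0 <= root_law i.
Proof. by rewrite fine_ge0. Qed.

Lemma root_law_sum : (\esum_(i in [set: G]) (root_law i)%:E = 1)%E.
Proof.
rewrite -(probability_setT P) -(preimage_setT alpha).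
rewrite (prob_discrete _ _ measurable_alpha).
by apply: eq_esum => i _; rewrite root_lawE.
Qed.

Lemma measurable_gw_tree_from i : discretely_measurable (gw_tree_from xi i).
Proof. by apply: discretely_measurable_grown => u j; exact: measurable_xi. Qed.

Lemma measurable_gw_tree_stopped k : discretely_measurable (gw_tree_stopped xi k).
Proof.
apply: discretely_measurable_grown => u j.
have [stop|stop] := boolP ((j == k) && (u != [::])).
  rewrite (_ : (fun w => _) = fun=> [::]); first exact: discretely_measurable_cst.
  by apply/funext => w; rewrite /stop_at stop.
rewrite (_ : (fun w => _) = xi u j); first exact: measurable_xi.
by apply/funext => w; rewrite /stop_at (negbTE stop).
Qed.

Lemma measurable_gw_tree : discretely_measurable (gw_tree xi alpha).
Proof.
apply: (discretely_measurable_bind (Y := fun i w => gw_tree_from xi i w)).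
  exact: measurable_alpha.
exact: measurable_gw_tree_from.
Qed.

Lemma prob_xi_nodes (l : seq (seq nat * tree G)) : uniq (unzip1 l) ->
  P (\bigcap_(x in [set` l])
      (xi x.1 (root_type x.2) @^-1` [set word_of x.2])) =
  (\prod_(x <- l) sigma (root_type x.2) (word_of x.2))%:E.
Proof.
move=> ul; rewrite (indep_prod (key := fun x => Some (x.1, root_type x.2)) (branching_indep hxi)).
- by congr EFin; apply: eq_bigr => x _; rewrite (branching_law hxi).
- apply: (map_uniq (f := fun j : option (seq nat * G) => if j is Some x then x.1 else [::])).
  by rewrite -map_comp.
- by move=> x _ /=; exists [set word_of x.2].
Qed.

Lemma prob_realizes i t : root_type t = i ->
  P [set w | realizes (fun u j => xi u j w) i t] = (W t)%:E.
Proof.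
move=> ti; rewrite (realizes_bigcap (fun w u j => xi u j w))// prob_xi_nodes.
  by rewrite /W /weight /fringes big_map.
by rewrite -vertices_nodes uniq_vertices.
Qed.

Lemma prob_realizes_root t :
  P [set w | realizes (fun u j => xi u j w) (alpha w) t] =
  (root_law (root_type t) * W t)%:E.
Proof.
pose key (x : option (seq nat * tree G)) := omap (fun x => (x.1, root_type x.2)) x.
pose ev (x : option (seq nat * tree G)) :=
  if x is Some x then xi x.1 (root_type x.2) @^-1` [set word_of x.2]
  else alpha @^-1` [set root_type t].
pose l := None :: map Some (nodes t).
rewrite (_ : [set w | _] = \bigcap_(x in [set` l]) ev x); last first.
  apply/seteqP; split=> w.
    by move=> /realizesE[rt H] [x|//]; rewrite /= inE mem_map; [exact: H|move=> ? ? []].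
  move=> H; apply/realizesE; split=> [|x xt]; first exact/esym/(H None (mem_head _ _)).
  by apply: (H (Some x)); rewrite /= inE mem_map// => ? ? [].
rewrite (indep_prod (key := key) (branching_indep hxi)).
- rewrite big_cons big_map /W /weight /fringes big_map; congr ((_ * _)%:E).
  by apply: eq_bigr => x _; rewrite /= (branching_law hxi).
- rewrite /= -map_comp; apply/andP; split; first by apply/mapP => -[].
  apply: (map_uniq (f := fun j : option (seq nat * G) => if j is Some x then x.1 else [::])).
  by rewrite -map_comp -[map _ _]/(unzip1 (nodes t)) -vertices_nodes uniq_vertices.
- by move=> [x|] _; [exists [set word_of x.2]|exists [set root_type t]].
Qed.

Lemma typed_sum_le1 i : (typed_sum sigma (fun=> 1%R) i <= 1)%E.
Proof.
apply: (@le_trans _ _ (\esum_(t in [set t | root_type t = i])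
    P (gw_tree_from xi i @^-1` [set t]))%E).
  apply: le_esum => t /= ti; rewrite mulr1 -(prob_realizes ti).
  apply: le_measure; rewrite ?inE.
  - by apply: measurable_realizes => u j; exact: measurable_xi.
  - exact: measurable_gw_tree_from.
  - by move=> w; exact: grown_realizes.
rewrite -prob_discrete; last exact: measurable_gw_tree_from.
exact/probability_le1/measurable_gw_tree_from.
Qed.

(** Almost sure finiteness makes the default value of [grown] invisible: outside a null set the tree
    equals [t] only if the growth realises [t]. *)
Lemma prob_gw_tree : {ae P, forall w, gw_finite xi alpha w} ->
  forall t, P (gw_tree xi alpha @^-1` [set t]) = (root_law (root_type t) * W t)%:E.
Proof.
move=> [N [mN PN Nsub]] t; rewrite -prob_realizes_root.
set A := _ @^-1` _; set B := [set w | _].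
have mA : measurable A by exact: measurable_gw_tree.
have mB : measurable B.
  rewrite (_ : B = (fun w => `[< realizes (fun u j => xi u j w) (alpha w) t >]) @^-1` [set true]).
    apply: (discretely_measurable_bind
      (Y := fun i w => `[< realizes (fun u j => xi u j w) i t >])) => [|i].
      exact: measurable_alpha.
    apply: discretely_measurableP => -[].
      rewrite (_ : _ @^-1` _ = [set w | realizes (fun u j => xi u j w) i t]).
        by apply: measurable_realizes => u j; exact: measurable_xi.
      by apply/seteqP; split=> w /=; [move/asboolP|move/asboolP ->].
    rewrite (_ : _ @^-1` _ = ~` [set w | realizes (fun u j => xi u j w) i t]).
      by apply/measurableC/measurable_realizes => u j; exact: measurable_xi.
    by apply/seteqP; split=> w /=; [move/asboolPn|move/asboolPn/negbTE ->].
  by apply/seteqP; split=> w /=; [move/asboolP|move/asboolP].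
have BA : B `<=` A by move=> w; exact: grown_realizes.
have AB : P (A `\` B) = 0.
  apply: (subset_measure0 (B := N)) => //; first exact: measurableD.
  move=> w [Aw nBw]; apply: Nsub => -[t' r]; apply: nBw.
  by move: Aw; rewrite /A /B /= /gw_tree (grown_realizes r) => <-.
rewrite -(setDUK BA) measureU0//; exact: measurableD.
Qed.

(* [typed_sum sigma 1 i] is the probability that the tree grown from type [i] is
   finite. *)
Lemma typed_sum_eq1_children i w j : typed_sum sigma (fun=> 1%R) i = 1%E ->
  0 < sigma i w -> j \in w -> typed_sum sigma (fun=> 1%R) j = 1%E.
Proof.
move=> qi sw jw; pose q j := fine (typed_sum sigma (fun=> 1%R) j).
have q0 l : (0 <= typed_sum sigma (fun=> 1%R) l)%E.
  by apply: esum_ge0 => t _; rewrite lee_fin mulr1 weight_ge0//; exact: sigma_ge0.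
have qfin l : typed_sum sigma (fun=> 1%R) l \is a fin_num.
  by rewrite ge0_fin_numE// (le_lt_trans (typed_sum_le1 l))// ltry.
have qE l : typed_sum sigma (fun=> 1%R) l = (q l)%:E by rewrite fineK.
have q01 l : 0 <= q l <= 1.
  by rewrite fine_ge0//= -lee_fin -qE typed_sum_le1.
have pq1 v : 0 <= \prod_(l <- v) q l <= 1.
  by rewrite prodr_ge0 ?prodr_ile1// => l _; case/andP: (q01 l).
have sumE : (\esum_(v in [set: seq G]) (sigma i v * \prod_(l <- v) q l)%:E = 1)%E.
  rewrite -qi -[RHS]/(typed_sum _ _ _).
  rewrite (_ : (fun=> 1) = fun t => \prod_(s <- children t) 1); last first.
    by apply/funext => t; rewrite big1.
  rewrite (typed_sum_children sigma_ge0)//; last by move=> l; rewrite qE ltry.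
  apply: eq_esum => v _; rewrite EFinM -prodEFin.
  by congr (_ * _)%E; apply: eq_bigr => l _; rewrite qE.
have := esum_deficit (A := setT) (f := fun v => sigma i v * \prod_(l <- v) q l)
   (g := sigma i).
rewrite sumE (sigma_sum i) => H.
have {}H : sigma i w * \prod_(l <- w) q l = sigma i w.
  apply: H => // [v _|]; last by rewrite ltry.
  by rewrite mulr_ge0 ?sigma_ge0//= ?ler_piMr ?sigma_ge0//; case/andP: (pq1 v).
have {}H : \prod_(l <- w) q l = 1.
  by apply: (mulfI (lt0r_neq0 sw)); rewrite H mulr1.
rewrite qE; congr EFin; apply/eqP; rewrite eq_le (proj2 (andP (q01 j)))/=.
rewrite -H (big_rem j)//= ler_piMr//; first by case/andP: (q01 j).
by case/andP: (pq1 (rem j w)).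
Qed.

Lemma typed_sum_eq1_fringes t s : typed_sum sigma (fun=> 1%R) (root_type t) = 1%E ->
  0 < W t -> s \in fringes t -> typed_sum sigma (fun=> 1%R) (root_type s) = 1%E.
Proof.
elim/tree_ind_mem: t => i ts IH /= qi; rewrite /W weightE => Wt.
have s0 : 0 < sigma i (map (@root_type G) ts).
  rewrite lt0r sigma_ge0 andbT; apply: contraTneq Wt => ->.
  by rewrite mul0r ltxx.
have W0 t : 0 <= weight sigma t by apply: weight_ge0; exact: sigma_ge0.
rewrite fringesE inE => /predU1P[->//|/flatten_mapP[t tts st]].
apply: IH (tts) _ _ st; first exact: typed_sum_eq1_children qi s0 (map_f _ tts).
rewrite lt0r W0 andbT; apply: contraTneq Wt => W0t.
by rewrite (big_rem t)//= -/(W t) W0t mul0r mulr0 ltxx.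
Qed.

Variable k : G.
Hypothesis hfin : {ae P, forall w, gw_finite xi alpha w}.
Hypothesis hreach : (0 < P [set w | ntype k (gw_tree xi alpha w) != 0%N])%E.

(** Transfers finiteness from the random root to the type [k]. The average of the finiteness
    probabilities over the root type is 1, so each root type of positive probability has value 1;
    the value 1 is then inherited along a tree of positive weight that contains a vertex of type
    [k]. *)
Lemma typed_sum_reachable : typed_sum sigma (fun=> 1%R) k = 1%E.
Proof.
have W0 t : 0 <= W t by apply: weight_ge0; exact: sigma_ge0.
have [t [kt at0 Wt0]] : exists t, [/\ ntype k t != 0%N,
    0 < root_law (root_type t) & 0 < W t].
  apply: contrapT => nt; move: hreach.
  rewrite (_ : [set w | _] = gw_tree xi alpha @^-1` [set t | ntype k t != 0%N])//.
  rewrite prob_discrete ?esum1 ?ltxx//; last exact: measurable_gw_tree.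
  move=> t /= kt; rewrite (prob_gw_tree hfin); apply/eqP; rewrite eqe mulf_eq0.
  apply/contraT; rewrite negb_or => /andP[a0 w0]; case: nt; exists t.
  by rewrite !lt0r a0 w0 root_law_ge0 W0.
have [s st sk] : exists2 s, s \in fringes t & root_type s = k.
  move: kt; rewrite ntype_fringes -lt0n -has_count => /hasP[s st /eqP sk].
  by exists s.
rewrite -sk; apply: typed_sum_eq1_fringes Wt0 st.
pose q j := fine (typed_sum sigma (fun=> 1%R) j).
have q0 l : (0 <= typed_sum sigma (fun=> 1%R) l)%E.
  by apply: esum_ge0 => t' _; rewrite lee_fin mulr1 W0.
have qE l : typed_sum sigma (fun=> 1%R) l = (q l)%:E.
  by rewrite fineK// ge0_fin_numE// (le_lt_trans (typed_sum_le1 l))// ltry.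
have sumE : (\esum_(i in [set: G]) (root_law i * q i)%:E = 1)%E.
  rewrite -(probability_setT P) -(preimage_setT (gw_tree xi alpha)).
  rewrite prob_discrete; last exact: measurable_gw_tree.
  rewrite (esum_fibers (@root_type G))//.
  apply: eq_esum => i _; rewrite EFinM -qE /typed_sum -esum_mull ?root_law_ge0//; last first.
    by move=> t'; rewrite lee_fin mulr1.
  by apply: eq_esum => t' /= <-; rewrite (prob_gw_tree hfin) mulr1 -EFinM.
have := esum_deficit (A := setT) (f := fun i => root_law i * q i) (g := root_law).
rewrite sumE root_law_sum => H.
have {}H : root_law (root_type t) * q (root_type t) = root_law (root_type t).
  apply: H => // [i _|]; last by rewrite ltry.
  rewrite mulr_ge0 ?root_law_ge0//= ?fine_ge0// ler_piMr ?root_law_ge0//.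
  by rewrite -lee_fin -qE typed_sum_le1.
rewrite qE; congr EFin.
by apply: (mulfI (lt0r_neq0 at0)); rewrite H mulr1.
Qed.

Lemma gw_tree_from_root i w : root_type (gw_tree_from xi i w) = i.
Proof.
have /grownP[[]//|[-> _]//] := erefl (gw_tree_from xi i w).
Qed.

(** The default value could only add mass to [W t]; since the weights for root type [k] sum to 1, it
    adds none. *)
Lemma prob_gw_tree_from t : root_type t = k ->
  P (gw_tree_from xi k @^-1` [set t]) = (W t)%:E.
Proof.
move=> tk; have W0 t' : 0 <= W t' by apply: weight_ge0; exact: sigma_ge0.
pose g t' := fine (P (gw_tree_from xi k @^-1` [set t'])).
have gE t' : P (gw_tree_from xi k @^-1` [set t']) = (g t')%:E.
  by rewrite fineK// fin_num_measure//; exact: measurable_gw_tree_from.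
have WE : (\esum_(t' in [set t' : tree G | root_type t' = k]) (W t')%:E = 1)%E.
  rewrite -typed_sum_reachable; apply: eq_esum => t' _; by rewrite mulr1.
rewrite gE; congr EFin; apply/esym.
apply: (esum_deficit (A := [set t' : tree G | root_type t' = k]) (f := W)) => //.
- move=> t' /= tk'; rewrite W0/= -lee_fin -gE -(prob_realizes tk').
  apply: le_measure; rewrite ?inE.
  + by apply: measurable_realizes => u j; exact: measurable_xi.
  + exact: measurable_gw_tree_from.
  + by move=> w; exact: grown_realizes.
- rewrite WE; under eq_esum do rewrite -gE.
  rewrite -prob_discrete; last exact: measurable_gw_tree_from.
  exact/probability_le1/measurable_gw_tree_from.
- by rewrite WE ltry.
Qed.

Lemma gw_tree_stopped_block w (b := gw_tree_stopped xi k w) :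
  root_type b = k /\ prune_root k b = b.
Proof.
have /grownP[/realizes_stop[]//|[-> _]//] := erefl b.
Qed.

(** Excluding [Node k [::]] excludes the default value of [grown]. A block with a non-root mark is
    never this tree. *)
Lemma prob_gw_tree_stopped b : root_type b = k -> prune_root k b = b ->
  b <> Node k [::] ->
  P (gw_tree_stopped xi k @^-1` [set b]) = (block_weight sigma k b)%:E.
Proof.
move=> bk bE b0; rewrite /block_weight -prob_xi_nodes ?uniq_block_nodes//.
congr (P _); apply/seteqP; split=> w /=.
  by move=> /grownP[/realizes_stop[_ _ H]|[/b0//]] x /= xb; exact: H.
by move=> H; apply: grown_realizes; apply/realizes_stop.
Qed.

End BranchingLaws.

(** * Prefixes of the spine consisting of whole blocks *)

Section SpineLevel.
Variables (G : countType) (k : G).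

(** Such a prefix is empty for [h = 0] and otherwise stops at the [h]-th frame of type [k], so the
    decomposition of the spine into blocks is unambiguous. *)
Lemma spine_level_prefix h (a a' b b' : seq (frame G)) :
  spine_level k h a -> spine_level k h a' -> a ++ b = a' ++ b' -> a = a'.
Proof.
move=> la la' e; have t0 : root_type (Node k [::]) = k by [].
have /(typed_fringeP _ t0 la) := up_FinM_cat (Node k [::]) a b.
rewrite e => E; have /(typed_fringeP _ t0 la') := up_FinM_cat (Node k [::]) a' b'.
by rewrite E => -[].
Qed.

Lemma spine_level0 (a : seq (frame G)) : spine_level k 0 a -> a = [::].
Proof.
case/lastP: a => [//|a f] /andP[]; rewrite map_rcons last_rcons => + fk.
by rewrite -cats1 count_cat /= fk addn_eq0 andbF.
Qed.

Lemma root_type_plug h t (a : seq (frame G)) : root_type t = k ->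
  spine_level k h a -> root_type (plug t a) = k.
Proof.
move=> tk; case/lastP: a => [//|a f] /andP[_].
by rewrite map_rcons last_rcons plug_rcons => /eqP.
Qed.

Variables (B : nat -> seq (frame G)).
Hypothesis blockB : forall i, is_block k (B i).

Definition prefix_frames n : seq (frame G) := flatten [seq B i | i <- iota 0 n].

Lemma prefix_framesS n : prefix_frames n.+1 = prefix_frames n ++ B n.
Proof. by rewrite /prefix_frames -addn1 iotaD map_cat flatten_cat /= cats0. Qed.

Lemma spine_level_prefix_frames n : spine_level k n (prefix_frames n).
Proof.
elim: n => [|n IH]; first by rewrite /spine_level /= eqxx.
rewrite prefix_framesS; have [c [f [-> ck fk]]] := blockB n.
exact: spine_level_cat.
Qed.

Lemma size_prefix_frames n : (n <= size (prefix_frames n))%N.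
Proof.
elim: n => [//|n IH]; rewrite prefix_framesS size_cat.
have [c [f [-> _ _]]] := blockB n.
by rewrite size_rcons addnS ltnS (leq_trans IH)// leq_addr.
Qed.

Lemma prefix_frames_prefix m n : (m <= n)%N -> prefix (prefix_frames m) (prefix_frames n).
Proof.
elim: n => [|n IH]; first by rewrite leqn0 => /eqP ->; exact: prefix_refl.
rewrite leq_eqVlt => /predU1P[->|]; first exact: prefix_refl.
rewrite ltnS => /IH mn; apply: prefix_trans mn _.
by rewrite prefix_framesS prefix_prefix.
Qed.

Lemma nth_prefix_frames x0 m n j : (j < size (prefix_frames m))%N ->
  (j < size (prefix_frames n))%N ->
  nth x0 (prefix_frames m) j = nth x0 (prefix_frames n) j.
Proof.
wlog mn : m n / (m <= n)%N.
  by case: (leqP m n) => [|/ltnW] mn H jm jn; [|apply/esym]; exact: H mn _ _.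
have /prefixP[s ->] := prefix_frames_prefix mn.
by move=> jm _; rewrite nth_cat jm.
Qed.

(** Frame [j] may be read off any sufficiently long prefix. The first [j.+1] blocks are long enough
    because each block has at least one frame. *)
Lemma up_prefix_frames t x0 n :
  up (size (prefix_frames n)) (InfM t (fun j => nth x0 (prefix_frames j.+1) j)) =
  Some (FinM t (prefix_frames n)).
Proof.
rewrite /=; congr (Some (FinM _ _)); apply: (@eq_from_nth _ x0).
  by rewrite size_mkseq.
move=> j; rewrite size_mkseq => jn; rewrite nth_mkseq//.
by apply: nth_prefix_frames => //; exact: size_prefix_frames.
Qed.

End SpineLevel.

Section AlmostEverywhere.
Context d (Omega : measurableType d) (R : realType) (P : probability Omega R).

Lemma ae_countable (V : countType) (Q : V -> Omega -> Prop) :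
  (forall v, {ae P, forall w, Q v w}) -> {ae P, forall w, forall v, Q v w}.
Proof.
move=> aeQ.
have : P.-negligible (\bigcup_n (if @unpickle V n is Some v then ~` [set w | Q v w] else set0)).
  apply: negligible_bigcup => n; case: unpickle => [v|]; first exact: aeQ.
  exact: negligible_set0.
apply: negligibleS => w /existsNP[v nQ]; exists (pickle v) => //.
by rewrite pickleK.
Qed.

Lemma ae_discrete (V : Type) (X : Omega -> V) (B : set V) :
  discretely_measurable X -> P (X @^-1` B) = 1%E -> {ae P, forall w, B (X w)}.
Proof.
move=> mX PB; exists (~` (X @^-1` B)); split => //; first exact/measurableC/mX.
by rewrite probability_setC ?PB ?subee//; exact: mX.
Qed.

Lemma prob_ae_eq (A B : set Omega) : measurable A -> measurable B ->
  {ae P, forall w, A w <-> B w} -> P A = P B.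
Proof.
move=> mA mB [N [mN PN sub]].
have le (C D : set Omega) : measurable C -> measurable D ->
    (forall w, ~ N w -> C w -> D w) -> (P C <= P D)%E.
  move=> mC mD CD; rewrite -(measureU0 mD mN PN).
  apply: le_measure; rewrite ?inE//; first exact: measurableU.
  by move=> w Cw; have [Nw|Nw] := pselect (N w); [right|left; exact: CD].
apply/eqP; rewrite eq_le !le// => w Nw; have [e1 e2] : A w <-> B w by
  apply: contrapT => nAB; apply/Nw/sub.
- by [].
- by [].
Qed.

End AlmostEverywhere.

(** * The law of the limit tree *)

Section LimitLaw.
Context d (Omega : measurableType d) (R : realType) (P : probability Omega R).
Context d' (Omega' : measurableType d') (P' : probability Omega' R).
Variables (G : countType) (k : G) (sigma : G -> seq G -> R) (alpha : Omega -> G)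
  (xi : seq nat -> G -> Omega -> seq G).
Hypothesis hxi : branching_family P sigma alpha xi.
Hypothesis hreach : (0 < P [set w | ntype k (gw_tree xi alpha w) != 0%N])%E.
Hypothesis hfin : {ae P, forall w, gw_finite xi alpha w}.
Variables (T0 : Omega' -> tree G) (H : nat -> Omega' -> tree G * seq nat)
  (Tk : nat -> seq nat -> Omega' -> tree G).
Hypothesis hspine : spine_family P P' k xi T0 H Tk.
Hypothesis hcrit : (\int[P]_w ((ntype k (gw_tree_stopped xi k w))%:R)%:E
              = 2%:E :> \bar R)%E.

Let W := weight sigma.

Lemma measurable_T0 : discretely_measurable T0.
Proof. by move=> B; apply: (spine_measurable hspine (j := None)); exists B. Qed.

Lemma measurable_H i : discretely_measurable (H i).
Proof. by move=> B; apply: (spine_measurable hspine (j := Some (inl i))); exists B. Qed.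

Lemma measurable_Tk i u : discretely_measurable (Tk i u).
Proof. by move=> B; apply: (spine_measurable hspine (j := Some (inr (i, u)))); exists B. Qed.

Definition valid_block (x : tree G * seq nat) : Prop :=
  [/\ prune_root k x.1 = x.1, root_type x.1 = k, x.2 != [::] & type_at x.1 x.2 = Some k].

Definition valid_spine (w : Omega') : Prop :=
  [/\ root_type (T0 w) = k, forall i, valid_block (H i w) &
      forall iu : nat * seq nat, root_type (Tk iu.1 iu.2 w) = k].

Let block (b : tree G) : Prop := prune_root k b = b /\ root_type b = k.

Lemma esum_block (f : tree G -> \bar R) : (forall b, (0 <= f b)%E) ->
  (\esum_(b in [set: tree G]) (f b * P (gw_tree_stopped xi k @^-1` [set b])) =
   \esum_(b in block) (f b * P (gw_tree_stopped xi k @^-1` [set b])))%E.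
Proof.
move=> f0; rewrite [RHS]esum_mkcond; apply: eq_esum => b _.
case: ifPn => // /negP nb; rewrite (_ : _ @^-1` _ = set0) ?measure0 ?mule0//.
apply/seteqP; split=> // w /= wb; apply: nb; rewrite inE -wb.
by have [? ?] := gw_tree_stopped_block xi k w; split.
Qed.

(** The law of [H i] is prescribed only at admissible pairs of block and mark. The total mass there
    is the expected number of admissible marks, which criticality makes 1, so nothing is left for
    other values. *)
Lemma prob_valid_block i : P' (H i @^-1` valid_block) = 1%E.
Proof.
pose p b := P (gw_tree_stopped xi k @^-1` [set b]).
have mS := measurable_gw_tree_stopped hxi k.
have p0 b : (0 <= p b)%E by exact: measure_ge0.
have pfin b : p b \is a fin_num by rewrite fin_num_measure//; exact: mS.
have sum_p : (\esum_(b in block) p b = 1)%E.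
  rewrite -(probability_setT P) -(preimage_setT (gw_tree_stopped xi k)).
  rewrite prob_discrete//; have := @esum_block (fun=> 1%E) (fun=> lee01).
  under eq_esum do rewrite mul1e.
  by under [in RHS]eq_esum do rewrite mul1e.
have sum_n : (\esum_(b in block) ((ntype k b)%:R%:E * p b) = 2%:E)%E.
  rewrite -hcrit (integral_discrete (f := fun b => (ntype k b)%:R) P mS)//.
  by rewrite esum_block// => b; rewrite lee_fin.
(* Removing the root from the count turns the 2 of criticality into 1. *)
have sum_s : (\esum_(b in block) ((size (stopped_vertices k b))%:R%:E * p b) = 1)%E.
  have : (\esum_(b in block) ((size (stopped_vertices k b))%:R%:E * p b) + 1 = 2%:E)%E.
    rewrite -{1}sum_p -esumD//; last by move=> b _; rewrite mule_ge0// lee_fin.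
    rewrite -sum_n; apply: eq_esum => b [_ bk].
    by rewrite (size_stopped_vertices bk) -natr1 EFinD ge0_muleDl ?mul1e ?lee_fin.
  by case: (esum _ _) => [r [r2]||]//; congr EFin; lra.
rewrite prob_discrete; last exact: measurable_H.
rewrite -sum_s.
transitivity (\esum_(b in block) \esum_(m in [set` stopped_vertices k b]) p b)%E.
  rewrite esum_esum//.
  rewrite [X in esum X _](_ : _ = block `*`` fun b => [set` stopped_vertices k b]); last first.
    apply/seteqP; split=> -[b m] /=.
      by move=> [bE bk m0 mk]; split=> //=; rewrite mem_stopped_vertices m0 mk eqxx.
    by move=> [[bE bk]]; rewrite mem_stopped_vertices => /andP[m0 /eqP mk]; split.
  apply: eq_esum => -[b m] [/= [bE bk]].
  rewrite mem_stopped_vertices => /andP[m0 /eqP mk].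
  exact: (spine_lawH hspine).
apply: eq_esum => b _; rewrite esum_fset//; last exact: finite_seq.
rewrite -fsbig_seq ?uniq_stopped_vertices//= big_const_seq count_predT.
have iterE n : iter n (fun y => p b + y)%E 0%E = (n%:R%:E * p b)%E.
  elim: n => [|n IH]; first by rewrite mul0e.
  by rewrite iterS IH -natr1 EFinD ge0_muleDl ?mul1e ?lee_fin// addeC.
exact: iterE.
Qed.

Lemma ae_valid_spine : {ae P', forall w, valid_spine w}.
Proof.
have lawT (X : Omega' -> tree G) : discretely_measurable X ->
    (forall t, P' (X @^-1` [set t]) = P (gw_tree_from xi k @^-1` [set t])) ->
    {ae P', forall w, root_type (X w) = k}.
  move=> mX lawX; apply: (ae_discrete (B := [set t | root_type t = k])) => //.
  rewrite prob_discrete//; under eq_esum do rewrite lawX.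
  rewrite -prob_discrete; last exact: (measurable_gw_tree_from hxi).
  rewrite (_ : _ @^-1` _ = setT) ?probability_setT//.
  by apply/seteqP; split=> // w _; exact: gw_tree_from_root.
have aT := lawT _ measurable_T0 (spine_lawT0 hspine).
have aH : {ae P', forall w, forall i, valid_block (H i w)}.
  apply: ae_countable => i.
  by apply: ae_discrete (prob_valid_block i); exact: measurable_H.
have aTk : {ae P', forall w, forall iu : nat * seq nat, root_type (Tk iu.1 iu.2 w) = k}.
  apply: ae_countable => -[i u] /=; apply: lawT; first exact: measurable_Tk.
  exact: (spine_lawT hspine).
by apply: filterS3 aT aH aTk => w a b c; split.
Qed.

Let B w i := block_frames k H Tk w i.

Lemma is_block_block_frames w i : valid_spine w -> is_block k (B w i).
Proof.
move=> [T0k vH vTk]; rewrite /B /block_frames.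
case: (H i w) (vH i) => b m [/= bE bk m0 mk].
have sk u : root_type (Tk i u w) = k by exact: (vTk (i, u)).
by have [] := graft_block sk m0 bE bk mk T0k.
Qed.

Lemma typed_fringe_limit_tree w n : valid_spine w ->
  typed_fringe k n (limit_tree k T0 H Tk w) = (FinM (T0 w) (prefix_frames (B w) n), false).
Proof.
move=> vw; have vB i := is_block_block_frames i vw.
apply/(typed_fringeP (h := n) _ (k := k)); first by case: vw.
  exact: spine_level_prefix_frames.
exact: up_prefix_frames.
Qed.

(** Keeps the indices used by the first [h] blocks apart from those of block [h], so that the
    extended list of events has distinct keys. *)
Let key_lt (h : nat) (j : option (nat + nat * seq nat)) : bool :=
  match j with
  | None => true
  | Some (inl i) => (i < h)%N
  | Some (inr (i, u)) => (i < h)%N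
  end.

(* By induction on [h]: the block at the [h]-th ancestor of type [k] and the trees
   grafted on it are read off the fringe subtree there, whose weight splits
   accordingly by [weight_prune_root]. *)
Lemma spine_events_cell h (t : tree G) a : root_type t = k -> spine_level k h a ->
  exists L : seq (option (nat + nat * seq nat) * set Omega'),
  [/\ uniq (unzip1 L), (forall x, x \in L -> spine_events T0 H Tk x.1 x.2 /\ key_lt h x.1),
    (forall w, valid_spine w ->
       (T0 w = t /\ prefix_frames (B w) h = a) <-> forall x, x \in L -> x.2 w) &
    \prod_(x <- L) fine (P' x.2) = W (plug t a)].
Proof.
move=> tk; elim: h a => [|h IH] a.
  move=> /spine_level0 ->; exists [:: (None, T0 @^-1` [set t])]; split=> //.
  - by move=> x; rewrite inE => /eqP -> /=; split=> //; exists [set t].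
  - move=> w _; split=> [[wt _] x|/(_ _ (mem_head _ _))]; last by [].
    by rewrite inE => /eqP ->.
  - by rewrite big_seq1 /= (spine_lawT0 hspine) (prob_gw_tree_from hxi hfin hreach tk).
move=> /spine_level_split[a' [c [f [-> la' ck fk]]]].
have [L [uL eL LP LW]] := IH _ la'; set t' := plug t a' in LW.
have t'k : root_type t' = k by exact: root_type_plug tk la'.
set fr := rcons c f; set u := plug t' fr; set m := addr fr.
have bfr : is_block k fr by exists c, f.
have mt' : (m, t') \in cut_root k u by exact: plug_cut_root.
have uk : root_type u = k by rewrite /u /fr plug_rcons.
(* The cut tree at the mark is the part [t'] built from the lower blocks; only the others are
   prescribed by [Tk]. *)
pose C := [seq x <- cut_root k u | x.1 != m].
have [m0 _ bm] := cut_rootP mt'.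
pose evH := (Some (inl h) : option (nat + nat * seq nat), H h @^-1` [set (prune_root k u, m)]).
pose evT (x : seq nat * tree G) :=
  (Some (inr (h, x.1)) : option (nat + nat * seq nat), Tk h x.1 @^-1` [set x.2]).
exists (L ++ evH :: map evT C); split.
- rewrite /unzip1 map_cat cat_uniq uL /=; apply/andP; split.
    rewrite negb_or; apply/andP; split.
      by apply/negP => /mapP[x /eL[_ +] E]; rewrite -E /= ltnn.
    apply/hasPn => _ /mapP[_ /mapP[x _ ->] ->] /=.
    by apply/negP => /mapP[y /eL[_ +] E]; rewrite -E /= ltnn.
  rewrite -map_comp; apply/andP; split; first by apply/mapP => -[].
  rewrite (map_comp (fun v => Some (inr (h, v))) fst) map_inj_uniq; last by move=> ? ? [].
  apply: subseq_uniq (uniq_cut_root k u); exact/map_subseq/filter_subseq.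
- move=> x; rewrite mem_cat inE => /or3P[/eL[e xh]|/eqP ->|/mapP[y _ ->]].
  + by split=> //; case: x.1 xh => [[i|[i v]]|] //=; exact: ltnW.
  + by split=> //=; exists [set (prune_root k u, m)].
  + by split=> //=; exists [set y.2].
- move=> w vw; have vB i := is_block_block_frames i vw.
  have [T0k vH vTk] := vw; have LPw := LP w vw.
  have sk v : root_type (Tk h v w) = k by exact: (vTk (h, v)).
  have Bh : B w h = fr <-> [/\ H h w = (prune_root k u, m) &
      forall x, x \in C -> Tk h x.1 w = x.2].
    rewrite /B /block_frames; case: (H h w) (vH h) => b m' [/= bE bk m'0 m'k].
    rewrite (graft_blockP sk m'0 bE bk m'k t'k bfr) -/u -/m; split.
      move=> [-> -> HT]; split=> // -[v y]; rewrite mem_filter => /andP[vm vy].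
      exact: HT.
    move=> [[-> ->] HT]; split=> // v y vy vm.
    by apply: (HT (v, y)); rewrite mem_filter vm.
  rewrite prefix_framesS; split=> [[wt pE] x|HL].
    have pa : prefix_frames (B w) h = a'.
      exact: spine_level_prefix (spine_level_prefix_frames vB h) la' pE.
    have /Bh[Hw HT] : B w h = fr.
      by move: pE; rewrite pa => /eqP; rewrite eqseq_cat// eqxx => /eqP.
    rewrite mem_cat inE => /or3P[xL|/eqP ->|/mapP[y yC ->]] //=.
      exact: (proj1 LPw (conj wt pa)).
    exact: HT.
  have [x xL|wt pa] := proj2 LPw; first by apply: HL; rewrite mem_cat xL.
  split=> //; rewrite pa; congr (_ ++ _); apply/Bh; split.
    by apply: (HL evH); rewrite mem_cat mem_head orbT.
  by move=> x xC; apply: (HL (evT x)); rewrite mem_cat inE map_f ?orbT.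
- rewrite big_cat big_cons big_map LW /= (spine_lawH hspine) ?/type_at ?bm//.
  rewrite (prob_gw_tree_stopped hxi) ?prune_root_idem ?root_type_prune_root//; last first.
    by move=> uE; move: bm; rewrite uE; case: (m) m0 => [//|j m1] _ /=; rewrite onth0n.
  rewrite plug_cat -/t' -/u /W (weight_prune_root _ k u) mulrCA; congr (_ * _).
  (* The factor at the mark is the weight supplied by the induction hypothesis. *)
  rewrite (bigD1_seq _ mt') /=; last exact: map_uniq (uniq_cut_root k u).
  congr (_ * _); rewrite /C big_filter big_seq_cond [RHS]big_seq_cond.
  apply: eq_big => [[v y]|[v y] /andP[vy _]].
    apply: andb_id2l => vy; rewrite xpair_eqE negb_and /=.
    case: eqVneq => //= vm; rewrite vm in vy; apply/esym/negbTE; rewrite negbK.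
    by apply/eqP; exact: uniq_unzip1 (uniq_cut_root k u) vy mt'.
  have [_ yk _] := cut_rootP vy.
  by rewrite (spine_lawT hspine) (prob_gw_tree_from hxi hfin hreach yk).
Qed.

Lemma measurable_block_frames i : discretely_measurable (fun w => B w i).
Proof.
rewrite /B /block_frames.
apply: (discretely_measurable_bind (X := H i) (Y := fun x w =>
  let: (t, m) := x in (focus (graft k m (fun u => Tk i u w) [::] t) m [::]).2)).
  exact: measurable_H.
move=> [t m]; apply: (discretely_measurable_comp (fun b => (focus b m [::]).2)).
move: [::]; elim/tree_ind_mem: t => j ts IH u.
have [gr|gr] := boolP [&& j == k, u != [::] & u != m].
  rewrite (_ : (fun w => _) = Tk i u); first exact: measurable_Tk.
  by apply/funext => w /=; rewrite gr.
rewrite (_ : (fun w => _) = Node j \o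
    fun w => imap (fun l t => graft k m (fun u => Tk i u w) (rcons u l) t) 0 ts); last first.
  by apply/funext => w /=; rewrite (negbTE gr).
apply: discretely_measurable_comp.
apply: (discretely_measurable_imap (F := fun l t w => graft k m (fun u => Tk i u w) (rcons u l) t)).
by move=> l t tts; exact: IH.
Qed.

Lemma measurable_up_limit_tree n :
  discretely_measurable (fun w => up n (limit_tree k T0 H Tk w)).
Proof.
pose X w := (T0 w, mkseq (fun j => nth (k, [::], [::]) (prefix_frames (B w) j.+1) j) n).
apply: (discretely_measurable_comp (fun x : tree G * seq (frame G) => Some (FinM x.1 x.2))
  (X := X)).
apply: discretely_measurable_pair; first exact: measurable_T0.
apply: (discretely_measurable_map (F := fun j w =>
  nth (k, [::], [::]) (prefix_frames (B w) j.+1) j)) => j _.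
apply: (discretely_measurable_comp (fun l => nth (k, [::], [::]) (flatten l) j)).
apply: (discretely_measurable_map (F := fun i w => B w i)) => i _.
exact: measurable_block_frames.
Qed.

Lemma measurable_cell h t a : root_type t = k -> spine_level k h a ->
  measurable [set w | typed_fringe k h (limit_tree k T0 H Tk w) = (FinM t a, false)].
Proof.
move=> tk la; rewrite (_ : [set w | _] =
  (fun w => up (size a) (limit_tree k T0 H Tk w)) @^-1` [set Some (FinM t a)]).
  exact: measurable_up_limit_tree.
by apply/seteqP; split=> w /(typed_fringeP _ tk la).
Qed.

Lemma prob_cell h t a : root_type t = k -> spine_level k h a ->
  P' [set w | typed_fringe k h (limit_tree k T0 H Tk w) = (FinM t a, false)] =
  (W (plug t a))%:E.
Proof.
move=> tk la; have [L [uL eL LP <-]] := spine_events_cell tk la.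
rewrite -(indep_prod (key := fst) (ev := snd) (spine_indep hspine) uL); last first.
  by move=> x /eL[].
apply: prob_ae_eq; first exact: measurable_cell.
  apply: fin_bigcap_measurable => [|x /= xL]; first exact: finite_seq.
  exact: (spine_measurable hspine (proj1 (eL x xL))).
apply: filterS ae_valid_spine => w vw; rewrite /= typed_fringe_limit_tree//; split.
  by move=> [wt pa]; apply/LP.
by move=> /LP[]// -> ->.
Qed.

End LimitLaw.

(** * Events of high conditional probability *)

Section HighProbability.
Context d (Omega : measurableType d) (R : realType) (P : probability Omega R).
Variable E : nat -> set Omega.
Hypothesis mE : forall n, measurable (E n).
Hypothesis hE : forall n, (0 < P (E n))%E.

Definition whp (A : nat -> set Omega) : Prop :=
  (fun n => cond_prob P (E n) (A n)) @ \oo --> (1 : R).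

Let p n : R := fine (P (E n)).

Let p_gt0 n : 0 < p n.
Proof. by rewrite /p fine_gt0// hE/= ltey_eq fin_num_measure. Qed.

Lemma cond_prob_le1 n A : measurable A -> cond_prob P (E n) A <= 1.
Proof.
move=> mA; rewrite /cond_prob ler_pdivrMr ?p_gt0// mul1r.
rewrite fine_le ?fin_num_measure//; try exact: measurableI.
by apply: le_measure; rewrite ?inE//; exact: measurableI.
Qed.

(** The exceptional event is measured without conditioning, and conditioning costs the division by
    [p n]. This is the only way in which the size of [P (E n)] enters. *)
Lemma whp_exception (A C D : nat -> set Omega) :
  (forall n, measurable (A n)) -> (forall n, measurable (C n)) ->
  (forall n, measurable (D n)) ->
  (\forall n \near \oo, C n `<=` A n `|` D n) -> whp C ->
  (fun n => fine (P (D n)) / p n) @ \oo --> (0 : R) -> whp A.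
Proof.
move=> mA mC mD CAD wC D0.
have lim : (fun n => cond_prob P (E n) (C n) - fine (P (D n)) / p n) @ \oo --> (1 : R).
  by rewrite -[1](subr0 1); exact: cvgB wC D0.
rewrite /whp; apply: (squeeze_cvgr _ lim (@cvg_cst _ _ _ _ _)).
near=> n; have CADn : C n `<=` A n `|` D n by near: n.
rewrite cond_prob_le1// andbT lerBlDr /cond_prob -mulrDl ler_pM2r ?invr_gt0//.
have mI A' : measurable A' -> measurable (A' `&` E n) by move=> ?; exact: measurableI.
have fI A' : measurable A' -> P A' \is a fin_num by move=> ?; exact: fin_num_measure.
rewrite -fineD ?fI//; try exact: mI.
rewrite fine_le ?fin_numD ?fI//; try exact: mI.
apply: le_trans (measureU2 P (mI _ (mA n)) (mD n)).
apply: le_measure; rewrite ?inE; [exact: mI|by apply: measurableU => //; exact: mI|].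
by move=> w [/CADn[Aw|Dw] Ew]; [left|right].
exact: p_gt0.
Unshelve. all: end_near. Qed.

Lemma whpS (A C : nat -> set Omega) :
  (forall n, measurable (A n)) -> (forall n, measurable (C n)) ->
  (\forall n \near \oo, C n `<=` A n) -> whp C -> whp A.
Proof.
move=> mA mC CA wC; apply: (whp_exception (C := C) (D := fun=> set0)) => //.
  by apply: filterS CA => n CA w /CA; left.
by rewrite (_ : (fun n => _) = fun=> 0); [exact: cvg_cst|apply/funext => n; rewrite measure0 mul0r].
Qed.

Lemma whpT : whp (fun=> setT).
Proof.
rewrite /whp (_ : (fun n => _) = fun=> 1); first exact: cvg_cst.
by apply/funext => n; rewrite /cond_prob setTI divff// gt_eqF// p_gt0.
Qed.

Lemma whpI (A B : nat -> set Omega) :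
  (forall n, measurable (A n)) -> (forall n, measurable (B n)) ->
  whp A -> whp B -> whp (fun n => A n `&` B n).
Proof.
move=> mA mB wA wB.
(* Restricting to [E n] allows the exceptional event [E n] minus [B n], whose relative mass is one
   minus the conditional probability of [B n]. *)
have wEA : whp (fun n => E n `&` A n).
  rewrite /whp (_ : (fun n => _) = fun n => cond_prob P (E n) (A n))//.
  by apply/funext => n; rewrite /cond_prob setIAC setIid setIC.
apply: (whp_exception (D := fun n => E n `\` B n)) wEA _.
- by move=> n; exact: measurableI.
- by move=> n; exact: measurableI.
- by move=> n; exact: measurableD.
- apply: nearW => n w [Ew Aw].
  by have [Bw|nBw] := pselect (B n w); [left|right].
rewrite (_ : (fun n => _) = fun n => 1 - cond_prob P (E n) (B n)).
  by rewrite -[0](subrr 1); apply: cvgB wB; exact: cvg_cst.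
apply/funext => n; rewrite /cond_prob -/(p n) -(divff (lt0r_neq0 (p_gt0 n))) -mulrBl.
congr (_ / _); rewrite setIC measureD// ?ltey_eq ?fin_num_measure//.
by rewrite fineB// fin_num_measure//; exact: measurableI.
Qed.

End HighProbability.

(** * Density of fringe subtrees in the conditioned tree *)

Section FringeDensity.
Context d (Omega : measurableType d) (R : realType) (P : probability Omega R).
Variables (G : countType) (k : G) (sigma : G -> seq G -> R) (alpha : Omega -> G)
  (xi : seq nat -> G -> Omega -> seq G).
Hypothesis hxi : branching_family P sigma alpha xi.
Hypothesis hfin : {ae P, forall w, gw_finite xi alpha w}.
Variable E : nat -> set Omega.
Hypothesis mE : forall n, measurable (E n).
Hypothesis hE : forall n, (0 < P (E n))%E.
Variable s : nat -> R.
Hypothesis hs : s n @[n --> \oo] --> +oo.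
Hypothesis hexp : forall eps : R, 0 < eps ->
    (fun n => expR (- (eps * s n))) =o_\oo (fun n => fine (P (E n))).
Hypothesis hlarge : cond_prob P (E n)
      [set w | s n <= (ntype k (gw_tree xi alpha w))%:R] @[n --> \oo]
    --> (1 : R).

Let W := weight sigma.
Let tau := gw_tree xi alpha.
Let mtau : discretely_measurable tau := measurable_gw_tree hxi.

Lemma measurable_tau (B : set (tree G)) : measurable [set w | B (tau w)].
Proof. exact: mtau. Qed.

Lemma prob_deviating T eps r : root_type T = k -> 0 < eps -> eps <= 1 ->
  (P [set w | deviating sigma k T eps r (tau w)] <=
    (2 * expR (- (eps ^+ 2 / 8 * r)))%:E)%E.
Proof.
move=> Tk e0 e1; set D := deviating sigma k T eps r.
have W0 t : 0 <= W t by apply: weight_ge0; exact: (sigma_ge0 hxi).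
rewrite -[X in P X]/(tau @^-1` D) (prob_discrete _ _ mtau) esum_mkcond.
rewrite (esum_fibers (@root_type G)); last first.
  by move=> t; case: ifP.
apply: (@le_trans _ _ (\esum_(i in [set: G]) ((2 * expR (- (eps ^+ 2 / 8 * r)))%:E *
    (root_law P alpha i)%:E))%E).
  apply: le_esum => i _.
  have := weight_deviation (sigma_ge0 hxi) (sigma_sum hxi) (typed_sum_le1 hxi) Tk i r e0 e1.
  move=> /(lee_wpmul2l (_ : (0 <= (root_law P alpha i)%:E)%E)).
  rewrite lee_fin root_law_ge0 => /(_ isT); rewrite [X in (_ <= X -> _)%E]muleC.
  apply: le_trans; rewrite -esum_mull ?root_law_ge0//.
  rewrite esum_mkcondr; apply: le_esum => t /= <-.
  by case: ifPn => // _; rewrite (prob_gw_tree hxi hfin) -EFinM.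
rewrite esum_mull; first by rewrite (root_law_sum hxi) mule1.
- by rewrite mulr_ge0 ?expR_ge0.
- by move=> i; rewrite lee_fin root_law_ge0.
Qed.

Lemma whp_typed : whp P E (fun=> [set w | (0 < ntype k (tau w))%N]).
Proof.
apply: (whpS mE hE _ _ _ hlarge) => [n|n|].
- exact: (measurable_tau [set t | (0 < ntype k t)%N]).
- exact: (measurable_tau [set t | s n <= (ntype k t)%:R]).
- have /cvgryPgt/(_ 0) := hs; apply: filterS => n sn w /=.
  by move=> /(lt_le_trans sn); rewrite ltr0n.
Qed.

Lemma whp_fringe_density T eps : root_type T = k -> 0 < eps ->
  whp P E (fun=> [set w | `|(count (pred1 T) (fringes (tau w)))%:R /
     (ntype k (tau w))%:R - W T| < eps]).
Proof.
(* The deviation bound is stated for accuracies up to 1, and a smaller accuracy gives a stronger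
   conclusion. *)
move=> Tk e0; pose e := Num.min eps 1.
have ep : 0 < e by rewrite lt_min e0 ltr01.
have e1 : e <= 1 by rewrite ge_min lexx orbT.
have ee : e <= eps by rewrite ge_min lexx.
apply: (whp_exception mE hE (D := fun n => [set w | deviating sigma k T e (s n) (tau w)])) hlarge _.
- by move=> n; exact: (measurable_tau
    [set t | `|(count (pred1 T) (fringes t))%:R / (ntype k t)%:R - W T| < eps]).
- by move=> n; exact: (measurable_tau [set t | s n <= (ntype k t)%:R]).
- by move=> n; exact: measurable_tau.
- have /cvgryPgt/(_ 0) := hs; apply: filterS => n sn w /= large.
  have n0 : 0 < (ntype k (tau w))%:R :> R by exact: lt_le_trans sn large.
  have [le|lt] := leP (e * (ntype k (tau w))%:R)
    `|(count (pred1 T) (fringes (tau w)))%:R - W T * (ntype k (tau w))%:R|; first by right.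
  left; apply: lt_le_trans ee; rewrite -(ltr_pM2r n0); apply: le_lt_trans lt.
  by rewrite -[X in _ * X](gtr0_norm n0) -normrM mulrBl divfK// gt_eqF.
have e8 : 0 < e ^+ 2 / 8 by rewrite divr_gt0// exprn_gt0.
apply/cvgr0Pnorm_le => r r0.
(* Half of [r] makes up for the factor 2 in the bound for two-sided deviations. *)
have r2 : 0 < r / 2 by rewrite divr_gt0.
have /eqoP/(_ _ r2) := hexp e8; apply: filterS => n.
have p0 : 0 < fine (P (E n)) by rewrite fine_gt0// hE/= ltey_eq fin_num_measure.
rewrite (gtr0_norm p0) gtr0_norm ?expR_gt0// => le.
rewrite ger0_norm ?divr_ge0 ?fine_ge0// ler_pdivrMr//.
have := @prob_deviating T e (s n) Tk ep e1.
rewrite -[P _]fineK ?fin_num_measure//; last exact: measurable_tau.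
rewrite lee_fin => /le_trans; apply.
by move: le; move: (expR _) (fine _) => a b; lra.
Qed.

End FringeDensity.

(** * Weak convergence *)

Section TreeSpace.
Variables (R : realType) (G : countType) (k : G).
Let X := treespace R k.

Definition cell (c : tree G * seq (frame G)) : set (mtree G) :=
  [set x | up (size c.2) x = Some (FinM c.1 c.2)].

Lemma tree_dist_le n (x y : mtree G) : fringe n x = fringe n y ->
  tree_dist R x y <= 2^-1 ^+ n.
Proof.
move=> e; rewrite /tree_dist asboolT; last exact: (fringe_le (leq0n n) e).
apply: ge_inf; last by exists n.
by exists 0 => _ [h _ <-]; rewrite exprn_ge0.
Qed.

Lemma tree_dist_lt n (x y : mtree G) : tree_dist R x y < 2^-1 ^+ n ->
  fringe n x = fringe n y.
Proof.
have half_lt1 : (2^-1 : R) <= 1 by rewrite invf_le1// ler1n.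
rewrite /tree_dist; case: asboolP => [e|_]; last first.
  rewrite ltNge; move=> /negP; apply: contra_notP => _.
  by rewrite (@le_trans _ _ 1)// ?ler1n// exprn_ile1.
move=> lt; apply: contrapT => ne; move: lt; rewrite ltNge => /negP; apply.
apply: lb_le_inf; first by exists (2^-1 ^+ 0); exists 0%N.
move=> _ [h ah <-]; apply: ler_wiXn2l => //; rewrite leqNgt; apply/negP => nh.
exact: ne (fringe_le (ltnW nh) ah).
Qed.

Lemma fringe_up n (x y : mtree G) z : up n x = Some z ->
  fringe n x = fringe n y <-> up n y = Some z.
Proof.
move=> ux; rewrite /fringe ux; split; last by move=> ->.
by case: (up n y) => // y' [->].
Qed.

Lemma ball_fringe (x : X) n (y : X) : fringe n x = fringe n y ->
  ball x ((2^-1 : R) ^+ n *+ 2) y.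
Proof.
move=> e; rewrite ballEmdist /=.
apply: le_lt_trans (tree_dist_le e) _.
by rewrite mulr2n ltrDl exprn_gt0.
Qed.

Lemma open_cell c : open (cell c : set X).
Proof.
rewrite openE => x cx; apply/nbhs_ballP; exists (2^-1 ^+ size c.2) => /=.
  by rewrite exprn_gt0.
move=> y; rewrite ballEmdist /= => /tree_dist_lt.
by move/(fringe_up _ cx).
Qed.

Lemma measurable_treespace_cell c : measurable (cell c : set (borel_treespace R k)).
Proof. by apply: sub_gen_smallest; exact: open_cell. Qed.

Lemma continuous_measurable (f : X -> R) : continuous f ->
  measurable_fun setT (f : borel_treespace R k -> R).
Proof.
move=> /continuousP cf; apply: (measurability _ (RGenOpens.measurableE R)).
move=> _ [_ [a [b ->] <-]]; rewrite setTI; apply: sub_gen_smallest.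
apply: cf; exact: interval_open.
Qed.

Lemma continuous_fringe (f : X -> R) t fs (r : R) : continuous f -> 0 < r ->
  exists n, forall y : X, fringe n (InfM t fs) = fringe n y ->
    `|f (InfM t fs) - f y| < r.
Proof.
move=> cf r0.
have /nbhs_ballP[e /= e0 be] := cf (InfM t fs : X) _ (nbhsx_ballx _ _ r0).
have [n ne] : exists n, (2^-1 : R) ^+ n *+ 2 < e.
  have : (fun n => (2^-1 : R) ^+ n) @ \oo --> 0.
    by apply: cvg_expr; rewrite ger0_norm ?invr_ge0// invf_lt1// ltr1n.
  have e2 : 0 < e / 2 by rewrite divr_gt0.
  move=> /cvgrPdist_lt /(_ _ e2) [N _ /(_ N (leqnn N))].
  rewrite /= sub0r normrN ger0_norm// => Ne; exists N.
  by rewrite -mulr_natr -ltr_pdivlMr.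
exists n => y e_xy; have := be y; apply.
by apply: le_ball (ltW ne) _ (ball_fringe e_xy).
Qed.

End TreeSpace.

Section UniformMark.
Variables (R : realType) (G : countType) (k : G).

(** A vertex whose mark lies in the cell has the type of the root of [c.1], so restricting the count
    to type [k] vertices loses nothing. *)
Lemma count_marked_cell h (c : tree G * seq (frame G)) t1 : root_type c.1 = k ->
  spine_level k h c.2 ->
  count (fun u => `[< cell c (mark t1 u) >]) (typed_vertices k t1) =
  count (pred1 (plug c.1 c.2)) (fringes t1).
Proof.
case: c => t a /= tk la.
rewrite -(noccur_fringes t1 tk la (mark_plug t a)) /noccur mark_plug count_filter.
apply: eq_in_count => u; rewrite vertices_nodes => /mapP[[u' t'] /nodesP /= + uE].
rewrite -uE /type_at => su; rewrite su /=; apply/andP/asboolP.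
  by move=> [/asboolP/(typed_fringeP _ tk la)].
move=> /(typed_fringeP _ tk la) up_u; split; first exact/asboolP.
have [b t1E uE'] := subtree_plugP su; move: up_u; rewrite t1E uE' mark_plug /=.
by case: ifP => // _ [-> _]; rewrite tk.
Qed.

Lemma uniform_mark_cell h mu0 (c : tree G * seq (frame G)) t1 : root_type c.1 = k ->
  spine_level k h c.2 -> (0 < ntype k t1)%N ->
  (uniform_mark (R := R) (k := k) mu0 t1 : probability (borel_treespace R k) R) (cell c) =
  ((count (pred1 (plug c.1 c.2)) (fringes t1))%:R / (ntype k t1)%:R)%:E.
Proof.
move=> ck la n0; rewrite -(count_marked_cell t1 ck la).
rewrite /uniform_mark /= /mnormalize /= /msum /=.
have totE : (\sum_(j < ntype k t1) \d_(mark t1 (nth [::] (typed_vertices k t1) j)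
     : borel_treespace R k) [set: borel_treespace R k] = (ntype k t1)%:R%:E :> \bar R)%E.
  under eq_bigr do rewrite diracT.
  by rewrite sumEFin sumr_const card_ord.
rewrite totE /= eqe pnatr_eq0 -leqn0 leqNgt n0 /= EFinM; congr (_ * _)%E.
rewrite (eq_bigr (fun j : 'I_(ntype k t1) =>
  (`[< cell c (mark t1 (nth [::] (typed_vertices k t1) j)) >]%:R)%:E)); last first.
  move=> j _; rewrite /= diracE; congr (_%:R%:E).
rewrite sumEFin; congr EFin; rewrite -sum1_count (big_nth [::]) big_mkord.
rewrite -/(ntype k t1) natr_sum [RHS]big_mkcond.
by apply: eq_bigr => j _; case: asboolP.
Qed.

End UniformMark.

Section CellIntegral.
Variables (R : realType) (G : countType) (k : G).
Variable nu : probability (borel_treespace R k) R.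
Let X := borel_treespace R k.

Let mass c : R := fine (nu (cell c)).

Definition step_fun (C : R) (z : tree G * seq (frame G) -> R) l (x : X) : R :=
  C + \sum_(c <- l) z c * \1_(cell c) x.

Lemma bounded_measurable_integrable (f : X -> R) M : measurable_fun setT f ->
  (forall x, `|f x| <= M) -> nu.-integrable setT (EFin \o f).
Proof.
move=> mf fM; apply: measurable_bounded_integrable => //.
  by rewrite (le_lt_trans (probability_le1 _ _))// ltry.
exists M; split; first by rewrite num_real.
by move=> r Mr x _; apply: le_trans (fM x) (ltW Mr).
Qed.

Lemma integrable_cell z c : nu.-integrable setT (EFin \o (fun x : X => z * \1_(cell c) x)).
Proof.
apply: (@bounded_measurable_integrable _ `|z|).
  apply: measurable_funM => //; apply: measurable_indic.
  exact: measurable_treespace_cell.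
move=> x; rewrite normrM ler_piMr// indicE.
by case: (_ \in _); rewrite ?normr1 ?normr0.
Qed.

Lemma integral_step_fun C z l :
  nu.-integrable setT (EFin \o step_fun C z l) /\
  (\int[nu]_x step_fun C z l x = C + \sum_(c <- l) z c * mass c)%R.
Proof.
have cstI : nu.-integrable setT (EFin \o (fun=> C : R)).
  by apply: (@bounded_measurable_integrable _ `|C|) => //.
elim: l => [|c l [IHi IH]].
  rewrite /step_fun; under eq_fun do rewrite big_nil addr0.
  split=> //; rewrite big_nil addr0 Rintegral_cst//.
  transitivity (C * fine (1%E : \bar R)); last by rewrite mulr1.
  by congr (_ * fine _); exact: probability_setT.
have stepE : step_fun C z (c :: l) = (fun x => z c * \1_(cell c) x) \+ step_fun C z l.
  by apply/funext => x; rewrite /step_fun big_cons /= addrCA.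
have cellI := integrable_cell (z c) c.
rewrite stepE; split.
  exact: (integrableD measurableT cellI IHi).
rewrite RintegralD// IH big_cons addrCA; congr (_ + (_ + _)).
rewrite RintegralZl//.
  congr (_ * _); rewrite /Rintegral; congr fine.
  rewrite integral_indic ?setIT//; exact: measurable_treespace_cell.
have := integrable_cell 1 c; congr (_.-integrable _ _).
by apply/funext => x /=; rewrite mul1r.
Qed.

Variables (f : X -> R) (M r : R) (y : tree G * seq (frame G) -> R).
Variable l : seq (tree G * seq (frame G)).
Hypotheses (mf : measurable_fun setT f) (fM : forall x, `|f x| <= M).
Hypotheses (ul : uniq l) (r0 : 0 <= r)
  (fl : forall c x, c \in l -> cell c x -> `|f x - y c| <= r)
  (dl : forall c c' x, c \in l -> c' \in l -> cell c x -> cell c' x -> c = c').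

(** On a cell of [l] the constants [M] cancel and [y c] is left with an error [r]; outside all cells
    only the crude bound [r + M] remains. Integrals are thus controlled by the masses of the cells
    in [l] alone. *)
Lemma step_fun_bound x :
  step_fun (- r - M) (fun c => y c + M) l x <= f x <= step_fun (r + M) (fun c => y c - M) l x.
Proof.
have fx := fM x; have M0 : 0 <= M by exact: le_trans fx.
have [[c cl cx]|nc] := pselect (exists2 c, c \in l & cell c x).
  have sumE z : \sum_(c' <- l) z c' * \1_(cell c') x = z c :> R.
    rewrite (bigD1_seq c)//= indicE mem_set// mulr1 big_seq_cond big1 ?addr0//.
    move=> c' /andP[c'l c'c]; rewrite indicE memNset ?mulr0// => c'x.
    by rewrite (dl c'l cl c'x cx) eqxx in c'c.
  rewrite /step_fun !sumE; have := fl cl cx; rewrite ler_norml => /andP[].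
  by move: (f x) (y c) => a b /= h1 h2; apply/andP; split; lra.
have sumE z : \sum_(c' <- l) z c' * \1_(cell c') x = 0 :> R.
  rewrite big_seq big1// => c' c'l; rewrite indicE memNset ?mulr0// => c'x.
  by apply: nc; exists c'.
rewrite /step_fun !sumE; move: fx; rewrite ler_norml => /andP[].
by move: r0 (f x) => r0p a /= h1 h2; apply/andP; split; lra.
Qed.

Lemma integral_cells_bound :
  - r - M + \sum_(c <- l) (y c + M) * mass c <= \int[nu]_x f x /\
  \int[nu]_x f x <= r + M + \sum_(c <- l) (y c - M) * mass c.
Proof.
have fI := bounded_measurable_integrable mf fM.
have [lI <-] := integral_step_fun (- r - M) (fun c => y c + M) l.
have [uI <-] := integral_step_fun (r + M) (fun c => y c - M) l.
by split; apply: le_Rintegral => // x _; have /andP[] := step_fun_bound x.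
Qed.

End CellIntegral.

(** * Cells on which a continuous function is almost constant *)

Section GoodCells.
Context d (Omega : measurableType d) (R : realType) (P : probability Omega R).
Context d' (Omega' : measurableType d') (P' : probability Omega' R).
Variables (G : countType) (k : G) (sigma : G -> seq G -> R) (alpha : Omega -> G)
  (xi : seq nat -> G -> Omega -> seq G).
Hypothesis hxi : branching_family P sigma alpha xi.
Variables (T0 : Omega' -> tree G) (H : nat -> Omega' -> tree G * seq nat)
  (Tk : nat -> seq nat -> Omega' -> tree G).
Hypothesis hspine : spine_family P P' k xi T0 H Tk.
Hypothesis hcrit : (\int[P]_w ((ntype k (gw_tree_stopped xi k w))%:R)%:E
              = 2%:E :> \bar R)%E.
Variable f : treespace R k -> R.
Hypothesis cf : continuous f.
Variable r : R.
Hypothesis r0 : 0 < r.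

Let limit := limit_tree k T0 H Tk.

Definition flat (c : tree G * seq (frame G)) : Prop :=
  exists y, forall x, cell c x -> `|f x - y| <= r.

(* Among the nested cells of a point, the first one on which [f] oscillates
   little; these cells are pairwise disjoint. *)
Definition first_flat : set (tree G * seq (frame G)) :=
  [set c | [/\ root_type c.1 = k, exists h, spine_level k h c.2, flat c &
    forall a b h, c.2 = a ++ b -> spine_level k h a -> flat (c.1, a) -> b = [::]]].

(** Cells with a common point are nested, the frames of one being a prefix of those of the other;
    minimality of the longer one forces equality. *)
Lemma first_flat_disjoint c c' x : first_flat c -> first_flat c' ->
  cell c x -> cell c' x -> c = c'.
Proof.
wlog le : c c' / (size c.2 <= size c'.2)%N.
  move=> hw fc fc' cx c'x; case: (leqP (size c.2) (size c'.2)) => [le|/ltnW le].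
    exact: hw.
  by apply/esym; exact: hw.
case: c c' le => [t a] [t' a'] /= le [tk [h la] fa _] [_ _ _ min'] /= cx c'x.
rewrite /cell /= in cx c'x.
move: cx; rewrite (up_up le c'x) /= le => -[tt' aE].
have a'E : a' = a ++ drop (size a) a' by rewrite -{1}aE cat_take_drop.
have fl : flat (t', a) by rewrite tt'.
by have d0 := min' _ _ _ a'E la fl; rewrite d0 cats0 in a'E; rewrite tt' a'E.
Qed.

Lemma first_flat_cover w : valid_spine k T0 H Tk w ->
  exists2 c, first_flat c & cell c (limit w).
Proof.
move=> vw; have [T0k _ _] := vw.
pose B := block_frames k H Tk w.
have vB i : is_block k (B i) by exact: (is_block_block_frames i vw).
pose a n := prefix_frames B n.
have la n : spine_level k n (a n) by exact: spine_level_prefix_frames.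
have up_a n : up (size (a n)) (limit w) = Some (FinM (T0 w) (a n)).
  exact: up_prefix_frames.
have ex : exists n, `[< flat (T0 w, a n) >].
  have [n fn] := continuous_fringe (T0 w)
    (fun n => nth (k, [::], [::]) (a n.+1) n) cf r0.
  exists n; apply/asboolP; exists (f (limit w)) => x cx.
  rewrite distrC; apply/ltW/fn.
  (* The first [n] blocks contain at least [n] frames, so their cell fixes the fringe subtree at
     height [n] that continuity asks for. *)
  apply: (fringe_le (size_prefix_frames vB n)).
  by apply/(fringe_up _ (up_a n)).
have [n /asboolP fn nmin] := ex_minnP ex.
exists (T0 w, a n); last exact: up_a.
split=> //=; first by exists n.
move=> a' b h aE la' fa'.
have hn : (h <= n)%N.
  have /andP[/eqP <- _] := la' ; have /andP[/eqP <- _] := la n.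
  by rewrite aE count_cat leq_addr.
have ah : a h = a'.
  have /prefixP[s anE] := prefix_frames_prefix B hn.
  by apply: (spine_level_prefix (b := s) (b' := b) (la h) la'); rewrite -anE.
have : (n <= h)%N by apply: nmin; apply/asboolP; rewrite ah.
move=> nh; have nhE : n = h by apply/eqP; rewrite eqn_leq nh.
move: (congr1 size aE); rewrite size_cat nhE ah => /eqP.
by rewrite -{1}[size a']addn0 eqn_add2l eq_sym => /nilP.
Qed.

Lemma esum_first_flat (mu : law R k) :
  (forall A : set (borel_treespace R k), measurable A ->
    (mu : probability (borel_treespace R k) R) A = P' (limit @^-1` A)) ->
  (\esum_(c in first_flat) (mu : probability (borel_treespace R k) R) (cell c) = 1)%E.
Proof.
(* Indexing the cells by their codes turns the sum into the measure of a countable disjoint union,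
   which contains the limit tree almost surely. *)
move=> hmu; pose F (n : nat) : set (borel_treespace R k) :=
  if @unpickle (tree G * seq (frame G))%type n is Some c then cell c else set0.
have FE c : F (pickle c) = cell c by rewrite /F pickleK.
have mF n : measurable (F n).
  by rewrite /F; case: unpickle => [c|]; [exact: measurable_treespace_cell|exact: measurable0].
have tF : trivIset (pickle @` first_flat) F.
  move=> _ _ [c fc <-] [c' fc' <-] [x []]; rewrite !FE => cx c'x.
  by rewrite (first_flat_disjoint fc fc' cx c'x).
transitivity ((mu : probability (borel_treespace R k) R)
    (\bigcup_(n in pickle @` first_flat) F n)).
  rewrite measure_bigcup// nneseries_esum// esum_mkcond.
  rewrite [in RHS](_ : [set x | _] = pickle @` first_flat); last first.
    by apply/seteqP; split=> n /=; [move/set_mem|move=> ?; exact/mem_set].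
  rewrite esum_image; last by move=> c c' _ _ /(pcan_inj pickleK).
  by rewrite [RHS]esum_mkcond; apply: eq_esum => c _; rewrite FE.
have mU : measurable (\bigcup_(n in pickle @` first_flat) F n).
  by apply: bigcup_measurable.
rewrite hmu// -(probability_setT P'); apply: prob_ae_eq => //.
  rewrite preimage_bigcup; apply: bigcup_measurable => _ [c fc <-].
  rewrite FE.
  exact: (measurable_up_limit_tree hspine (size c.2) [set Some (FinM c.1 c.2)]).
apply: filterS (ae_valid_spine hxi hspine hcrit) => w vw; split=> // _.
have [c fc cw] := first_flat_cover vw.
by exists (pickle c); [exists c|rewrite FE].
Qed.

End GoodCells.

(** * The two forms of convergence *)

Lemma whp_all d (Omega : measurableType d) (R : realType) (P : probability Omega R)
    (E : nat -> set Omega) (mE : forall n, measurable (E n))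
    (hE : forall n, (0 < P (E n))%E) (I : eqType) (l : seq I)
    (A : I -> nat -> set Omega) :
  (forall i n, measurable (A i n)) -> (forall i, i \in l -> whp P E (A i)) ->
  whp P E (fun n => \bigcap_(i in [set` l]) A i n).
Proof.
move=> mA; elim: l => [_|i l IH wA].
  rewrite (_ : (fun n => _) = fun=> setT); first exact: whpT.
  by apply/funext => n; rewrite set_nil bigcap_set0.
have mI n : measurable (\bigcap_(j in [set` l]) A j n).
  by apply: fin_bigcap_measurable => [|j _]; [exact: finite_seq|exact: mA].
have := whpI mE hE (mA i) mI (wA i (mem_head _ _))
  (IH (fun j jl => wA j (mem_behead (s := i :: l) jl))).
rewrite (_ : (fun n => A i n `&` _) = fun n => \bigcap_(j in [set` i :: l]) A j n)//.
apply/funext => n; apply/seteqP; split=> w.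
  by move=> [Ai Al] j; rewrite /= inE => /predU1P[->//|jl]; exact: Al.
move=> H; split; first by apply: H; rewrite /= mem_head.
by move=> j jl; apply: H; rewrite /= inE (jl : j \in l) orbT.
Qed.

Section MainResult.
Context (R : realType) (G : countType) (k : G)
  (d : measure_display) (Omega : measurableType d) (P : probability Omega R)
  (sigma : G -> seq G -> R) (alpha : Omega -> G)
  (xi : seq nat -> G -> Omega -> seq G).
Hypotheses (hxi : branching_family P sigma alpha xi)
  (hreach : (0 < P [set w | ntype k (gw_tree xi alpha w) != 0%N])%E)
  (hfin : {ae P, forall w, gw_finite xi alpha w}).
Context (d' : measure_display) (Omega' : measurableType d') (P' : probability Omega' R)
  (T0 : Omega' -> tree G) (H : nat -> Omega' -> tree G * seq nat)
  (Tk : nat -> seq nat -> Omega' -> tree G).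
Hypothesis hspine : spine_family P P' k xi T0 H Tk.
Context (mu : law R k).
Hypothesis hmu : forall A : set (borel_treespace R k), measurable A ->
    (mu : probability (borel_treespace R k) R) A
      = P' (limit_tree k T0 H Tk @^-1` A).
Context (E : nat -> set Omega).
Hypotheses (mE : forall n, measurable (E n)) (hE : forall n, (0 < P (E n))%E)
  (hcrit : (\int[P]_w ((ntype k (gw_tree_stopped xi k w))%:R)%:E
              = 2%:E :> \bar R)%E).
Context (s : nat -> R).
Hypotheses (hs : s n @[n --> \oo] --> +oo)
  (hexp : forall eps : R, 0 < eps ->
    (fun n => expR (- (eps * s n))) =o_\oo (fun n => fine (P (E n))))
  (hlarge : cond_prob P (E n)
      [set w | s n <= (ntype k (gw_tree xi alpha w))%:R] @[n --> \oo]
    --> (1 : R)).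

Let W := weight sigma.
Let tau := gw_tree xi alpha.
Let mtau : discretely_measurable tau := measurable_gw_tree hxi.

Lemma law_cell h (c : tree G * seq (frame G)) : root_type c.1 = k ->
  spine_level k h c.2 ->
  (mu : probability (borel_treespace R k) R) (cell c) = (W (plug c.1 c.2))%:E.
Proof.
move=> ck la; rewrite hmu; last exact: measurable_treespace_cell.
rewrite -(prob_cell hxi hreach hfin hspine hcrit ck la); congr (P' _).
by apply/seteqP; split=> w /(typed_fringeP _ ck la).
Qed.

Lemma whp_integrate (mu0 : tree G -> law R k) (f : bounded_continuous R k) eps : 0 < eps ->
  whp P E (fun=> [set w | `|integrate mu f -
    integrate (uniform_mark (mu0 (tau w)) (tau w)) f| < eps]).
Proof.
move=> e0; case: f => f [cf bf].
have [M M0 fM] : exists2 M : R, 0 < M & forall x, `|f x| <= M.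
  have [N [_ fN]] := bf; exists (`|N| + 1); first by rewrite ltr_wpDl.
  by move=> x; apply: fN => //; rewrite (le_lt_trans (ler_norm _))// ltrDl.
(* The integrals against [mu] and against the uniform law will differ from the same finite sum by at
   most [2 * r] and [3 * r], so [eps / 8] leaves room. *)
pose r := eps / 8; have r0 : 0 < r by rewrite divr_gt0.
pose K := first_flat f r.
have K1 := esum_first_flat hxi hspine hcrit cf r0 hmu.
have : ((1 - r / M)%:E < \esum_(c in K) (mu : probability (borel_treespace R k) R) (cell c))%E.
  by rewrite K1 lte_fin ltrBlDr ltrDl divr_gt0.
(* Finitely many cells miss a mass below [r / M], on which a function bounded by [M] contributes
   less than [r]. *)
move=> /ereal_sup_gt[_ [X [finX XK] <-]]; rewrite fsbig_finite//=.
set l := finmap.enum_fset _; have ul : uniq l by exact: finmap.fset_uniq.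
have lK c : c \in l -> K c by rewrite in_fset_set// => /set_mem/XK.
pose N c t : R := (count (pred1 (plug c.1 c.2)) (fringes t))%:R / (ntype k t)%:R.
pose w_ c := W (plug c.1 c.2).
have muE c : c \in l -> (mu : probability (borel_treespace R k) R) (cell c) = (w_ c)%:E.
  by move=> /lK[ck [h la] _ _]; exact: law_cell la.
rewrite big_seq (eq_bigr (fun c => (w_ c)%:E)); last by move=> c /muE.
rewrite -big_seq sumEFin lte_fin => mass.
pose y (c : tree G * seq (frame G)) : R :=
  xget 0 [set y | forall x, cell c x -> `|f x - y| <= r].
have fy c x : c \in l -> cell c x -> `|f x - y c| <= r.
  by move=> /lK[_ _ fl _] cx; apply: (xgetPex 0 fl).
have dl c c' x : c \in l -> c' \in l -> cell c x -> cell c' x -> c = c'.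
  by move=> /lK Kc /lK Kc'; exact: (first_flat_disjoint Kc Kc').
pose Z := \sum_(c <- l) (`|y c| + M).
have Z0 : 0 <= Z by apply: sumr_ge0 => c _; rewrite addr_ge0// ltW.
(* [Z] bounds the total of the coefficients [y c + M] and [y c - M], so replacing each limiting mass
   within [eta] costs at most [r]; adding 1 guards against [Z = 0]. *)
pose eta := r / (Z + 1); have eta0 : 0 < eta by rewrite divr_gt0// ltr_wpDl.
pose A c (n : nat) := [set w | `|N c (tau w) - w_ c| < eta].
have mB (B : set (tree G)) : measurable [set w | B (tau w)] by exact: mtau.
have mA c n : measurable (A c n) by exact: (mB [set t | `|N c t - w_ c| < eta]).
have wA c : c \in l -> whp P E (A c).
  move=> /lK[ck [h la] _ _].
  exact: (whp_fringe_density hxi hfin mE hE hs hexp hlarge (root_type_plug ck la)).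
pose pos (n : nat) := [set w | (0 < ntype k (tau w))%N].
have wpos : whp P E pos by exact: (whp_typed hxi mE hE hs hlarge).
have mI n : measurable (\bigcap_(c in [set` l]) A c n).
  by apply: fin_bigcap_measurable => [|c _]; [exact: finite_seq|exact: mA].
have mpos n : measurable (pos n) by exact: (mB [set t | (0 < ntype k t)%N]).
have wI := whpI mE hE mpos mI wpos (whp_all mE hE mA wA).
apply: (whpS mE hE _ _ _ wI).
- move=> n; exact: (mB [set t | `|integrate mu (exist _ f (conj cf bf)) -
    integrate (uniform_mark (mu0 t) t) (exist _ f (conj cf bf))| < eps]).
- by move=> n; exact: measurableI.
apply: nearW => n w [/= n0 Aw]; rewrite /integrate /=.
set nu := uniform_mark _ _.
have nuE c : c \in l -> fine ((nu : probability (borel_treespace R k) R) (cell c)) = N c (tau w).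
  by move=> /lK[ck [h la] _ _]; rewrite (uniform_mark_cell _ ck la n0).
have mf := continuous_measurable cf.
have [lo_mu up_mu] := integral_cells_bound mu mf fM ul (ltW r0) fy dl.
have [lo_nu up_nu] := integral_cells_bound nu mf fM ul (ltW r0) fy dl.
pose D c := N c (tau w) - w_ c.
have Dle z : (forall c, `|z c| <= `|y c| + M) -> \sum_(c <- l) z c * D c <= r.
  move=> zle; apply: (@le_trans _ _ (Z * eta)).
    rewrite /Z mulr_suml big_seq [leRHS]big_seq; apply: ler_sum => c cl.
    apply: le_trans (ler_norm _) _; rewrite normrM ler_pM//.
    by apply/ltW/(Aw c).
  by rewrite /eta mulrCA ler_piMr ?ltW// ltr_pdivrMr ?ltr_wpDl// mul1r ltrDl.
have muS z : \sum_(c <- l) z c * fine ((mu : probability (borel_treespace R k) R) (cell c)) =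
    \sum_(c <- l) z c * w_ c.
  by apply: eq_big_seq => c cl; rewrite muE.
have nuS z : \sum_(c <- l) z c * fine ((nu : probability (borel_treespace R k) R) (cell c)) =
    \sum_(c <- l) z c * w_ c + \sum_(c <- l) z c * D c.
  rewrite -big_split /=; apply: eq_big_seq => c cl.
  by rewrite nuE// /D -mulrDr addrC subrK.
rewrite !muS in lo_mu up_mu; rewrite !nuS in lo_nu up_nu.
have split_w (z : R) : \sum_(c <- l) (y c + z) * w_ c =
    \sum_(c <- l) y c * w_ c + z * \sum_(c <- l) w_ c.
  by rewrite mulr_sumr -big_split; apply: eq_bigr => c _; rewrite /= mulrDl.
rewrite !split_w in lo_mu up_mu lo_nu up_nu.
have D1 : \sum_(c <- l) (y c - M) * D c <= r.
  by apply: Dle => c; rewrite (le_trans (ler_normB _ _))// (gtr0_norm M0).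
have D2 : - (\sum_(c <- l) (y c + M) * D c) <= r.
  rewrite -sumrN (eq_bigr (fun c => (- (y c + M)) * D c)); last first.
    by move=> c _; rewrite mulNr.
  by apply: Dle => c; rewrite normrN (le_trans (ler_normD _ _))// (gtr0_norm M0).
have massM : M - r < M * \sum_(c <- l) w_ c.
  have := mass; rewrite -(ltr_pM2l M0); apply: le_lt_trans.
  by rewrite mulrBr mulr1 mulrCA divff ?mulr1// gt_eqF.
have er : eps = 8 * r by rewrite /r mulrCA divff ?mulr1.
move: lo_mu up_mu lo_nu up_nu D1 D2 massM.
rewrite er !mulNr ltr_norml; move: (\sum_(c <- l) y c * w_ c) (M * _) => a b.
move: (\int[_]_x _)%R (\int[_]_x _)%R => I1 I2.
move: (\sum_(c <- l) _) (\sum_(c <- l) _) => S1 S2.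
move=> h1 h2 h3 h4 h5 h6 h7; apply/andP; split; lra.
Qed.

(** The sets of laws that are hit with conditional probability tending to 1 form a filter. Its
    convergence to [mu] in the initial topology is convergence of the image under [integrate] in a
    product topology, hence can be tested on one function at a time. *)
Lemma cvg_uniform_mark (mu0 : tree G -> law R k) :
  cvg_in_prob P E (fun _ w => uniform_mark (mu0 (tau w)) (tau w)) mu.
Proof.
have mV (V : set (law R k)) : measurable [set w | V (uniform_mark (mu0 (tau w)) (tau w))].
  exact: (mtau [set t | V (uniform_mark (mu0 t) t)]).
pose F : set_system (law R k) :=
  [set V | whp P E (fun=> [set w | V (uniform_mark (mu0 (tau w)) (tau w))])].
have FF : Filter F.
  split; first exact: whpT.
  - move=> V V' FV FV'; exact: (whpI mE hE _ _ FV FV').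
  - move=> V V' VV' FV; apply: (whpS mE hE _ _ _ FV) => //.
    by apply: nearW => n w; exact: VV'.
pose F' : set_system {ptws bounded_continuous R k -> R} :=
  [set A | F (integrate (k := k) @^-1` A)].
have FF' : Filter F'.
  split; first exact: filterT.
    by move=> A B FA FB; exact: filterI FA FB.
  by move=> A B AB FA; apply: (@filterS _ F FF _ _ _ FA) => nu; exact: AB.
have cvF : cvg_to F' (nbhs (integrate mu)).
  (* Closure of the filter under finite intersections is what reduces a weak neighbourhood to a
     single coordinate [f]. *)
  apply/cvg_sup => f A; rewrite nbhsE => -[_ [[D oD <-] Df] DA].
  have /nbhs_ballP[e /= e0 eD] := open_nbhs_nbhs (conj oD Df).
  have := whp_integrate mu0 f e0; apply: (whpS mE hE) => [n|n|].
  - exact: (mV (integrate (k := k) @^-1` A)).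
  - exact: (mtau [set t | `|integrate mu f - integrate (uniform_mark (mu0 t) t) f| < e]).
  - by apply: nearW => n w we; apply: DA; exact: eD.
move=> U; rewrite nbhsE => -[_ [[D oD <-] Dmu] DU].
have FD := cvF _ (open_nbhs_nbhs (conj oD Dmu)).
exact: (filterS DU FD : F U).
Qed.

Lemma cvg_noccur (t : tree G) (v : seq nat) (h : nat) :
    root_type t = k -> type_at t v = Some k -> path_ntype k t v = h.+1 ->
  cvg_in_prob P E
    (fun _ w => (noccur k h t v (tau w))%:R / (ntype k (tau w))%:R : R)
    (fine (P' [set w | typed_fringe k h (limit_tree k T0 H Tk w) = (mark t v, false)])).
Proof.
move=> tk vk hv; have [t0 [a [tE vE t0k la]]] := marked_tree_plug tk vk hv.
have mE' : mark t v = FinM t0 a by rewrite tE vE mark_plug.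
rewrite mE' (prob_cell hxi hreach hfin hspine hcrit t0k la) /= -tE -/W => U.
move=> /nbhs_ballP[e /= e0 eU].
have := whp_fringe_density hxi hfin mE hE hs hexp hlarge tk e0.
pose q t1 : R := (noccur k h t v t1)%:R / (ntype k t1)%:R.
apply: (whpS mE hE) => [n|n|].
- exact: (mtau [set t1 | U (q t1)]).
- exact: (mtau [set t1 | `|(count (pred1 t) (fringes t1))%:R / (ntype k t1)%:R
    - weight sigma t| < e]).
- apply: nearW => n w we; apply: eU.
  by rewrite /ball /= distrC (noccur_fringes _ t0k la mE') -tE.
Qed.

End MainResult.

Theorem theorem1 (R : realType) (G : countType) (kappa : G)
  (* the branching tree *)
  (d : measure_display) (Omega : measurableType d) (P : probability Omega R)
  (sigma : G -> seq G -> R) (alpha : Omega -> G)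
  (xi : seq nat -> G -> Omega -> seq G)
  (hxi : branching_family P sigma alpha xi)
  (hreach : forall i, (0 < P [set w | ntype i (gw_tree xi alpha w) != 0%N])%E)
  (hfin : {ae P, forall w, gw_finite xi alpha w})
  (* the limit tree and its law *)
  (d' : measure_display) (Omega' : measurableType d') (P' : probability Omega' R)
  (T0 : Omega' -> tree G) (H : nat -> Omega' -> tree G * seq nat)
  (Tk : nat -> seq nat -> Omega' -> tree G)
  (hspine : spine_family P P' kappa xi T0 H Tk)
  (mu : law R kappa)
  (hmu : forall A : set (borel_treespace R kappa), measurable A ->
    (mu : probability (borel_treespace R kappa) R) A
      = P' (limit_tree kappa T0 H Tk @^-1` A))
  (* the conditioning events *)
  (E : nat -> set Omega) (mE : forall n, measurable (E n))
  (hE : forall n, (0 < P (E n))%E)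
  (hcrit : (\int[P]_w ((ntype kappa (gw_tree_stopped xi kappa w))%:R)%:E
              = 2%:E :> \bar R)%E)
  (s : nat -> R) (hs : s n @[n --> \oo] --> +oo)
  (hexp : forall eps : R, 0 < eps ->
    (fun n => expR (- (eps * s n))) =o_\oo (fun n => fine (P (E n))))
  (hlarge : cond_prob P (E n)
      [set w | s n <= (ntype kappa (gw_tree xi alpha w))%:R] @[n --> \oo]
    --> (1 : R))
  (mu0 : tree G -> law R kappa) :
  cvg_in_prob P E
    (fun _ w => uniform_mark (mu0 (gw_tree xi alpha w)) (gw_tree xi alpha w)) mu
  /\
  forall (t : tree G) (v : seq nat) (h : nat),
    root_type t = kappa -> type_at t v = Some kappa ->
    path_ntype kappa t v = h.+1 ->
    cvg_in_prob P E
      (fun _ w => (noccur kappa h t v (gw_tree xi alpha w))%:R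
                    / (ntype kappa (gw_tree xi alpha w))%:R : R)
      (fine (P' [set w | typed_fringe kappa h (limit_tree kappa T0 H Tk w)
                           = (mark t v, false)])).
Proof.
split.
  exact: (cvg_uniform_mark hxi (hreach kappa) hfin hspine hmu mE hE hcrit hs hexp hlarge).
exact: (cvg_noccur hxi (hreach kappa) hfin hspine mE hE hcrit hs hexp hlarge).
Qed.
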